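(* Let $\zeta\in\mathbb C\setminus\{0\}$ and $\mathcal A_\zeta:=\{a/b: a,b\in\mathcal A,\ b(\zeta)\neq0\}$. Let $\lambda$ be a partition of $n$, $t$ a standard $\lambda$-tableau, and $1\le r\le s\le n$. For $m\le n$ let $\lambda^{\le m}$ be the shape of the tableau obtained from $t$ by deleting the nodes containing $m+1,\dots,n$, and write $\lambda^{<r}:=\lambda^{\le r-1}$. Let $t^{\le}=t^{\le}_{|r,\dots,s}$ be the $\lambda^{\le s}$-tableau that agrees with $t$ on the nodes containing $r,r+1,\dots,s$ and has $1,2,\dots,r-1$ filled in along rows (top row first) in the remaining nodes. Let $U:=f_{t^{\le}}\,\mathcal H_{\mathcal A_\zeta,r-1}\subseteq S^{\lambda^{\le s}}$ (the $\mathcal A_\zeta$-span of $f_{t^\le}h$, $h\in\mathcal H_{\mathcal A_\zeta,r-1}$, inside the Specht module over $\mathcal K$ for $\mathcal H_{\mathcal K,s}$). Then the rule $f_{t^{\le}}\mapsto e_{\lambda^{<r}}$ defines an isomorphism of $\mathcal H_{\mathcal A_\zeta,r-1}$-modules $\varphi:U\to S^{\lambda^{<r}}_{\mathcal A_\zeta}$.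
   Context: $\mathcal A=\mathbb C[q,q^{-1}]$, $\mathcal K=\mathbb C(q)$. $\mathcal H_{\mathcal A,m}$ is the Iwahori–Hecke algebra over $\mathcal A$ with generators $T_1,\dots,T_{m-1}$ and relations $T_iT_j=T_jT_i$ for $|i-j|>1$, $T_iT_jT_i=T_jT_iT_j$ for $|i-j|=1$, $(T_i-q)(T_i+1)=0$; $\mathcal H_{\mathcal B,m}=\mathcal H_{\mathcal A,m}\otimes_{\mathcal A}\mathcal B$; $\mathcal H_{\mathcal B,m'}\subset\mathcal H_{\mathcal B,m}$ for $m'\le m$ via $T_i\mapsto T_i$. Permutations compose left to right; $s_i=(i,i+1)$; $T_w=T_{i_1}\cdots T_{i_N}$ for reduced $w=s_{i_1}\cdots s_{i_N}$. $[k]_q=(q^k-1)/(q-1)$. For a partition $\nu$ of $m$: a $\nu$-tableau is a bijective filling of its diagram with $1,\dots,m$; standard = increasing along rows and columns; $t^\nu$ has $1,\dots,m$ filled along rows, top first; $S_m$ acts on the right on tableaux by permuting entries and $t=t^\nu d(t)$. Specht module: $x_\nu=\sum_{w\in S_\nu}T_w$ ($S_\nu$ the row stabilizer of $t^\nu$), $x_{uv}=T_{d(u)^{-1}}x_\nu T_{d(v)}$, $\overline N_\nu$ the $\mathcal A$-span of $x_{uv}$ for $\rho$-tableaux $u,v$ with $\rho$ strictly dominating $\nu$; $S^\nu_{\mathcal A}$ is the right $\mathcal H_{\mathcal A,m}$-module generated by $x_\nu+\overline N_\nu$, with basis $e_v=x_{t^\nu v}+\overline N_\nu$, $v$ standard;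 $e_\nu=e_{t^\nu}$; $S^\nu_{\mathcal B}=S^\nu_{\mathcal A}\otimes\mathcal B$, $S^\nu=S^\nu_{\mathcal K}$. Seminormal basis of $S^\nu$: $L_p=\sum_{i=1}^{p-1}q^{-i}T_{(p-i,p)}$; residue of node $(r,c)$ is $[c-r]_q$; $r_v(p)$ = residue of the node containing $p$ in $v$; $\mathrm R$ = set of residues of nodes of partitions of $m$; $E_v=\prod_{p=1}^m\prod_{c\in\mathrm R\setminus\{r_v(p)\}}\frac{L_p-c}{r_v(p)-c}$, $f_v=e_vE_v$. *)

(* Defs.v *)
From mathcomp Require Import all_boot all_algebra all_fingroup.
From mathcomp Require Import complex fraction.
From mathcomp Require Import Rstruct.
Set Implicit Arguments.
Unset Strict Implicit.
Unset Printing Implicit Defensive.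
Import GRing.Theory.
Local Open Scope ring_scope.

Definition C : fieldType := (Rdefinitions.R)[i].
Definition K : fieldType := {fraction {poly C}}.
Definition polyK (p : {poly C}) : K := FracField.tofrac p.
Definition q : K := polyK 'X.

Definition inA (x : K) : Prop := exists (p : {poly C}) (k : nat), x = polyK p / q ^+ k.

Definition evalL (zeta : C) (p : {poly C}) (k : nat) : C := p.[zeta] / zeta ^+ k.

Definition inAz (zeta : C) (x : K) : Prop :=
  exists (a : {poly C}) (ka : nat) (b : {poly C}) (kb : nat),
    evalL zeta b kb != 0 /\ x = (polyK a / q ^+ ka) / (polyK b / q ^+ kb).

(* Permutations.  'S_m acts on 'I_m = {0,...,m-1}, which encodes        *)
(* {1,...,m}.  MathComp's product is left-to-right: (u * w) x = w (u x), *)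
(* matching the paper's convention.                                     *)
(* the simple transposition s_{i+1} = (i+1, i+2) (0-based: swaps i, i+1) *)
Definition sgen (m i : nat) : 'S_m :=
  match @insub _ (fun x => x < m)%N _ i, @insub _ (fun x => x < m)%N _ i.+1 with
  | Some a, Some b => tperm (a : 'I_m) b
  | _, _ => 1%g
  end.

Definition tpn (m a b : nat) : 'S_m :=
  match @insub _ (fun x => x < m)%N _ a, @insub _ (fun x => x < m)%N _ b with
  | Some x, Some y => tperm (x : 'I_m) y
  | _, _ => 1%g
  end.

Definition plen m (w : 'S_m) : nat :=
  #|[set p : 'I_m * 'I_m | (p.1 < p.2)%N && (w p.2 < w p.1)%N]|.

Definition pnat m (w : 'S_m) (k : nat) : nat :=
  if @insub _ (fun x => x < m)%N 'I_m k is Some i then val (w i) else k.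

(* permutation built from a nat function (identity if not a bijection of [0,m)) *)
Definition perm_of_nat m (f : nat -> nat) : 'S_m :=
  insubd (1%g : 'S_m) [ffun k : 'I_m => insubd k (f k) : 'I_m].

Definition plift a b (w : 'S_a) : 'S_b := perm_of_nat b (pnat w).

(* a reduced word: w = s_{i1} ... s_{iN} (left to right) *)
Fixpoint rword_rec m (fuel : nat) (w : 'S_m) : seq nat :=
  match fuel with
  | 0 => [::]
  | fuel'.+1 =>
      match [pick i : 'I_m | (plen (w * sgen m i)%g < plen w)%N] with
      | Some i => rcons (rword_rec fuel' (w * sgen m i)%g) (i : nat)
      | None => [::]
      end
  end.
Definition rword m (w : 'S_m) : seq nat := rword_rec (plen w) w.

(* The Iwahori-Hecke algebra H_{K,m}: an element is its coefficient      *)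
(* vector on the basis (T_w)_{w in S_m}.                                *)
Definition hecke (m : nat) := {ffun 'S_m -> K}.

Definition hT m (w : 'S_m) : hecke m := [ffun v => (v == w)%:R].
Definition hone m : hecke m := hT 1%g.
Definition hadd m (h g : hecke m) : hecke m := [ffun w => h w + g w].
Definition hscale m (c : K) (h : hecke m) : hecke m := [ffun w => c * h w].
Definition hsub m (h g : hecke m) : hecke m := [ffun w => h w - g w].

(* right multiplication by the generator T_{s_{i+1}} (0-based i):
   T_v T_s = T_{vs} if l(vs) > l(v), and q T_{vs} + (q-1) T_v otherwise *)
Definition hmulTs m (h : hecke m) (i : nat) : hecke m :=
  [ffun w => if (plen (w * sgen m i)%g < plen w)%N
             then h (w * sgen m i)%g + (q - 1) * h w
             else q * h (w * sgen m i)%g].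

Definition hmulT m (h : hecke m) (w : 'S_m) : hecke m := foldl (@hmulTs m) h (rword w).

Definition hmul m (h g : hecke m) : hecke m :=
  [ffun x => \sum_(w : 'S_m) g w * hmulT h w x].

Definition hsum m (s : seq (hecke m)) : hecke m := foldr (@hadd m) [ffun=> 0] s.
Definition hprod m (s : seq (hecke m)) : hecke m := foldr (@hmul m) (hone m) s.

Definition hincl a b (h : hecke a) : hecke b :=
  hsum [seq hscale (h w) (hT (plift b w)) | w <- enum [set: 'S_a]].

Definition inHAz (zeta : C) m (h : hecke m) : Prop := forall w, inAz zeta (h w).

(* A partition is a nonincreasing seq of positive nats.  The nodes of    *)
(* nu are indexed by their position 0,1,...,|nu|-1 in the row reading   *)
(* order (rows top to bottom, left to right): position k is the node    *)
(* of t^nu containing k+1.  Rows and columns are 0-based.               *)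
(* A nu-tableau t is represented by d(t) in S_m (t = t^nu d(t)): the    *)
(* node at position k contains d(t)(k) (0-based entries).                *)
Definition is_partition_of (m : nat) (nu : seq nat) : bool :=
  [&& sorted geq nu, all (fun x => 0 < x)%N nu & sumn nu == m].

Fixpoint rowof (nu : seq nat) (k : nat) : nat :=
  match nu with
  | [::] => 0
  | a :: nu' => if (k < a)%N then 0 else (rowof nu' (k - a)).+1
  end.
Fixpoint colof (nu : seq nat) (k : nat) : nat :=
  match nu with
  | [::] => k
  | a :: nu' => if (k < a)%N then k else colof nu' (k - a)
  end.
Definition posof (nu : seq nat) (r c : nat) : nat := (sumn (take r nu) + c)%N.

Definition dominates (rho nu : seq nat) : bool :=
  [forall i : 'I_(size rho + size nu).+1, (sumn (take i nu) <= sumn (take i rho))%N].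
Definition sdominates (rho nu : seq nat) : bool := dominates rho nu && (rho != nu).

Definition standard (nu : seq nat) m (d : 'S_m) : bool :=
  [forall k : 'I_m, forall k' : 'I_m,
     ((rowof nu k == rowof nu k') && (colof nu k < colof nu k')%N) ||
     ((colof nu k == colof nu k') && (rowof nu k < rowof nu k')%N)
     ==> (d k < d k')%N].

Definition rowstab (nu : seq nat) m (w : 'S_m) : bool :=
  [forall k : 'I_m, rowof nu (w k) == rowof nu k].
Definition xnu (nu : seq nat) m : hecke m :=
  hsum [seq hT w | w <- enum [set w : 'S_m | rowstab nu w]].

Definition xuv (rho : seq nat) m (du dv : 'S_m) : hecke m :=
  hmul (hmul (hT du^-1) (xnu rho m)) (hT dv).

(* membership in bar N_nu (tensored with K): K-span of x_{uv}, u, v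
   rho-tableaux, rho a partition of m strictly dominating nu *)
Definition inNbar (nu : seq nat) m (h : hecke m) : Prop :=
  exists l : seq (K * seq nat * 'S_m * 'S_m),
    (forall z, z \in l -> is_partition_of m z.1.1.2 && sdominates z.1.1.2 nu) /\
    h = hsum [seq hscale z.1.1.1 (xuv z.1.1.2 z.1.2 z.2) | z <- l].

(* equality in H/bar N_nu, i.e. in the Specht module S^nu *)
Definition speq (nu : seq nat) m (h g : hecke m) : Prop := inNbar nu (hsub h g).

(* e_v (representative in H_{K,m}); e_nu = x_nu *)
Definition ev (nu : seq nat) m (dv : 'S_m) : hecke m := hmul (xnu nu m) (hT dv).

Definition qint (k : int) : K := (q ^ k - 1) / (q - 1).

Definition resq (nu : seq nat) (k : nat) : K := qint ((colof nu k)%:Z - (rowof nu k)%:Z).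

(* Jucys-Murphy element L_p (p 1-based): sum_{i=1}^{p-1} q^-i T_{(p-i,p)} *)
Definition JM m (p : nat) : hecke m :=
  hsum [seq hscale (q ^- i) (hT (tpn m (p - i).-1 p.-1)) | i <- iota 1 p.-1].

Fixpoint allseqs (k b : nat) : seq (seq nat) :=
  if k is k'.+1 then [seq x :: s | x <- iota 0 b.+1, s <- allseqs k' b] else [:: [::]].
Definition partitions (m : nat) : seq (seq nat) :=
  [seq p <- flatten [seq allseqs k m | k <- iota 0 m.+1] | is_partition_of m p].
Definition Rres (m : nat) : seq K :=
  undup [seq resq p k | p <- partitions m, k <- iota 0 m].

(* r_v(p): residue of the node containing p (1-based) in v *)
Definition rv (nu : seq nat) m (dv : 'S_m) (p : nat) : K := resq nu (pnat dv^-1 p.-1).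

Definition Ev (nu : seq nat) m (dv : 'S_m) : hecke m :=
  hprod [seq hprod [seq hscale (rv nu dv p - c)^-1
                          (hsub (JM m p) (hscale c (hone m)))
                   | c <- Rres m & c != rv nu dv p]
        | p <- iota 1 m].

Definition fv (nu : seq nat) m (dv : 'S_m) : hecke m := hmul (ev nu dv) (Ev nu dv).

Definition tentry (lam : seq nat) n (dt : 'S_n) (r c : nat) : nat := pnat dt (posof lam r c).

Definition shape_le (lam : seq nat) n (dt : 'S_n) (m : nat) : seq nat :=
  [seq x <- [seq count (fun c => tentry lam dt r c < m)%N (iota 0 (nth 0 lam r))
            | r <- iota 0 (size lam)] | (0 < x)%N].

(* t^{<=}_{|r..s}: lambda^{<=s}-tableau agreeing with t on nodes containing
   r..s, with 1..r-1 filled along rows in the remaining nodes.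
   As a permutation of S_s on positions of lambda^{<= s}. *)
Definition tle (lam : seq nat) n (dt : 'S_n) (r s : nat) : 'S_s :=
  let mu := shape_le lam dt s in
  let ent k := tentry lam dt (rowof mu k) (colof mu k) in
  perm_of_nat s (fun k => if (r.-1 <= ent k)%N then ent k
                          else count (fun k' => ent k' < r.-1)%N (iota 0 k)).

(* Main.v *)
Require Import Defs.
From mathcomp Require Import all_boot all_algebra all_fingroup.
From mathcomp Require Import fraction zify ring functions.
Set Implicit Arguments.
Unset Strict Implicit.
Unset Printing Implicit Defensive.
Import GRing.Theory.
Local Open Scope ring_scope.

(* Young's seminormal form gives, for each m, a module over the generic Hecke algebra with basis the
   standard tableaux of size m, on which the Jucys-Murphy elements act by contents. Counting standard
   tableaux shows that it is faithful, with image a product of full matrix algebras, one for each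
   shape. A vector fixed by the row stabilizer of rho only involves shapes dominating rho, so the
   ideal Nbar_nu is the sum of the blocks of shape strictly dominating nu, and x_nu h lies in Nbar_nu
   if and only if h kills the basis vector v_nu of the tableau t^nu. The seminormal idempotent of
   t^<= sends v_mu T_(d(t^<=)) to a nonzero multiple of the basis vector of t^<=, and restricted to
   the Hecke algebra of index r-1 this vector generates a copy of the module of v_nu, because the
   seminormal coefficients only depend on contents. Hence f_(t^<=) and e_nu have the same
   annihilator, over the field of fractions and a fortiori over any subring. *)

(** [inNbar] only asserts that some list exists, and no basis of the quotient is at hand. This is
    why membership is tested in an explicit faithful model, where it becomes the vanishing of one
    vector. Both modules of the statement are cyclic, so the isomorphism reduces to comparing
    annihilators.

    Tableaux enter as words of row indices. The model then carries no shape parameter: a shape is a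
    rearrangement class of words, and restriction to a smaller index fixes a suffix.

    Young's form is normalised so that the coefficient of an exchange creating an inversion of the
    word is 1. The word of $t^\mu$ is sorted and each generator creates at most one inversion, so
    the coefficient of $t^{\le}$ in $v_\mu T_{d(t^{\le})}$ is a product of ones; hence the nonzero
    multiple.

    The matrix units number $\sum_\lambda (f^\lambda)^2$, with $f^\lambda$ the number of standard
    tableaux. This sum is evaluated to $m!$ by commuting the addition and the removal of corners. *)

Local Notation pnat := Defs.pnat.

(** * Length of permutations and Matsumoto's theorem *)

Lemma ord_neqF m (u v : 'I_m) : u <> v :> nat -> (u == v) = false.
Proof. by move=> h; apply/eqP=> h'; apply: h; rewrite h'. Qed.

Lemma tperm_lt m (a b x y : 'I_m) : b = a.+1 :> nat ->
  (x = a -> y = b -> False) -> (x < y)%N -> (tperm a b x < tperm a b y)%N.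
Proof.
have ne (u v : 'I_m) : u <> v -> u <> v :> nat by move=> h h'; apply/h/val_inj.
move=> ab nxy.
by case: tpermP => [ex|ex|/ne ex1 /ne ex2]; case: tpermP => [ey|ey|/ne ey1 /ne ey2] lt;
  rewrite ?ex ?ey in lt nxy *; try lia; case: nxy.
Qed.

Lemma sgenE m (a b : 'I_m) : b = a.+1 :> nat -> sgen m a = tperm a b.
Proof. by move=> hb; rewrite /sgen -hb !valK. Qed.

Lemma sgen_ord m i : (i.+1 < m)%N ->
  exists a b : 'I_m, [/\ a = i :> nat, b = i.+1 :> nat & sgen m i = tperm a b].
Proof.
move=> im; exists (Ordinal (ltnW im)), (Ordinal im); split=> //.
by rewrite -(@sgenE m (Ordinal (ltnW im)) (Ordinal im)).
Qed.

Lemma sgen_out m i : (m <= i.+1)%N -> sgen m i = 1%g.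
Proof.
move=> mi; rewrite /sgen; case: insub => // a.
by rewrite insubF // ltnNge mi.
Qed.

Lemma sgenK m i : (sgen m i * sgen m i = 1)%g.
Proof.
have [im|mi] := ltnP i.+1 m; last by rewrite sgen_out // mulg1.
by have [a [b [_ _ ->]]] := sgen_ord im; rewrite tperm2.
Qed.

Lemma mulsgenK m i (w : 'S_m) : (w * sgen m i * sgen m i = w)%g.
Proof. by rewrite -mulgA sgenK mulg1. Qed.

(** Exchanging the adjacent values [a] and [b] reverses the order of a single pair of positions, so
    the inversion set gains exactly [(w^-1 a, w^-1 b)]. *)
Lemma plen_mulr m (w : 'S_m) (a b : 'I_m) : b = a.+1 :> nat ->
  ((w^-1)%g a < (w^-1)%g b)%N -> plen (w * tperm a b)%g = (plen w).+1.
Proof.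
move=> hb lt; rewrite /plen.
set A := [set p : 'I_m * 'I_m | _ & (w _ < w _)%N].
have nA : ((w^-1)%g a, (w^-1)%g b) \notin A.
  by rewrite inE /= !permKV lt hb /= ltnNge leqnSn.
rewrite -add1n -[1%N]/(nat_of_bool true) -nA -cardsU1; congr #|pred_of_set _|.
apply/setP=> -[x y]; rewrite !inE /= !permM.
have eV (z c : 'I_m) : (z == (w^-1)%g c) = (w z == c :> nat).
  by rewrite -(inj_eq (@perm_inj _ w)) permKV.
have ne (u v : 'I_m) : u <> v -> u <> v :> nat by move=> h h'; apply/h/val_inj.
rewrite xpair_eqE !eV.
have [xa ya] : (x = w^-1 (w x))%g /\ (y = w^-1 (w y))%g by rewrite !permK.
case: tpermP => [ey|ey|/ne ey1 /ne ey2]; case: tpermP => [ex|ex|/ne ex1 /ne ex2];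
  rewrite ?ex ?ey in xa ya *; clear ne A nA eV;
  by [lia | rewrite xa ya; lia].
Qed.

Lemma plen_desc m (w : 'S_m) (a b : 'I_m) : b = a.+1 :> nat ->
  ((w^-1)%g b < (w^-1)%g a)%N -> plen w = (plen (w * tperm a b)%g).+1.
Proof.
move=> hb lt; rewrite -(@plen_mulr _ _ a b) //.
  by rewrite -mulgA tperm2 mulg1.
by rewrite invMg !permM tpermV tpermL tpermR.
Qed.

Lemma desc_ord m (w : 'S_m) (a b : 'I_m) : b = a.+1 :> nat ->
  (plen (w * sgen m a)%g < plen w)%N = ((w^-1)%g b < (w^-1)%g a)%N.
Proof.
move=> hb; rewrite (sgenE hb); case: (ltngtP ((w^-1)%g a) ((w^-1)%g b)).
- by move=> /(plen_mulr hb) ->; rewrite ltnNge leqnSn.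
- by move=> /(plen_desc hb) h; rewrite [in X in (_ < X)%N]h ltnS leqnn.
- by move=> /val_inj/perm_inj ab; move: hb; rewrite ab; lia.
Qed.

Lemma desc_nat m (w : 'S_m) (a b : 'I_m) i : a = i :> nat -> b = i.+1 :> nat ->
  (plen (w * sgen m i)%g < plen w)%N = ((w^-1)%g b < (w^-1)%g a)%N.
Proof. by move=> <-; exact: desc_ord. Qed.

Lemma desc_range m (w : 'S_m) i : (plen (w * sgen m i)%g < plen w)%N -> (i.+1 < m)%N.
Proof.
by move=> h; rewrite ltnNge; apply/negP=> mi; rewrite sgen_out // mulg1 ltnn in h.
Qed.

Lemma plenS m (w : 'S_m) i : (i.+1 < m)%N ->
  plen w = (plen (w * sgen m i)%g).+1 \/ plen (w * sgen m i)%g = (plen w).+1.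
Proof.
move=> im; have [a [b [ha hb ->]]] := sgen_ord im.
have {}hb : b = a.+1 :> nat by rewrite hb ha.
case: (ltngtP ((w^-1)%g a) ((w^-1)%g b)).
- by move=> /(plen_mulr hb); right.
- by move=> /(plen_desc hb); left.
- by move=> /val_inj/perm_inj ab; move: hb; rewrite ab; lia.
Qed.

Lemma descN m (w : 'S_m) i : (i.+1 < m)%N ->
  (plen (w * sgen m i * sgen m i)%g < plen (w * sgen m i)%g)%N
  = ~~ (plen (w * sgen m i)%g < plen w)%N.
Proof. by move=> im; rewrite mulsgenK; case: (plenS w im) => ->; lia. Qed.

(** Here [w^-1] is increasing, and an increasing self-map of a finite interval is squeezed onto the
    identity from both ends. Thus the search in [rword] gets stuck only at the identity. *)
Lemma nodesc1 m (w : 'S_m) :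
  (forall i : 'I_m, ~~ (plen (w * sgen m i)%g < plen w)%N) -> w = 1%g.
Proof.
move=> h.
have inc (a b : 'I_m) : b = a.+1 :> nat -> ((w^-1)%g a < (w^-1)%g b)%N.
  move=> hb; have := h a; rewrite (desc_ord _ hb) -leqNgt leq_eqVlt.
  by case/orP=> // /eqP/val_inj/perm_inj ab; move: hb; rewrite ab; lia.
have ge k (hk : (k < m)%N) : (k <= (w^-1)%g (Ordinal hk))%N.
  elim: k hk => // k IH hk; have := IH (ltnW hk).
  move/leq_ltn_trans; apply; exact: inc.
have le j : forall k (hk : (k < m)%N), (m - k <= j)%N -> ((w^-1)%g (Ordinal hk) <= k)%N.
  elim: j => [|j IH] k hk; first by move=> ?; exfalso; lia.
  move=> hj; case: (ltnP k.+1 m) => [hk1|hk1].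
    have := inc (Ordinal hk) (Ordinal hk1) erefl.
    have := IH k.+1 hk1; lia.
  have := ltn_ord ((w^-1)%g (Ordinal hk)); lia.
apply: invg_inj; rewrite invg1; apply/permP=> -[k hk]; rewrite perm1; apply: val_inj => /=.
by apply/eqP; rewrite eqn_leq ge (le m) // leq_subr.
Qed.

Lemma plen1 m : plen (1 : 'S_m)%g = 0%N.
Proof. by apply/eqP; rewrite cards_eq0; apply/eqP/setP=> p; rewrite !inE !perm1; lia. Qed.

Lemma sgen_comm m i j : (i.+1 < j)%N -> (sgen m i * sgen m j = sgen m j * sgen m i)%g.
Proof.
move=> ij; have [jm|mj] := ltnP j.+1 m; last by rewrite (sgen_out mj) mulg1 mul1g.
have [a [b [ha hb ->]]] := sgen_ord (ltn_trans ij (ltnW jm)).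
have [c [d [hc hd ->]]] := sgen_ord jm.
by rewrite conjgC tpermJ !tpermD // ord_neqF //; lia.
Qed.

Lemma sgen_braid m i : (i.+2 < m)%N ->
  (sgen m i * sgen m i.+1 * sgen m i = sgen m i.+1 * sgen m i * sgen m i.+1)%g.
Proof.
move=> im.
set a := Ordinal (ltnW (ltnW im)); set b := Ordinal (ltnW im); set c := Ordinal im.
rewrite (_ : sgen m i = tperm a b); last by rewrite -(@sgenE m a b).
rewrite (_ : sgen m i.+1 = tperm b c); last by rewrite -(@sgenE m b c).
have ab : a != b by apply/eqP=> /(congr1 val) /=; lia.
have bc : b != c by apply/eqP=> /(congr1 val) /=; lia.
have ac : a != c by apply/eqP=> /(congr1 val) /=; lia.
have t u v w : u != w -> v != w -> u != v -> (tperm u v * tperm v w * tperm u v = tperm u w)%g.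
  move=> uw vw uv; rewrite -{1}(tpermV u v) -mulgA -[RHS](_ : (tperm v w) ^ (tperm u v) = _)%g //.
  by rewrite tpermJ tpermR tpermD // eq_sym.
rewrite t // [RHS](_ : _ = (tperm c b * tperm b a * tperm c b)%g).
  by rewrite t 1?tpermC // eq_sym.
by rewrite (tpermC c) (tpermC b a).
Qed.

Lemma desc_comm m (w : 'S_m) i j : (i.+1 < m)%N -> (j.+1 < m)%N ->
  (i.+1 < j)%N || (j.+1 < i)%N ->
  (plen (w * sgen m j * sgen m i)%g < plen (w * sgen m j)%g)%N
  = (plen (w * sgen m i)%g < plen w)%N.
Proof.
move=> im jm ij.
have [a [b [ha hb _]]] := sgen_ord im; have [c [d [hc hd sj]]] := sgen_ord jm.
rewrite !(desc_nat _ ha hb).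
rewrite sj invMg tpermV !permM !tpermD ?ord_neqF //; lia.
Qed.

Section Matsumoto.
Variables (m : nat) (V : Type) (X : nat -> V -> V).
Hypothesis Xcomm : forall i j v, (i.+1 < j)%N -> (j.+1 < m)%N -> X i (X j v) = X j (X i v).
Hypothesis Xbraid : forall i v, (i.+2 < m)%N ->
  X i (X i.+1 (X i v)) = X i.+1 (X i (X i.+1 v)).

(** [X] is any family of maps obeying the two braid relations. The product of the Hecke algebra
    (through [hmulT]) and the seminormal action are both instances. *)
Definition opT (v : V) (w : 'S_m) : V := foldl (fun u i => X i u) v (rword w).

Lemma opT1 v : opT v 1%g = v.
Proof. by rewrite /opT /rword plen1. Qed.

Lemma opT_pick v (w : 'S_m) : w <> 1%g -> exists i, (plen (w * sgen m i)%g < plen w)%N /\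
  opT v w = X i (opT v (w * sgen m i)%g).
Proof.
move=> w1; rewrite /opT /rword; case e : (plen w) => [|k] /=.
  case: w1; apply: nodesc1 => i; by rewrite e.
case: pickP => [i|h]; last by case: w1; apply: nodesc1 => i; move: (h i) => /=; rewrite e => ->.
rewrite /= -e => hi; exists i; split=> //.
have -> : k = plen (w * sgen m i)%g by move: e (hi); case: (plenS w (desc_range hi)) => -> => [[->]//|]; lia.
by rewrite -cats1 foldl_cat.
Qed.

(* Matsumoto's argument: two descents of [w] are compared inside the dihedral parabolic coset. *)
Lemma opT_desc v (w : 'S_m) i : (plen (w * sgen m i)%g < plen w)%N ->
  opT v w = X i (opT v (w * sgen m i)%g).
Proof.
have [k] := ubnP (plen w); elim: k w i => // k IH w i hk di.
have [] := @opT_pick v w; first by move=> w1; rewrite w1 plen1 in di.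
move=> j [dj ->].
have im := desc_range di; have jm := desc_range dj.
have ki : (plen (w * sgen m i)%g < k)%N by exact: leq_trans di hk.
have kj : (plen (w * sgen m j)%g < k)%N by exact: leq_trans dj hk.
have [hij|hij|->//] : [\/ (i.+1 < j)%N || (j.+1 < i)%N, (j = i.+1) \/ (i = j.+1) | i = j].
  case: (ltngtP i j) => h; last by constructor 3.
    by move: h; rewrite leq_eqVlt => /orP[/eqP<-|->]; [constructor 2; left|constructor 1].
  by move: h; rewrite leq_eqVlt => /orP[/eqP<-|->]; [constructor 2; right|constructor 1; rewrite orbT].
  have dji : (plen (w * sgen m j * sgen m i)%g < plen (w * sgen m j)%g)%N.
    by rewrite desc_comm.
  have dij : (plen (w * sgen m i * sgen m j)%g < plen (w * sgen m i)%g)%N.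
    by rewrite desc_comm // orbC.
  rewrite (IH _ i kj dji) (IH _ j ki dij).
  have c : (w * sgen m j * sgen m i = w * sgen m i * sgen m j)%g.
    by rewrite -!mulgA; case/orP: hij => h; rewrite (sgen_comm m h).
  by rewrite c; case/orP: hij => h; [symmetry|]; apply: Xcomm.
wlog ji : i j di dj im jm ki kj {hij} / j = i.+1.
  by move=> H; case: hij => h; [|symmetry]; exact: H.
subst j.
have [a [b [ha hb sa]]] := sgen_ord im; have [b' [c [hb' hc sb]]] := sgen_ord jm.
have ? : b' = b by apply: val_inj; rewrite /= hb hb'.
subst b'.
have ab : b = a.+1 :> nat by rewrite hb ha.
have bc : c = b.+1 :> nat by rewrite hb hc.
have db : ((w^-1)%g b < (w^-1)%g a)%N by rewrite -(desc_nat _ ha hb).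
have dc : ((w^-1)%g c < (w^-1)%g b)%N by rewrite -(desc_nat _ hb hc).
have d1 : (plen (w * sgen m i * sgen m i.+1)%g < plen (w * sgen m i)%g)%N.
  rewrite (desc_nat _ hb hc) sa invMg tpermV !permM tpermR tpermD ?ord_neqF //; by [exact: ltn_trans dc db | lia].
have d2 : (plen (w * sgen m i.+1 * sgen m i)%g < plen (w * sgen m i.+1)%g)%N.
  rewrite (desc_nat _ ha hb) sb invMg tpermV !permM tpermL tpermD ?ord_neqF //; by [exact: ltn_trans dc db | lia].
have d3 : (plen (w * sgen m i * sgen m i.+1 * sgen m i)%g < plen (w * sgen m i * sgen m i.+1)%g)%N.
  rewrite (desc_nat _ ha hb) sa sb !invMg !tpermV !permM tpermL.
  by rewrite (@tpermD _ b c a) ?tpermL ?(@tpermD _ a b c) ?ord_neqF //; lia.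
have d4 : (plen (w * sgen m i.+1 * sgen m i * sgen m i.+1)%g < plen (w * sgen m i.+1 * sgen m i)%g)%N.
  rewrite (desc_nat _ hb hc) sa sb !invMg !tpermV !permM tpermR.
  by rewrite (@tpermD _ a b c) ?tpermR ?(@tpermD _ b c a) ?ord_neqF //; lia.
rewrite (IH _ _ ki d1) (IH _ _ kj d2) (IH _ i (ltn_trans d1 ki) d3).
rewrite (IH _ i.+1 (ltn_trans d2 kj) d4).
rewrite Xbraid; last by lia.
by rewrite -[in LHS](mulgA w) -[in LHS](mulgA w) -[in RHS](mulgA w) -[in RHS](mulgA w) sgen_braid //; exact: jm.
Qed.

Lemma opT_asc v (w : 'S_m) i : (i.+1 < m)%N -> ~~ (plen (w * sgen m i)%g < plen w)%N ->
  opT v (w * sgen m i)%g = X i (opT v w).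
Proof. by move=> im d; rewrite (@opT_desc _ _ i) ?mulsgenK // -{1}(mulsgenK i w) mulsgenK; rewrite -descN // in d; rewrite mulsgenK in d. Qed.

(** Reduced words are built on the right, so a letter on the left needs its own induction. A right
    descent of [w] remains one of [tperm a b * w]: the only pair whose order could flip is excluded
    by [w a < w b]. *)
Lemma opT_left v (w : 'S_m) (a b : 'I_m) : b = a.+1 :> nat -> (w a < w b)%N ->
  opT v (tperm a b * w)%g = opT (X a v) w.
Proof.
move=> ab; have [k] := ubnP (plen w); elim: k w => // k IH w hk lt.
have am : (a.+1 < m)%N by rewrite -ab.
have [/eqP ->|/eqP w1] := boolP (w == 1%g).
  have s1 : sgen m a = tperm a b by rewrite (sgenE ab).
  by rewrite mulg1 -s1 -[sgen m a]mul1g opT_asc ?opT1 // plen1.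
have [i [di ->]] := @opT_pick (X a v) w w1.
have im := desc_range di; have [c [d [hc hd si]]] := sgen_ord im.
have cd : d = c.+1 :> nat by rewrite hc hd.
have wdc : ((w^-1)%g d < (w^-1)%g c)%N by rewrite -(desc_nat _ hc hd).
rewrite (@opT_desc v (tperm a b * w)%g i); last first.
  rewrite (desc_nat _ hc hd) invMg tpermV !permM tperm_lt // => wd wc.
  by move: lt; rewrite -wd -wc !permKV cd ltnNge leqnSn.
congr (X _ _); rewrite -mulgA IH //; first exact: leq_trans di hk.
rewrite si !permM tperm_lt // => wa wb.
by move: wdc; rewrite -wa -wb !permK ab ltnNge leqnSn.
Qed.
End Matsumoto.

(** * Modules over the Hecke algebra *)

Record hecke_module m (V : lmodType K) (X : nat -> V -> V) : Prop := HeckeModule {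
  hm_lin : forall i a u v, X i (a *: u + v) = a *: X i u + X i v;
  hm_quad : forall i v, (i.+1 < m)%N -> X i (X i v) = (q - 1) *: X i v + q *: v;
  hm_comm : forall i j v, (i.+1 < j)%N -> (j.+1 < m)%N -> X i (X j v) = X j (X i v);
  hm_braid : forall i v, (i.+2 < m)%N -> X i (X i.+1 (X i v)) = X i.+1 (X i (X i.+1 v)) }.

Definition hact m (V : lmodType K) (X : nat -> V -> V) (v : V) (h : hecke m) : V :=
  \sum_(w : 'S_m) h w *: opT X v w.

Lemma rword_range m (w : 'S_m) i : i \in rword w -> (i.+1 < m)%N.
Proof.
rewrite /rword; move: (plen w) => k; elim: k w => //= k IH w.
case: pickP => // j hj; rewrite mem_rcons inE => /orP[/eqP ->|]; last exact: IH.
exact: desc_range hj.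
Qed.

Section HeckeModule.
Variables (m : nat) (V : lmodType K) (X : nat -> V -> V).
Hypothesis hX : hecke_module m X.
Implicit Types (h g : hecke m) (w : 'S_m) (u v : V).

Lemma hmX0 i : X i 0 = 0.
Proof. by have := hm_lin hX i (-1) 0 0; rewrite scaler0 addr0 scaleN1r addNr. Qed.

Lemma hmXD i u v : X i (u + v) = X i u + X i v.
Proof. by have := hm_lin hX i 1 u v; rewrite !scale1r. Qed.

Lemma hmXZ i a u : X i (a *: u) = a *: X i u.
Proof. by have := hm_lin hX i a u 0; rewrite hmX0 !addr0. Qed.

Lemma hmX_sum i (I : Type) (r : seq I) (P : pred I) (F : I -> V) :
  X i (\sum_(j <- r | P j) F j) = \sum_(j <- r | P j) X i (F j).
Proof. by apply: (big_morph (X i)); [exact: hmXD | exact: hmX0]. Qed.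

Lemma foldX_lin s a u v :
  foldl (fun x i => X i x) (a *: u + v) s
  = a *: foldl (fun x i => X i x) u s + foldl (fun x i => X i x) v s.
Proof. by elim: s u v => //= i s IH u v; rewrite hmXD hmXZ IH. Qed.

Lemma opT_lin w a u v : opT X (a *: u + v) w = a *: opT X u w + opT X v w.
Proof. exact: foldX_lin. Qed.

Lemma act_linl h a u v : hact X (a *: u + v) h = a *: hact X u h + hact X v h.
Proof.
rewrite /hact scaler_sumr -big_split; apply: eq_bigr => w _ /=.
by rewrite opT_lin scalerDr !scalerA mulrC.
Qed.

Lemma act0l h : hact X 0 h = 0.
Proof. by have := act_linl h (-1) 0 0; rewrite scaler0 addr0 scaleN1r addNr. Qed.

Lemma actDl h u v : hact X (u + v) h = hact X u h + hact X v h.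
Proof. by have := act_linl h 1 u v; rewrite !scale1r. Qed.

Lemma actZl h a u : hact X (a *: u) h = a *: hact X u h.
Proof. by have := act_linl h a u 0; rewrite act0l !addr0. Qed.

Lemma act_suml h (I : Type) (r : seq I) (P : pred I) (F : I -> V) :
  hact X (\sum_(j <- r | P j) F j) h = \sum_(j <- r | P j) hact X (F j) h.
Proof. by apply: (big_morph (fun v => hact X v h)) => [u v|]; rewrite ?actDl ?act0l. Qed.

Lemma act_hT v w : hact X v (hT w) = opT X v w.
Proof.
rewrite /hact (bigD1 w) //= ffunE eqxx scale1r big1 ?addr0 // => w' /negbTE nw.
by rewrite ffunE nw scale0r.
Qed.

Lemma act_one v : hact X v (hone m) = v.
Proof. by rewrite act_hT opT1. Qed.

Lemma act_add v h g : hact X v (hadd h g) = hact X v h + hact X v g.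
Proof. by rewrite /hact -big_split; apply: eq_bigr => w _; rewrite ffunE scalerDl. Qed.

Lemma act_sub v h g : hact X v (hsub h g) = hact X v h - hact X v g.
Proof. by rewrite /hact -sumrB; apply: eq_bigr => w _; rewrite ffunE scalerBl. Qed.

Lemma act_scale v a h : hact X v (hscale a h) = a *: hact X v h.
Proof. by rewrite /hact scaler_sumr; apply: eq_bigr => w _; rewrite ffunE scalerA. Qed.

Lemma act_hsum v (s : seq (hecke m)) : hact X v (hsum s) = \sum_(h <- s) hact X v h.
Proof.
elim: s => [|h s IH] /=; last by rewrite big_cons act_add IH.
by rewrite big_nil /hact big1 // => w _; rewrite ffunE scale0r.
Qed.

Lemma hm_opT_desc v w i : (plen (w * sgen m i)%g < plen w)%N ->
  opT X v w = X i (opT X v (w * sgen m i)%g).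
Proof. exact: opT_desc (hm_comm hX) (hm_braid hX) v w i. Qed.

Lemma hm_opT_asc v w i : (i.+1 < m)%N -> ~~ (plen (w * sgen m i)%g < plen w)%N ->
  opT X v (w * sgen m i)%g = X i (opT X v w).
Proof. exact: opT_asc (hm_comm hX) (hm_braid hX) v w i. Qed.

Lemma hm_opT_left v w (a b : 'I_m) : b = a.+1 :> nat -> (w a < w b)%N ->
  opT X v (tperm a b * w)%g = opT X (X a v) w.
Proof. exact: opT_left (hm_comm hX) (hm_braid hX) v w a b. Qed.

Lemma act_mulTs v h i : (i.+1 < m)%N -> hact X v (hmulTs h i) = X i (hact X v h).
Proof.
move=> im; rewrite /hact hmX_sum.
(* Both sides are split into a part transported by [w -> w * sgen m i] and a diagonal part, present
   at descents only. The diagonal parts coincide and the substitution matches the others. *)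
pose d w := (plen (w * sgen m i)%g < plen w)%N.
have eL w : hmulTs h i w *: opT X v w =
    (if d w then 1 else q) *: (h (w * sgen m i)%g *: opT X v w)
    + (if d w then (q - 1) * h w else 0) *: opT X v w.
  rewrite ffunE -/(d w); case: (d w); last by rewrite scale0r addr0 scalerA.
  by rewrite scale1r scalerDl.
have eR w : X i (h w *: opT X v w) =
    (if d (w * sgen m i)%g then 1 else q) *: (h w *: opT X v (w * sgen m i)%g)
    + (if d w then (q - 1) * h w else 0) *: opT X v w.
  rewrite hmXZ {1}/d descN // -/(d w).
  case e : (d w) => /=; last by rewrite hm_opT_asc -/(d w) ?e // scale1r scale0r addr0.
  rewrite (hm_opT_desc v e) (hm_quad hX) //.
  by rewrite scalerDr !scalerA addrC; congr (_ *: _ + _ *: _); rewrite mulrC.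
rewrite (eq_bigr _ (fun w _ => eL w)) (eq_bigr _ (fun w _ => eR w)) !big_split /=.
congr (_ + _); rewrite (reindex_inj (mulIg (sgen m i))) /=.
by apply: eq_bigr => w _; rewrite mulsgenK.
Qed.

Lemma act_foldTs v h s : {in s, forall i, (i.+1 < m)%N} ->
  hact X v (foldl (@hmulTs m) h s) = foldl (fun u i => X i u) (hact X v h) s.
Proof.
elim: s h => //= i s IH h hs; rewrite IH ?act_mulTs ?hs ?mem_head //.
by move=> j js; apply: hs; rewrite inE js orbT.
Qed.

Lemma act_mulT v h w : hact X v (hmulT h w) = opT X (hact X v h) w.
Proof. by apply: act_foldTs => i; exact: rword_range. Qed.

Lemma act_hmul v h g : hact X v (hmul h g) = hact X (hact X v h) g.
Proof.
transitivity (\sum_w g w *: hact X v (hmulT h w)).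
  rewrite /hact; under [RHS]eq_bigr do rewrite scaler_sumr.
  rewrite exchange_big /=; apply: eq_bigr => x _.
  by rewrite ffunE scaler_suml; apply: eq_bigr => w _; rewrite scalerA.
by apply: eq_bigr => w _; rewrite act_mulT.
Qed.

End HeckeModule.

Section Regular.
Variable m : nat.

(** The elements of [hecke m] with their vector space structure; the two types are convertible, so
    [hadd] and [hscale] can be traded for the library operations. *)
Definition regV : lmodType K := {ffun 'S_m -> K^o}.
Definition regX (i : nat) (h : regV) : regV := hmulTs (h : hecke m) i.

Lemma haddE (h g : hecke m) : hadd h g = (h : regV) + g.
Proof. by apply/ffunP=> w; rewrite !ffunE. Qed.

Lemma hsubE (h g : hecke m) : hsub h g = (h : regV) - g.
Proof. by apply/ffunP=> w; rewrite !ffunE. Qed.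

Lemma hscaleE c (h : hecke m) : hscale c h = c *: (h : regV).
Proof. by apply/ffunP=> w; rewrite !ffunE. Qed.

Lemma hsumE (s : seq (hecke m)) : hsum s = \sum_(h <- s) (h : regV).
Proof.
elim: s => [|h s IH]; last by rewrite big_cons /= haddE IH.
by rewrite big_nil; apply/ffunP=> w; rewrite !ffunE.
Qed.

Lemma hmulTs_comm (h : hecke m) i j : (i.+1 < j)%N -> (j.+1 < m)%N ->
  hmulTs (hmulTs h j) i = hmulTs (hmulTs h i) j.
Proof.
move=> ij jm; apply/ffunP=> w; rewrite !ffunE.
have im : (i.+1 < m)%N by lia.
rewrite desc_comm ?ij ?orbT // desc_comm ?ij //.
have -> : (w * sgen m i * sgen m j = w * sgen m j * sgen m i)%g.
  by rewrite -!mulgA (sgen_comm m ij).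
by do 2!case: (plen _ < plen _)%N => /=; ring.
Qed.

Lemma hmulTs_quad (h : hecke m) i : (i.+1 < m)%N ->
  hmulTs (hmulTs h i) i = hadd (hscale (q - 1) (hmulTs h i)) (hscale q h).
Proof.
move=> im; apply/ffunP=> w; rewrite !ffunE descN // mulsgenK.
by case: (plen _ < plen _)%N => /=; ring.
Qed.

Lemma hmulTs_braid (h : hecke m) i : (i.+2 < m)%N ->
  hmulTs (hmulTs (hmulTs h i) i.+1) i = hmulTs (hmulTs (hmulTs h i.+1) i) i.+1.
Proof.
move=> im; apply/ffunP=> w; rewrite !ffunE.
have [a [b [ha hb sa]]] := sgen_ord (ltnW im); have [b' [c [hb' hc sb]]] := sgen_ord im.
have ? : b' = b by apply: val_inj; rewrite /= hb hb'.
subst b'; rewrite !(desc_nat _ ha hb) !(desc_nat _ hb hc) !mulsgenK.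
have := @sgen_braid m i im; rewrite -!mulgA => br; rewrite !mulgA.
have -> : (w * sgen m i * sgen m i.+1 * sgen m i
           = w * sgen m i.+1 * sgen m i * sgen m i.+1)%g by rewrite -!mulgA br.
rewrite sa sb !invMg !tpermV !permM.
have [ab bc ac] : [/\ a != b, b != c & a != c].
  by split; rewrite ord_neqF //; lia.
have t1 : tperm b c a = a by rewrite tpermD // eq_sym.
have t2 : tperm a b c = c by rewrite tpermD // eq_sym.
rewrite !(tpermL, tpermR, t1, t2).
have nV (u v : 'I_m) : u != v -> (w^-1)%g u <> (w^-1)%g v :> nat.
  by move=> uv /val_inj/perm_inj e; rewrite e eqxx in uv.
have := nV _ _ ab; have := nV _ _ bc; have := nV _ _ ac.
move: ((w^-1)%g a : nat) ((w^-1)%g b : nat) ((w^-1)%g c : nat) => A B D AD BD AB.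
(* The six values of [h] are its coefficients on the coset of [w] under the two generators; all
   descents are decided by the relative order of the preimages [A], [B], [D]. *)
move: (h _) (h _) (h _) (h _) (h _) (h _) q => x1 x2 x3 x4 x5 x6 q'.
case: (ltngtP A B) => //; case: (ltngtP B D) => //; case: (ltngtP A D) => // *;
  by [ring | lia].
Qed.

Lemma regX_module : hecke_module m regX.
Proof.
split.
- move=> i a u v; apply/ffunP=> w; rewrite !ffunE /=; case: ifP => _;
    rewrite /GRing.scale /=; ring.
- by move=> i v im; rewrite /regX hmulTs_quad // haddE !hscaleE.
- by move=> i j v ij jm; apply: hmulTs_comm.
- by move=> i v im; apply: hmulTs_braid.
Qed.

Lemma hmul_act (h g : hecke m) : hmul h g = hact regX h g.
Proof.
apply/ffunP=> x; rewrite ffunE sum_ffunE; apply: eq_bigr => w _.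
by rewrite !ffunE.
Qed.

Implicit Types h g k : hecke m.
(** Associativity says that the regular representation is an action, so it is [act_hmul] for
    [regX]. *)
Lemma hmulA h g k : hmul (hmul h g) k = hmul h (hmul g k).
Proof. by rewrite !hmul_act -(hmul_act g) (act_hmul regX_module). Qed.

Lemma hT_basis h : h = \sum_w h w *: (hT w : regV).
Proof.
apply/ffunP=> x; rewrite sum_ffunE.
under eq_bigr do rewrite !ffunE.
rewrite (bigD1 x) // eqxx big1 => [|w /negbTE]; first by symmetry; exact: etrans (addr0 _) (mulr1 _).
by rewrite eq_sym => ->; exact: mulr0.
Qed.

End Regular.

(** * Yamanouchi words *)

Lemma polyK_inj : injective polyK.
Proof. by move=> x y /eqP; rewrite /polyK tofrac_eq => /eqP. Qed.

Lemma polyKX n : polyK ('X^n) = q ^+ n.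
Proof. by rewrite /polyK rmorphXn. Qed.

Lemma q_neq0 : q != 0.
Proof. by rewrite -(rmorph0 (@FracField.tofrac _)) (inj_eq polyK_inj) polyX_eq0. Qed.

Lemma qX_inj : injective (fun n : nat => q ^+ n).
Proof.
move=> m n /=; rewrite -!polyKX => /polyK_inj /(congr1 (fun p : {poly C} => size p)).
by rewrite !size_polyXn => -[].
Qed.

Lemma qz_inj : injective (fun k : int => q ^ k).
Proof.
move=> k l /= e.
have [n hn] : exists n : nat, 0 <= k + n%:Z /\ 0 <= l + n%:Z.
  by exists (`|k| + `|l|)%N; lia.
have {}e : q ^ (k + n%:Z) = q ^ (l + n%:Z) by rewrite !expfzDr ?q_neq0 // e.
case: hn => kn ln; move: e; rewrite -(gez0_abs kn) -(gez0_abs ln) => /qX_inj; lia.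
Qed.

Lemma q_neq1 : q - 1 != 0.
Proof. by rewrite subr_eq0; apply/eqP=> /(@qX_inj 1 0). Qed.

Lemma qint_inj : injective qint.
Proof.
move=> k l; rewrite /qint => /(mulIf _) e; apply: qz_inj => /=.
by apply: (addIr (- 1)); apply: e; rewrite invr_eq0 q_neq1.
Qed.

Definition addable (p : seq nat) a := (a == 0)%N || (count_mem a p < count_mem a.-1 p)%N.

Fixpoint yam_from (p s : seq nat) : bool :=
  if s is a :: s' then addable p a && yam_from (rcons p a) s' else true.

(* A standard tableau is encoded by its Yamanouchi word, whose k-th letter is the row of entry k. *)
Definition yam (u : seq nat) := yam_from [::] u.

Definition sw i (u : seq nat) : seq nat :=
  if (i.+1 < size u)%N then take i u ++ [:: nth 0%N u i.+1, nth 0%N u i & drop i.+2 u] else u.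

(** Appending [a] to [p] adds a node in row [a] and column [count_mem a p]; this is the content of
    that node. *)
Definition ccount (p : seq nat) (a : nat) : int := (count_mem a p)%:Z - a%:Z.

Definition cont (u : seq nat) (k : nat) : int := ccount (take k u) (nth 0%N u k).

Lemma addable_perm p p' a : perm_eq p p' -> addable p a = addable p' a.
Proof. by move=> /seq.permP h; rewrite /addable !h. Qed.

Lemma ccount_perm p p' a : perm_eq p p' -> ccount p a = ccount p' a.
Proof. by move=> /seq.permP h; rewrite /ccount h. Qed.

Lemma yam_from_perm p p' s : perm_eq p p' -> yam_from p s = yam_from p' s.
Proof.
elim: s p p' => //= a s IH p p' h; rewrite (addable_perm a h); congr (_ && _).
by apply: IH; rewrite -!cats1 perm_cat2r.
Qed.

Lemma yam_from_cat p s t : yam_from p (s ++ t) = yam_from p s && yam_from (p ++ s) t.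
Proof.
elim: s p => [|a s IH] p /=; first by rewrite cats0.
by rewrite IH andbA cat_rcons.
Qed.

Lemma yam_cat s t : yam (s ++ t) = yam s && yam_from s t.
Proof. exact: yam_from_cat. Qed.

Lemma yam_rcons s a : yam (rcons s a) = yam s && addable s a.
Proof. by rewrite -cats1 yam_cat /= andbT. Qed.

Lemma yam_take k u : yam u -> yam (take k u).
Proof. by rewrite -{1}(cat_take_drop k u) yam_cat => /andP[]. Qed.

Lemma count_rcons (p : seq nat) a b :
  count_mem b (rcons p a) = (count_mem b p + (a == b))%N.
Proof. by rewrite -cats1 count_cat /= addn0. Qed.

Lemma yam_count u j : yam u -> (count_mem j.+1 u <= count_mem j u)%N.
Proof.
elim/last_ind: u => // u a IH; rewrite yam_rcons => /andP[/IH h].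
rewrite !count_rcons /addable; case: (eqVneq a j.+1) => [-> /=|_ _]; last by lia.
by move=> lt; rewrite addn1 (leq_trans lt) // leq_addr.
Qed.

Lemma yam_count_le u j k : yam u -> (j <= k)%N -> (count_mem k u <= count_mem j u)%N.
Proof.
move=> yu; elim: k => [|k IH]; first by rewrite leqn0 => /eqP ->.
rewrite leq_eqVlt => /orP[/eqP -> //|/IH]; exact: leq_trans (yam_count _ yu).
Qed.

(** Going down, rows do not get longer while the row index grows. Contents therefore separate the
    possible next letters of a word. *)
Lemma ccount_lt p a b : yam p -> (a < b)%N -> ccount p b < ccount p a.
Proof. by move=> yp ab; have := yam_count_le yp (ltnW ab); rewrite /ccount; lia. Qed.

Lemma ccount_inj p : yam p -> injective (ccount p).
Proof.
move=> yp a b e; case: (ltngtP a b) => // /(ccount_lt yp); rewrite e; lia.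
Qed.

Lemma split2 i (u : seq nat) : (i.+1 < size u)%N ->
  exists p a b s, u = p ++ [:: a, b & s] /\ size p = i.
Proof.
move=> h; exists (take i u), (nth 0 u i)%N, (nth 0 u i.+1)%N, (drop i.+2 u).
by rewrite -!drop_nth ?cat_take_drop ?size_takel //; lia.
Qed.

Lemma split3 i (u : seq nat) : (i.+2 < size u)%N ->
  exists p a b c s, u = p ++ [:: a, b, c & s] /\ size p = i.
Proof.
move=> h; exists (take i u), (nth 0 u i)%N, (nth 0 u i.+1)%N, (nth 0 u i.+2)%N, (drop i.+3 u).
by rewrite -!drop_nth ?cat_take_drop ?size_takel //; lia.
Qed.

Lemma sw_cat p a b s : sw (size p) (p ++ [:: a, b & s]) = p ++ [:: b, a & s].
Proof.
rewrite /sw size_cat /= ifT; last by lia.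
rewrite take_size_cat // !nth_cat ltnn subnn ltnNge leqnSn subSnn /=.
rewrite drop_cat ifF; last by lia.
by rewrite (_ : (size p).+2 - size p = 2)%N //=; [rewrite drop0 | lia].
Qed.

Lemma size_sw i u : size (sw i u) = size u.
Proof.
rewrite /sw; case: ifP => // h.
by rewrite size_cat /= size_drop size_takel; lia.
Qed.

Lemma sw_perm i u : perm_eq (sw i u) u.
Proof.
have [h|h] := ltnP i.+1 (size u); last by rewrite /sw ltnNge h.
have [p [a [b [s [-> <-]]]]] := split2 h.
by rewrite sw_cat perm_cat2l -[b :: a :: s]/([:: b; a] ++ s) -[a :: b :: s]/([:: a; b] ++ s)
  perm_cat2r -(perm_rot 1).
Qed.

Lemma swK i u : sw i (sw i u) = u.
Proof.
have [h|h] := ltnP i.+1 (size u); last by rewrite /sw !ltnNge h /= h.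
by have [p [a [b [s [-> <-]]]]] := split2 h; rewrite !sw_cat.
Qed.

(** An exchange removing an inversion stays standard: for [b < a] the letter [a] cannot help [b] to
    become addable, while an earlier [b] can only help [a]. *)
Lemma yam_sw_gt p a b s : (b <= a)%N -> yam (p ++ [:: a, b & s]) -> yam (p ++ [:: b, a & s]).
Proof.
rewrite leq_eqVlt => /orP[/eqP -> //|ba].
rewrite !yam_cat /= => /andP[-> /and3P[oa ob ys]] /=.
apply/and3P; split.
- by move: ob; rewrite /addable !count_rcons => ?; lia.
- by move: oa; rewrite /addable !count_rcons => ?; lia.
- move: ys; rewrite (@yam_from_perm _ (rcons (rcons p b) a)) //.
  by rewrite -!cats1 -!catA perm_cat2l (permEl (perm_catC [:: a] [:: b])).
Qed.

Definition ct (p : seq nat) (a : nat) : K := q ^ ccount p a.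

Lemma ct_rcons p a b : ct (rcons p b) a = (if b == a then q else 1) * ct p a.
Proof.
rewrite /ct /ccount count_rcons; case: eqP => _; last by rewrite addn0 mul1r.
by rewrite (_ : _ - _ = 1 + ((count_mem a p)%:Z - a%:Z)) ?expfzDr ?q_neq0 //=; lia.
Qed.

Lemma ct_neq0 p a : ct p a != 0.
Proof. by rewrite /ct expfz_neq0 ?q_neq0. Qed.

Lemma ct_neq p a b : yam p -> a != b -> ct p a != ct p b.
Proof. by move=> yp ab; apply: contraNneq ab => /qz_inj /(ccount_inj yp) ->. Qed.

(* Young's seminormal form, in the Hecke generator exchanging two entries whose contents [c], [c']
   give [x = Q ^ c] and [y = Q ^ c']. The off-diagonal coefficient [semP x y] is put entirely on
   one of the two words, so that it vanishes whenever the exchange leaves the standard tableaux. *)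
Definition semA (F : fieldType) (Q x y : F) : F := (Q - 1) * y / (y - x).
Definition semP (F : fieldType) (Q x y : F) : F := (Q * x - y) * (x - Q * y) / (x - y) ^+ 2.
Definition semB (F : fieldType) (a b : nat) (Q x y : F) : F :=
  if (a <= b)%N then semP Q x y else 1.

Definition semU (i : nat) (f : seq nat -> K^o) (u : seq nat) : K :=
  let x := q ^ cont u i in let y := q ^ cont u i.+1 in
  semA q x y * f u + semB (nth 0%N u i) (nth 0%N u i.+1) q x y * f (sw i u).

(* Functions on words are row vectors. Words that are not Yamanouchi of length [m] are junk on which
   every generator acts by [q]; they never interact with the others (see [semB_exit]). *)
Definition semX m (i : nat) (f : seq nat -> K^o) : seq nat -> K^o :=
  fun u => if (size u == m) && yam u then semU i f u else q * f u.

Lemma cont_cat p a s : cont (p ++ a :: s) (size p) = ccount p a.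
Proof. by rewrite /cont take_size_cat // nth_cat ltnn subnn. Qed.

Lemma semU_cat f p a b s : semU (size p) f (p ++ [:: a, b & s]) =
  semA q (ct p a) (ct (rcons p a) b) * f (p ++ [:: a, b & s])
  + semB a b q (ct p a) (ct (rcons p a) b) * f (p ++ [:: b, a & s]).
Proof.
rewrite /semU sw_cat cont_cat -cat_rcons -(size_rcons p a) cont_cat cat_rcons.
by rewrite !nth_cat ltnn subnn size_rcons ltnNge leqnSn subSnn.
Qed.

(** * The seminormal module *)

Opaque q.

Section SeminormalCoefficients.
Variables (F : fieldType) (Q : F).
Hypothesis Q1 : Q - 1 != 0.
Implicit Types x y z : F.

Lemma semA_same x : x != 0 -> semA Q x (Q * x) = Q.
Proof.
move=> x0; rewrite /semA -[X in _ / (_ - X)]mul1r -mulrBl mulrCA -mulrA divff ?mulr1 //.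
by rewrite mulf_neq0.
Qed.

Lemma mulq_neq x : x != 0 -> x != Q * x.
Proof.
move=> x0; rewrite -subr_eq0 -{1}[x]mul1r -mulrBl mulf_neq0 //.
by rewrite -oppr_eq0 opprB.
Qed.

Lemma semP_same x : semP Q x (Q * x) = 0.
Proof. by rewrite /semP subrr !mul0r. Qed.

Lemma semP_col x y : x = Q * y -> semP Q x y = 0.
Proof. by move=> ->; rewrite /semP subrr mulr0 mul0r. Qed.

Lemma semPC x y : semP Q y x = semP Q x y.
Proof.
rewrite /semP -(opprB x y) sqrrN; congr (_ / _).
rewrite -(opprB (Q * x)) -(opprB x) mulrNN mulrC; congr (_ * _); ring.
Qed.

Lemma semB_mul a b x y : a != b -> semB a b Q x y * semB b a Q y x = semP Q x y.
Proof. by rewrite /semB semPC; case: ltngtP => // _ _; rewrite ?mulr1 ?mul1r. Qed.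

Lemma semB_same a x : semB a a Q x (Q * x) = 0.
Proof. by rewrite /semB leqnn semP_same. Qed.

Lemma semA_sum x y : x != y -> semA Q x y + semA Q y x = Q - 1.
Proof.
by move=> xy; have yx := xy; rewrite eq_sym in yx; rewrite /semA; field; rewrite !subr_eq0 xy yx.
Qed.

Lemma semA_quad x y : x != y ->
  semA Q x y * semA Q x y + semP Q x y = (Q - 1) * semA Q x y + Q.
Proof.
by move=> xy; have yx := xy; rewrite eq_sym in yx; rewrite /semA /semP; field; rewrite !subr_eq0 xy yx.
Qed.

Section Three.
Variables x y z : F.
Hypotheses (xy : x != y) (yz : y != z) (xz : x != z).

Let yx : y != x. Proof. by rewrite eq_sym. Qed.
Let zy : z != y. Proof. by rewrite eq_sym. Qed.
Let zx : z != x. Proof. by rewrite eq_sym. Qed.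

Lemma semA_braid1 :
  semA Q x y * semA Q y z * semA Q x y + semP Q x y * semA Q x z
  = semA Q y z * semA Q x y * semA Q y z + semP Q y z * semA Q x z.
Proof.
by rewrite /semA /semP; field; rewrite !subr_eq0 ?xy ?yz ?xz ?yx ?zy ?zx.
Qed.

Lemma semA_braid2 :
  semA Q x y * semA Q y z + semA Q x z * semA Q y x = semA Q y z * semA Q x z.
Proof.
by rewrite /semA; field; rewrite !subr_eq0 ?xy ?yz ?xz ?yx ?zy ?zx.
Qed.

Lemma semA_braid3 :
  semA Q x y * semA Q x z = semA Q y z * semA Q x y + semA Q x z * semA Q z y.
Proof.
by rewrite /semA; field; rewrite !subr_eq0 ?xy ?yz ?xz ?yx ?zy ?zx.
Qed.
End Three.
End SeminormalCoefficients.

(** [F1] to [F6] are the values at the six rearrangements of three letters. The second and third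
    identities carry the factors [Bab] and [Bbc] so that they hold trivially when two letters
    coincide and these factors vanish. *)
Lemma braid_combine (F : comNzRingType)
    (Axy Ayz Axz Ayx Azy Pxy Pyz Bab Bba Bbc Bcb Bac F1 F2 F3 F4 F5 F6 : F) :
  Axy * Ayz * Axy + Pxy * Axz = Ayz * Axy * Ayz + Pyz * Axz ->
  Bab * (Axy * Ayz + Axz * Ayx) = Bab * (Ayz * Axz) ->
  Bbc * (Axy * Axz) = Bbc * (Ayz * Axy + Axz * Azy) ->
  Bab * Bba = Pxy -> Bbc * Bcb = Pyz ->
  Axy * (Ayz * (Axy * F1 + Bab * F2) + Bbc * (Axz * F3 + Bac * F4))
  + Bab * (Axz * (Ayx * F2 + Bba * F1) + Bac * (Ayz * F5 + Bbc * F6))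
  = Ayz * (Axy * (Ayz * F1 + Bbc * F3) + Bab * (Axz * F2 + Bac * F5))
  + Bbc * (Axz * (Azy * F3 + Bcb * F1) + Bac * (Axy * F4 + Bab * F6)).
Proof.
move=> e1 e2 e3 eP eP'; rewrite -eP -eP' in e1.
apply/eqP; rewrite -subr_eq0; apply/eqP.
transitivity (F1 * (Axy * Ayz * Axy + Bab * Bba * Axz - (Ayz * Axy * Ayz + Bbc * Bcb * Axz))
  + F2 * (Bab * (Axy * Ayz + Axz * Ayx) - Bab * (Ayz * Axz))
  + F3 * (Bbc * (Axy * Axz) - Bbc * (Ayz * Axy + Axz * Azy))); first by ring.
by rewrite e1 e2 e3 !subrr !mulr0 !addr0.
Qed.

(** On two exchanged words a generator is a 2 by 2 matrix of trace [Q - 1] and determinant [- Q];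
    the quadratic relation is its Cayley-Hamilton identity. *)
Lemma quad_combine (F : comNzRingType) (A A' B B' Q F1 F2 : F) :
  A * A + B * B' = (Q - 1) * A + Q -> A + A' = Q - 1 ->
  A * (A * F1 + B * F2) + B * (A' * F2 + B' * F1) = (Q - 1) * (A * F1 + B * F2) + Q * F1.
Proof.
move=> e1 e2.
transitivity ((A * A + B * B') * F1 + (A + A') * (B * F2)); first by ring.
by rewrite e1 e2; ring.
Qed.

(** An exchange leaves the standard tableaux only if [b] is the row just below [a] and both rows of
    [p] have equal length. The two entries then sit on top of each other, their contents differ by
    one, and [semP] vanishes. *)
Lemma semB_exit p a b s : yam (p ++ [:: a, b & s]) -> ~~ yam (p ++ [:: b, a & s]) ->
  semB a b q (ct p a) (ct (rcons p a) b) = 0.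
Proof.
move=> yu nyu; have ab : (a < b)%N.
  by rewrite ltnNge; apply: contra nyu => ba; apply: yam_sw_gt yu.
rewrite /semB (ltnW ab); apply: semP_col; rewrite ct_rcons (ltn_eqF ab) mul1r.
rewrite /ct -[X in X * _](expr1z q) -expfzDr ?q_neq0 //; congr (q ^ _).
move: yu nyu; rewrite !yam_cat /= => /andP[yp /and3P[oa ob ys]]; rewrite yp /=.
rewrite (@yam_from_perm _ (rcons (rcons p a) b)); last first.
  by rewrite -!cats1 -!catA perm_cat2l (permEl (perm_catC [:: b] [:: a])).
rewrite ys andbT; have := yam_count_le yp (ltnW ab).
move: oa ob; rewrite /addable /ccount !count_rcons (ltn_eqF ab) (gtn_eqF ab) !addn0.
have [ba|_] := eqVneq a b.-1; last first.
  by rewrite addn0 => oa -> le h; exfalso; lia.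
by rewrite -ba; move: (count_mem b p) (count_mem a p) => B A oa ob le h; lia.
Qed.

(** Equality would force [a = c.+1] with rows [a] and [c] of equal length in [p], and two more nodes
    in row [a] against one in row [c] would break the partition. This keeps the denominators nonzero
    in the braid relation when a letter is repeated. *)
Lemma ct_neq_q p p' a c : yam p -> yam p' -> perm_eq p' (p ++ [:: a; a; c]) -> a != c ->
  ct p c != q * ct p a.
Proof.
move=> yp yp' /seq.permP pe ac; rewrite /ct -[X in X * _](expr1z q) -expfzDr ?q_neq0 //.
apply/eqP=> /qz_inj; rewrite /ccount => e.
have [ca|ca] := leqP a c; first by have := yam_count_le yp ca => ?; lia.
have le := yam_count_le yp (ltnW ca).
have ca1 : a = c.+1 by lia.
have := yam_count c yp'; rewrite -ca1 !pe !count_cat /= !eqxx (eq_sym c) (negbTE ac) => h; move: e le h; move: (count_mem a p) (count_mem c p) => A B e le h; lia.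
Qed.

Section SemBraid.
Variables (f : seq nat -> K^o) (p s : seq nat).
Implicit Types (g : seq nat -> K^o) (a b c : nat).

Lemma semU_l g a b c : semU (size p) g (p ++ [:: a, b, c & s]) =
  semA q (ct p a) (ct (rcons p a) b) * g (p ++ [:: a, b, c & s])
  + semB a b q (ct p a) (ct (rcons p a) b) * g (p ++ [:: b, a, c & s]).
Proof. exact: semU_cat. Qed.

Lemma semU_r g a b c : semU (size p).+1 g (p ++ [:: a, b, c & s]) =
  semA q (ct (rcons p a) b) (ct (rcons (rcons p a) b) c) * g (p ++ [:: a, b, c & s])
  + semB b c q (ct (rcons p a) b) (ct (rcons (rcons p a) b) c) * g (p ++ [:: a, c, b & s]).
Proof. by rewrite -!(cat_rcons a) -(size_rcons p a) semU_cat. Qed.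

(** The cases are the coincidences among the three letters. Repeated letters have contents [x] and
    [q * x], with [semA] equal to [q] and [semB] to 0 when they are adjacent; the third content
    avoids both. The same three rational identities then serve every case except three equal
    letters, with zeros for the absent rearrangements. *)
Lemma semU_braid a b c : yam (p ++ [:: a, b, c & s]) ->
  semU (size p) (semU (size p).+1 (semU (size p) f)) (p ++ [:: a, b, c & s])
  = semU (size p).+1 (semU (size p) (semU (size p).+1 f)) (p ++ [:: a, b, c & s]).
Proof.
move=> yu; have yp : yam p by move: yu; rewrite yam_cat => /andP[].
have y3 : yam (p ++ [:: a; b; c]).
  by move: yu; rewrite -[_ :: _]/([:: a; b; c] ++ s) catA yam_cat => /andP[].
rewrite !(semU_l, semU_r).
have [ab|ab] := eqVneq a b; have [bc|bc] := eqVneq b c.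
- subst b c; rewrite !ct_rcons !eqxx; have x0 := ct_neq0 p a.
  move: (ct p a) x0 => x x0; have x1 := mulf_neq0 q_neq0 x0.
  rewrite !(semA_same q_neq1 x0) !(semA_same q_neq1 x1).
  by rewrite !semB_same !mul0r !addr0.
- subst b; rewrite !ct_rcons !eqxx (eq_sym c) (negbTE bc) !mul1r.
  have yx := ct_neq yp bc; have yqx := ct_neq_q yp y3 (perm_refl _) bc.
  have x0 := ct_neq0 p a; move: (ct p a) (ct p c) x0 yx yqx => x y x0 yx yqx.
  rewrite eq_sym in yqx; have xqx := mulq_neq q_neq1 x0.
  rewrite !(semA_same q_neq1 x0) !semB_same !mul0r !addr0.
  have := semA_braid1 q xqx yqx yx; have := semA_braid3 q xqx yqx yx.
  have := semB_mul q (q * x) y bc; rewrite semP_same (semA_same q_neq1 x0).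
  move=> eB e3 e1.
  have := @braid_combine _ q _ _ 0 _ 0 _ 0 0 _ _ (semB a c q x y)
    (f (p ++ [:: a, a, c & s])) 0 (f (p ++ [:: a, c, a & s])) (f (p ++ [:: c, a, a & s])) 0 0
    e1 _ (congr1 (fun z => semB a c q (q * x) y * z) e3) _ eB.
  by rewrite !(mul0r, mulr0, addr0, add0r); apply.
- subst c; rewrite !ct_rcons !eqxx (eq_sym b) (negbTE ab) !mul1r.
  have xy := ct_neq yp ab; have := @ct_neq_q p _ b a yp y3; rewrite (eq_sym b) ab.
  rewrite perm_cat2l (permEl (perm_catC [:: a] [:: b; b])) => /(_ isT isT) xqy.
  have y0 := ct_neq0 p b; move: (ct p a) (ct p b) y0 xy xqy => x y y0 xy xqy.
  have yqy := mulq_neq q_neq1 y0.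
  rewrite !(semA_same q_neq1 y0) !semB_same !mul0r !addr0.
  have := semA_braid1 q xy yqy xqy; have := semA_braid2 q xy yqy xqy.
  have := semB_mul q x y ab; rewrite semP_same (semA_same q_neq1 y0).
  move=> eB e2 e1.
  have := @braid_combine _ _ q _ _ 0 _ 0 _ _ 0 0 (semB a b q x (q * y))
    (f (p ++ [:: a, b, b & s])) (f (p ++ [:: b, a, b & s])) 0 0 (f (p ++ [:: b, b, a & s])) 0
    e1 (congr1 (fun z => semB a b q x y * z) e2) _ eB.
  by rewrite !(mul0r, mulr0, addr0, add0r); apply.
have [ac|ac] := eqVneq a c.
- subst c; rewrite !ct_rcons !eqxx (negbTE ab) (negbTE bc) !mul1r.
  have xy := ct_neq yp ab; have := @ct_neq_q p _ a b yp y3; rewrite ab perm_cat2l.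
  rewrite (perm_cons a [:: b; a]) (permEl (perm_catC [:: b] [:: a])) => /(_ isT isT) yqx.
  have x0 := ct_neq0 p a; move: (ct p a) (ct p b) x0 xy yqx => x y x0 xy yqx.
  have xqx := mulq_neq q_neq1 x0.
  rewrite !(semA_same q_neq1 x0) !semB_same !mul0r !addr0.
  have := semA_braid1 q xy yqx xqx; have := semA_braid2 q xy yqx xqx; have := semA_braid3 q xy yqx xqx.
  have := semB_mul q x y ab; have := semB_mul q y (q * x) bc; rewrite (semA_same q_neq1 x0).
  move=> eB' eB e3 e2 e1.
  have := @braid_combine _ _ _ _ _ _ _ _ _ _ _ _ 0
    (f (p ++ [:: a, b, a & s])) (f (p ++ [:: b, a, a & s])) (f (p ++ [:: a, a, b & s])) 0 0 0
    e1 (congr1 (fun z => semB a b q x y * z) e2) (congr1 (fun z => semB b a q y (q * x) * z) e3) eB eB'.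
  by rewrite !(mul0r, mulr0, addr0, add0r); apply.
rewrite !ct_rcons !(eq_sym _ a) !(eq_sym c) (negbTE ab) (negbTE bc) (negbTE ac) !mul1r.
have xy := ct_neq yp ab; have yz := ct_neq yp bc; have xz := ct_neq yp ac.
move: (ct p a) (ct p b) (ct p c) xy yz xz => x y z xy yz xz.
exact: braid_combine (semA_braid1 q xy yz xz) (congr1 _ (semA_braid2 q xy yz xz))
  (congr1 _ (semA_braid3 q xy yz xz)) (semB_mul q x y ab) (semB_mul q y z bc).
Qed.
End SemBraid.

Definition goodw m (u : seq nat) := (size u == m) && yam u.

Lemma semX_good m i f u : goodw m u -> semX m i f u = semU i f u.
Proof. by rewrite /semX -/(goodw m u) => ->. Qed.

Lemma semX_bad m i f u : ~~ goodw m u -> semX m i f u = q * f u.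
Proof. by rewrite /semX -/(goodw m u) => /negbTE ->. Qed.

Lemma good_split2 m i u : (i.+1 < m)%N -> goodw m u ->
  exists p a b s, [/\ u = p ++ [:: a, b & s], size p = i, yam p & yam u].
Proof.
move=> im /andP[/eqP su yu]; rewrite -su in im.
have [p [a [b [s [eu sp]]]]] := split2 im.
by exists p, a, b, s; split=> //; move: yu; rewrite eu yam_cat => /andP[].
Qed.

Lemma good_sw p a b s m : goodw m (p ++ [:: a, b & s]) ->
  yam (p ++ [:: b, a & s]) -> goodw m (p ++ [:: b, a & s]).
Proof. by rewrite /goodw !size_cat /= => /andP[-> _] ->. Qed.

Lemma semU_ext m i f g : (i.+1 < m)%N -> (forall u, goodw m u -> f u = g u) ->
  forall u, goodw m u -> semU i f u = semU i g u.
Proof.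
move=> im fg u gu; have [p [a [b [s [eu sp yp yu]]]]] := good_split2 im gu.
rewrite eu -sp !semU_cat; rewrite eu in gu yu.
rewrite (fg _ gu); congr (_ + _).
have [ys|nys] := boolP (yam (p ++ [:: b, a & s])); first by rewrite (fg _ (good_sw gu ys)).
by rewrite (semB_exit yu nys) !mul0r.
Qed.

Lemma semU_quad m i f u : (i.+1 < m)%N -> goodw m u ->
  semU i (semU i f) u = (q - 1) * semU i f u + q * f u.
Proof.
move=> im gu; have [p [a [b [s [-> <- yp _]]]]] := good_split2 im gu.
rewrite !semU_cat; have [<-|ab] := eqVneq a b.
  rewrite !ct_rcons eqxx; have x0 := ct_neq0 p a; move: (ct p a) (f _) x0 => x y x0.
  by rewrite (semA_same q_neq1 x0) semB_same !mul0r !addr0; ring.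
rewrite !ct_rcons (eq_sym b) (negbTE ab) !mul1r; have xy := ct_neq yp ab.
move: (ct p a) (ct p b) (f _) (f _) xy => x y F1 F2 xy.
have e1 := semA_quad q xy; have e2 := semA_sum q xy; have e3 := semB_mul q x y ab.
exact: quad_combine (etrans (congr1 _ e3) e1) e2.
Qed.

Lemma ct_perm p p' a : perm_eq p p' -> ct p a = ct p' a.
Proof. by rewrite /ct => /ccount_perm ->. Qed.

Lemma perm_rconsl p p' (a : nat) : perm_eq p p' -> perm_eq (rcons p a) (rcons p' a).
Proof. by rewrite -!cats1 perm_cat2r. Qed.

Lemma semU_comm f p a b t c d s :
  let i := size p in let j := size (p ++ [:: a, b & t]) in
  let u := p ++ [:: a, b & t ++ [:: c, d & s]] in
  semU i (semU j f) u = semU j (semU i f) u.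
Proof.
move=> i j u; rewrite /u /i /j.
have E x y z w : p ++ [:: x, y & t ++ [:: z, w & s]] = (p ++ [:: x, y & t]) ++ [:: z, w & s].
  by rewrite -catA.
have pe x y : perm_eq (p ++ [:: x, y & t]) (p ++ [:: y, x & t]).
  by rewrite perm_cat2l -[_ :: _]/([:: x; y] ++ t) -[X in perm_eq _ X]/([:: y; x] ++ t)
    perm_cat2r (permEl (perm_catC [:: x] [:: y])).
have sz : size (p ++ [:: a, b & t]) = size (p ++ [:: b, a & t]) by rewrite !size_cat.
have U g x y z w : size (p ++ [:: x, y & t]) = size (p ++ [:: a, b & t]) ->
    semU (size (p ++ [:: a, b & t])) g (p ++ [:: x, y & t ++ [:: z, w & s]]) =
    semA q (ct (p ++ [:: x, y & t]) z) (ct (rcons (p ++ [:: x, y & t]) z) w)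
      * g (p ++ [:: x, y & t ++ [:: z, w & s]])
    + semB z w q (ct (p ++ [:: x, y & t]) z) (ct (rcons (p ++ [:: x, y & t]) z) w)
      * g (p ++ [:: x, y & t ++ [:: w, z & s]]).
  by move=> <-; rewrite E semU_cat -!E.
rewrite semU_cat !U // !semU_cat.
rewrite (ct_perm c (pe b a)) (ct_perm d (perm_rconsl c (pe b a))).
move: (semA q _ _) (semA q _ _) (semB _ _ _ _ _) (semB _ _ _ _ _) (f _) (f _) (f _) (f _).
by move=> A A' B B' F1 F2 F3 F4; ring.
Qed.

Lemma good_split4 m i j u : (i.+1 < j)%N -> (j.+1 < m)%N -> goodw m u ->
  exists p a b t c d s, [/\ u = p ++ [:: a, b & t ++ [:: c, d & s]], size p = i
    & size (p ++ [:: a, b & t]) = j].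
Proof.
move=> ij jm /andP[/eqP su _]; rewrite -su in jm.
have [p' [c [d [s [eu sj]]]]] := split2 jm.
rewrite -sj in ij; have [p [a [b [t [ep si]]]]] := split2 ij.
by exists p, a, b, t, c, d, s; split=> //; rewrite -?ep // eu ep -catA.
Qed.

Lemma semX_module m : hecke_module m (semX m).
Proof.
have ext i f g u : (i.+1 < m)%N -> (forall u, goodw m u -> f u = g u) -> goodw m u ->
    semX m i f u = semU i g u.
  by move=> im fg gu; rewrite semX_good // (semU_ext im fg).
split.
- move=> i a u v; apply: boolp.funext => w.
  rewrite /semX /semU [in RHS]addrfctE [in RHS]scalrfctE.
  case: ifP => _; rewrite !addrfctE !scalrfctE /GRing.scale /=.
    move: (semA _ _ _) (semB _ _ _ _ _) (u _) (u _) (v _) (v _) => A B U1 U2 V1 V2; ring.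
  move: (u _) (v _) => U V; ring.
- move=> i v im; apply: boolp.funext => w; rewrite addrfctE !scalrfctE /GRing.scale /=.
  have [gw|bw] := boolP (goodw m w); last first.
    by rewrite !(semX_bad _ _ bw); move: (v w) => V; ring.
  rewrite (ext _ _ (semU i v)) //; last exact: semX_good.
  by rewrite (semX_good _ _ gw) (semU_quad _ im gw).
- move=> i j v ij jm; apply: boolp.funext => w.
  have im : (i.+1 < m)%N by lia.
  have [gw|bw] := boolP (goodw m w); last by rewrite !(semX_bad _ _ bw).
  rewrite (ext _ _ (semU j v)) //; last exact: semX_good.
  rewrite (ext _ _ (semU i v)) //; last exact: semX_good.
  have [p [a [b [t [c [d [s [-> <- <-]]]]]]]] := good_split4 ij jm gw.
  exact: semU_comm.
- move=> i v im; have im' := ltnW im; apply: boolp.funext => w.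
  have [gw|bw] := boolP (goodw m w); last by rewrite !(semX_bad _ _ bw).
  have X2 j k : (j.+1 < m)%N -> forall u, goodw m u ->
      semX m j (semX m k v) u = semU j (semU k v) u.
    by move=> jm u gu; rewrite (ext _ _ (semU k v)) // => ?; exact: semX_good.
  rewrite (ext _ _ _ w im' (X2 _ _ im)) // (ext _ _ _ w im (X2 _ _ im')) //.
  have /andP[/eqP sw yw] := gw; rewrite -sw in im.
  have [p [a [b [c [s [ew <-]]]]]] := split3 im.
  by rewrite ew; apply: semU_braid; rewrite -ew.
Qed.

(** * Jucys-Murphy elements *)

Lemma tpn_ord m (a b : 'I_m) : tpn m a b = tperm a b.
Proof. by rewrite /tpn !valK. Qed.

(** The transposition of [a] and [k.+1] is the one of [a] and [k] conjugated by the generator [k],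
    and the length grows by two, so the corresponding Hecke elements multiply. The left factor is
    what requires [opT_left]. *)
Lemma opT_tpn m (V : lmodType K) (X : nat -> V -> V) v a k :
  hecke_module m X -> (a < k)%N -> (k.+1 < m)%N ->
  opT X v (tpn m a k.+1) = X k (opT X (X k v) (tpn m a k)).
Proof.
move=> hX ak km; have [i [j [hi hj sk]]] := sgen_ord km.
have am : (a < m)%N by lia.
have -> : tpn m a k.+1 = tperm (Ordinal am) j by rewrite -hj -tpn_ord.
have -> : tpn m a k = tperm (Ordinal am) i by rewrite -hi -tpn_ord.
set o := Ordinal am.
have ij : i != j by rewrite ord_neqF //; lia.
have oi : o != i by rewrite ord_neqF //=; lia.
have oj : o != j by rewrite ord_neqF //=; lia.
have e : (tperm o j = tperm i j * tperm o i * tperm i j)%g.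
  by rewrite -{1}(tpermV i j) -mulgA -[RHS]/(conjg _ _) tpermJ tpermL tpermD // eq_sym.
rewrite (@hm_opT_desc m V X hX v (tperm o j) k); last first.
  by rewrite (desc_nat _ hi hj) tpermV tpermR tpermD ?hi // 1?eq_sym.
congr (X _ _); rewrite e sk -mulgA tperm2 mulg1 -hi.
rewrite (hm_opT_left hX) ?hj ?hi // tpermR tpermD // 1?eq_sym //= hj; lia.
Qed.

(* [L_(p+1) = q^-1 T_p (1 + L_p T_p)]; indices are shifted by one, as [JM] is 1-based. *)
Lemma act_JM_rec m (V : lmodType K) (X : nat -> V -> V) v k :
  hecke_module m X -> (k.+1 < m)%N ->
  hact X v (JM m k.+2) = q^-1 *: X k (v + hact X (X k v) (JM m k.+1)).
Proof.
move=> hX km; rewrite /JM !(act_hsum) !big_map /= (hmXD hX) scalerDr.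
rewrite big_cons; congr (_ + _).
  rewrite act_scale act_hT subn1 expr1 [k.+2.-1.-1]/=; congr (_ *: _).
  have [i [j [hi hj sk]]] := sgen_ord km.
  rewrite -[X in tpn _ _ X]hj -[X in tpn _ X _]hi tpn_ord -sk.
  rewrite -[sgen m k]mul1g (hm_opT_asc hX) ?opT1 //.
  by rewrite plen1.
rewrite (hmX_sum hX) scaler_sumr -[2%N]addn1 iotaDl big_map.
rewrite !big_seq; apply: eq_bigr => i; rewrite mem_iota => ik.
rewrite !act_scale !act_hT (hmXZ hX) scalerA -invfM -exprS add1n subSS; congr (_ *: _).
by apply: opT_tpn => //; lia.
Qed.

Section JMCoefficient.
Variables (F : fieldType) (Q x y F1 F2 : F).
Hypothesis Q1 : Q - 1 != 0.
Let c z := (z - 1) / (Q - 1).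

(** [c x] is the quantum integer of a content when [x] is the matching power of [Q]. The
    off-diagonal coefficient of $T(1+LT)$ is proportional to [1 + c x * A + c y * A'], which is
    zero; the diagonal one simplifies to [Q * c y]. *)
Lemma JM_combine A A' B B' : x != y -> A = semA Q x y -> A' = semA Q y x ->
  B * B' = semP Q x y ->
  A * (F1 + c x * (A * F1 + B * F2)) + B * (F2 + c y * (A' * F2 + B' * F1)) = Q * (c y * F1).
Proof.
move=> xy eA eA' eB; have yx := xy; rewrite eq_sym in yx; have Q1' : Q != 1 by rewrite -subr_eq0.
transitivity ((A + c x * (A * A) + c y * (B * B')) * F1 + B * F2 * (1 + c x * A + c y * A')).
  by ring.
rewrite eB (_ : 1 + _ + _ = 0).
  rewrite mulr0 addr0 [RHS]mulrA; congr (_ * _); rewrite eA /c /semA /semP; field.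
  by rewrite !subr_eq0 ?xy ?yx ?Q1'.
rewrite eA eA' /c /semA; field.
by rewrite !subr_eq0 ?xy ?yx ?Q1'.
Qed.

Lemma JM_same : Q * (F1 + c x * (Q * F1)) = Q * (c (Q * x) * F1).
Proof. by rewrite /c; field. Qed.
End JMCoefficient.

Lemma act_JM m f k w : (k < m)%N -> goodw m w ->
  hact (semX m) f (JM m k.+1) w = qint (cont w k) * f w.
Proof.
have hX := semX_module m.
elim: k f w => [|k IH] f w km gw.
  rewrite /JM act_hsum big_map [iota _ _]/= big_nil (_ : cont w 0 = 0).
    by rewrite /qint expr0z subrr !mul0r.
  move: gw; rewrite /cont /ccount take0 /= => /andP[/eqP sw].
  case: w sw => [|a w]; first by move=> sw; rewrite -sw in km.
  by rewrite /yam /= /addable /= ltnn orbF => _ /andP[/eqP -> _].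
rewrite (act_JM_rec _ hX km) scalrfctE (semX_good _ _ gw) -[LHS]/(q^-1 * _).
rewrite (@semU_ext m _ _ (fun u => f u + qint (cont u k) * semU k f u)) //; last first.
  move=> u gu; rewrite addrfctE IH ?semX_good //; exact: ltnW.
have [p [a [b [s [ew sp yp yu]]]]] := good_split2 km gw.
have [cl cr] : cont (p ++ [:: a, b & s]) k = ccount p a /\
    cont (p ++ [:: a, b & s]) k.+1 = ccount (rcons p a) b.
  by rewrite -sp cont_cat -cat_rcons -(size_rcons p a) cont_cat.
have cl' : cont (p ++ [:: b, a & s]) k = ccount p b by rewrite -sp cont_cat.
rewrite ew -sp !semU_cat sp cl cl' cr /qint -/(ct _ _) -/(ct (rcons p a) b) -/(ct p a) -/(ct p b).
apply: (mulfI q_neq0); rewrite [LHS]mulrA divff ?q_neq0 // mul1r.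
have [<-|ab] := eqVneq a b.
  rewrite !ct_rcons eqxx; have x0 := ct_neq0 p a; move: (ct p a) (f _) x0 => x y x0.
  by rewrite (semA_same q_neq1 x0) semB_same !mul0r !addr0; apply: JM_same q_neq1.
rewrite !ct_rcons (eq_sym b) (negbTE ab) !mul1r; have xy := ct_neq yp ab.
exact: (JM_combine _ _ q_neq1 xy erefl erefl (semB_mul _ _ _ ab)).
Qed.

(** * Tableaux and their words *)

Local Open Scope nat_scope.

Lemma posof_cons a nu j c : posof (a :: nu) j.+1 c = a + posof nu j c.
Proof. by rewrite /posof /= addnA. Qed.

Lemma posof0 nu c : posof nu 0 c = c.
Proof. by rewrite /posof take0. Qed.

Lemma posofK nu j c : c < nth 0 nu j ->
  [/\ rowof nu (posof nu j c) = j, colof nu (posof nu j c) = c & posof nu j c < sumn nu].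
Proof.
elim: nu j => [|a nu IH] [|j] //= ca; first by rewrite posof0 ca ltn_addr.
have [h1 h2 h3] := IH _ ca.
by rewrite posof_cons ltnNge leq_addr /= addKn h1 h2 ltn_add2l.
Qed.

Lemma rowcolK nu k : k < sumn nu ->
  posof nu (rowof nu k) (colof nu k) = k /\ colof nu k < nth 0 nu (rowof nu k).
Proof.
elim: nu k => [|a nu IH] //= k kn; case: ltnP => ka; first by rewrite posof0.
have [h1 h2] := IH (k - a) ltac:(lia).
by rewrite posof_cons h1; split=> //; lia.
Qed.

Lemma count_row nu j (P : pred nat) :
  count (fun x => (rowof nu x == j) && P x) (iota 0 (sumn nu))
  = count (fun c => P (posof nu j c)) (iota 0 (nth 0 nu j)).
Proof.
elim: nu j P => [|a nu IH] j P /=; first by rewrite nth_nil.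
rewrite iotaD count_cat (_ : iota (0 + a) _ = map (addn a) (iota 0 (sumn nu))) ?count_map;
  last by rewrite -iotaDl addn0.
have -> : count (fun x => ((if x < a then 0 else (rowof nu (x - a)).+1) == j) && P x) (iota 0 a)
          = if j is 0 then count P (iota 0 a) else 0.
  case: j => [|j].
    by apply: eq_in_count => x; rewrite mem_iota => /= ->.
  rewrite -[RHS](count_pred0 (iota 0 a)).
  by apply: eq_in_count => x; rewrite mem_iota => /= ->.
have E x : ((if a + x < a then 0%R else (rowof nu (a + x - a)).+1)) = (rowof nu x).+1.
  by rewrite ltnNge leq_addr addKn.
case: j => [|j].
  rewrite -[RHS]addn0; congr (_ + _).
  rewrite -[RHS](count_pred0 (iota 0 (sumn nu))).
  by apply: eq_count => x /=; rewrite E.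
rewrite add0n; transitivity (count (fun c => P (a + posof nu j c)) (iota 0 (nth 0 nu j))).
  apply: etrans (IH j (fun x => P (a + x))).
  by apply: eq_count => x /=; rewrite E eqSS.
by apply: eq_count => c; rewrite posof_cons.
Qed.

Lemma count_initial (P : pred nat) L c : (forall i k, i <= k -> k < L -> P k -> P i) ->
  c < L -> (c < count P (iota 0 L)) = P c.
Proof.
elim: L => // L IH down; rewrite ltnS -[L.+1]addn1 iotaD count_cat /= addn0 add0n => cL.
have down' i k : i <= k -> k < L -> P k -> P i by move=> ik kL; apply: down => //; exact: ltnW.
have [PL|nPL] := boolP (P L).
  have all1 : all P (iota 0 L).
    by apply/allP=> i; rewrite mem_iota => /= iL; apply: down PL => //; exact: ltnW.
  rewrite all_count in all1; rewrite (eqP all1) size_iota addn1 ltnS cL; symmetry.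
  exact: down PL.
rewrite addn0; case: (ltngtP c L) cL => // [cL _|-> _]; first exact: IH.
rewrite (negbTE nPL); apply/negbTE; rewrite -leqNgt.
by have := count_size P (iota 0 L); rewrite size_iota.
Qed.

Lemma pnat_ord m (w : 'S_m) (i : 'I_m) : pnat w i = w i.
Proof. by rewrite /pnat valK. Qed.

Lemma dpnatE m (w : 'S_m) k (km : k < m) : pnat w k = w (Ordinal km).
Proof. exact: (pnat_ord w (Ordinal km)). Qed.

Lemma pnat_lt m (w : 'S_m) k : k < m -> pnat w k < m.
Proof. by move=> km; rewrite dpnatE. Qed.

Lemma pnatKV m (w : 'S_m) k : k < m -> pnat w (pnat (w^-1)%g k) = k.
Proof. by move=> km; rewrite (dpnatE (w^-1)%g km) pnat_ord permKV. Qed.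

Lemma pnatK m (w : 'S_m) k : k < m -> pnat (w^-1)%g (pnat w k) = k.
Proof. by move=> km; rewrite (dpnatE w km) pnat_ord permK. Qed.

Lemma count_ord n (P : pred nat) : count P (iota 0 n) = #|[set x : 'I_n | P x]|.
Proof.
by rewrite -sum1_count -[in LHS](subn0 n) -/(index_iota 0 n) big_mkord sum1dep_card.
Qed.

Lemma count_perm n (d : 'S_n) (P : pred nat) :
  count (fun k => P (pnat (d^-1)%g k)) (iota 0 n) = count P (iota 0 n).
Proof.
rewrite !count_ord -(card_imset _ (@perm_inj _ (d^-1)%g)).
congr #|pred_of_set _|; apply/setP=> x; rewrite [RHS]inE.
apply/imsetP/idP=> [[y]|Px]; first by rewrite inE /= pnat_ord => Py ->.
by exists (d x); rewrite ?inE /= ?pnat_ord permK.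
Qed.

(** The column half of standardness is carried by [yam (wd nu d)]. The two halves are followed
    separately when a descent of [d] is peeled off. *)
Definition rowinc (nu : seq nat) m (d : 'S_m) : Prop :=
  forall j c c', c < c' -> c' < nth 0 nu j -> pnat d (posof nu j c) < pnat d (posof nu j c').

Definition wd (nu : seq nat) m (d : 'S_m) : seq nat :=
  mkseq (fun k => rowof nu (pnat (d^-1)%g k)) m.

Section TableauWord.
Variables (m : nat) (nu : seq nat) (d : 'S_m).
Hypotheses (sz : sumn nu = m) (inc : rowinc nu d).

Lemma size_wd : size (wd nu d) = m. Proof. by rewrite size_mkseq. Qed.

Lemma nth_wd k : k < m -> nth 0 (wd nu d) k = rowof nu (pnat (d^-1)%g k).
Proof. by move=> km; rewrite nth_mkseq. Qed.

Lemma take_wd t : t <= m -> take t (wd nu d) = mkseq (fun k => rowof nu (pnat (d^-1)%g k)) t.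
Proof. by move=> tm; rewrite /wd /mkseq -map_take take_iota; congr map; congr iota; lia. Qed.

Lemma wd_count t j : t <= m ->
  count_mem j (take t (wd nu d)) = count (fun c => pnat d (posof nu j c) < t) (iota 0 (nth 0 nu j)).
Proof.
move=> tm; rewrite -(count_row nu j (fun x => pnat d x < t)) sz -(count_perm d).
rewrite take_wd // count_map (_ : iota 0 m = iota 0 t ++ iota t (m - t)); last first.
  by rewrite -{1}(subnKC tm) iotaD.
rewrite count_cat.
rewrite [X in _ + X](_ : _ = 0) ?addn0.
  apply: eq_in_count => k; rewrite mem_iota => /= kt.
  by rewrite pnatKV ?kt ?andbT //; exact: leq_trans tm.
rewrite -[RHS](count_pred0 (iota t (m - t))).
apply: eq_in_count => k; rewrite mem_iota (subnKC tm) => /andP[tk km].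
by rewrite pnatKV // ltnNge tk andbF.
Qed.

Lemma wd_entry t j c : t <= m -> c < nth 0 nu j ->
  (pnat d (posof nu j c) < t) = (c < count_mem j (take t (wd nu d))).
Proof.
move=> tm cj; rewrite wd_count //.
rewrite (@count_initial (fun c => pnat d (posof nu j c) < t)) // => i k ik kj.
by case: (ltngtP i k) ik => // [ik _|-> //]; apply: ltn_trans; exact: inc.
Qed.

Lemma wd_count_all j : count_mem j (wd nu d) = nth 0 nu j.
Proof.
rewrite -[in LHS](take_oversize (leqnn (size (wd nu d)))) size_wd wd_count //.
rewrite -[RHS](size_iota 0); apply/eqP; rewrite -all_count; apply/allP => c.
by rewrite mem_iota => /= cj; apply: pnat_lt; rewrite -sz; case: (posofK cj).
Qed.

(** In an increasing row the smaller entries are exactly those to the left, so counting the earlier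
    equal letters gives the column. *)
Lemma wd_colof k : k < m ->
  count_mem (nth 0 (wd nu d) k) (take k (wd nu d)) = colof nu (pnat (d^-1)%g k).
Proof.
move=> km; rewrite nth_wd //; set x := pnat _ k.
have xm : x < m by apply: pnat_lt.
have [xE cE] : posof nu (rowof nu x) (colof nu x) = x /\ colof nu x < nth 0 nu (rowof nu x).
  by apply: rowcolK; rewrite sz.
have dx : pnat d x = k by rewrite pnatKV.
have := wd_entry (ltnW km) cE; rewrite xE dx ltnn => /esym/negbT; rewrite -leqNgt => le1.
have := wd_entry km cE; rewrite xE dx ltnSn => /esym.
rewrite (take_nth 0) ?size_wd // count_rcons nth_wd // -/x eqxx addn1 ltnS => le2.
by apply/eqP; rewrite eqn_leq le1 le2.
Qed.

Lemma wd_cont k : k < m ->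
  cont (wd nu d) k = ((colof nu (pnat (d^-1)%g k))%:Z - (rowof nu (pnat (d^-1)%g k))%:Z)%R.
Proof. by move=> km; rewrite /cont /ccount wd_colof // nth_wd. Qed.

Lemma wd_entryK k : k < m ->
  pnat d (posof nu (nth 0 (wd nu d) k) (count_mem (nth 0 (wd nu d) k) (take k (wd nu d)))) = k.
Proof.
move=> km; rewrite wd_colof // nth_wd //.
by rewrite (rowcolK _).1 ?pnatKV // sz; apply: pnat_lt.
Qed.

End TableauWord.

Lemma yam_nthP u : (forall k, k < size u -> addable (take k u) (nth 0 u k)) -> yam u.
Proof.
elim/last_ind: u => // u a IH h; rewrite yam_rcons; apply/andP; split.
  apply: IH => k ku; have := h k; rewrite size_rcons ltnS (ltnW ku) nth_rcons ku => /(_ isT).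
  by rewrite -cats1 takel_cat // ltnW.
by have := h (size u); rewrite size_rcons ltnSn nth_rcons ltnn eqxx -cats1 take_size_cat //; apply.
Qed.

Lemma yam_addable u k : yam u -> k < size u -> addable (take k u) (nth 0 u k).
Proof.
move=> yu ku; have := yam_take k.+1 yu.
by rewrite (take_nth 0 ku) yam_rcons => /andP[].
Qed.

Lemma standard_rowinc nu m (d : 'S_m) : sumn nu = m -> standard nu d -> rowinc nu d.
Proof.
move=> sz /forallP st j c c' cc' c'j.
have [r1 c1 p1] := posofK (ltn_trans cc' c'j); have [r2 c2 p2] := posofK c'j.
rewrite sz in p1 p2; have /forallP/(_ (Ordinal p2)) := st (Ordinal p1).
by rewrite /= r1 r2 c1 c2 eqxx cc' /= (dpnatE d p1) (dpnatE d p2).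
Qed.

Lemma standard_colinc nu m (d : 'S_m) : sumn nu = m -> standard nu d ->
  forall j c, c < nth 0 nu j.+1 -> c < nth 0 nu j ->
  pnat d (posof nu j c) < pnat d (posof nu j.+1 c).
Proof.
move=> sz /forallP st j c c1 c0.
have [r1 c1' p1] := posofK c0; have [r2 c2 p2] := posofK c1.
rewrite sz in p1 p2; have /forallP/(_ (Ordinal p2)) := st (Ordinal p1).
by rewrite /= r1 r2 c1' c2 eqxx ltnSn orbT /= (dpnatE d p1) (dpnatE d p2).
Qed.

Lemma partition_nth nu m j : is_partition_of m nu -> nth 0 nu j.+1 <= nth 0 nu j.
Proof.
case/and3P=> so _ _; have [js|js] := ltnP j.+1 (size nu); last by rewrite (nth_default 0 js).
by have /(sortedP 0)/(_ _ js) := so.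
Qed.

Lemma standard_yam nu m (d : 'S_m) : is_partition_of m nu -> standard nu d -> yam (wd nu d).
Proof.
move=> pn st; have sz : sumn nu = m by case/and3P: pn => _ _ /eqP.
have inc := standard_rowinc sz st.
apply: yam_nthP => k; rewrite size_wd => km.
rewrite /addable; have := wd_colof sz inc km; have := wd_entryK sz inc km.
have := nth_wd nu d km; case: (nth 0 (wd nu d) k) => //= j rj eK cj.
rewrite cj; rewrite cj in eK; set c := colof _ _ in cj eK *.
have cn : c < nth 0 nu j.+1.
  by rewrite rj /c; have [] := @rowcolK nu (pnat (d^-1)%g k); rewrite // sz pnat_lt.
have cn' := leq_trans cn (partition_nth j pn).
by rewrite -(wd_entry sz inc (ltnW km) cn') -[X in _ < X]eK; apply: standard_colinc.
Qed.

(** * Shapes and content idempotents *)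

Definition is_shape (nu : seq nat) (w : seq nat) : Prop :=
  all (fun x => 0 < x) nu /\ forall j, nth 0 nu j = count_mem j w.

(** The zeros of a nonincreasing sequence come last, so the filter in [shape_le] is a truncation and
    shifts no row index. *)
Lemma filter_mkseq_pos (g : nat -> nat) n : (forall j, g j.+1 <= g j) ->
  exists k, [/\ k <= n, [seq x <- mkseq g n | 0 < x] = mkseq g k,
    forall j, j < k -> 0 < g j & k < n -> g k = 0].
Proof.
move=> dec; have mono i j : i <= j -> g j <= g i.
  elim: j => [|j IH]; first by rewrite leqn0 => /eqP ->.
  by rewrite leq_eqVlt => /orP[/eqP -> //|/IH]; apply: leq_trans.
elim: n => [|n [k [kn fk pos zk]]]; first by exists 0.
have -> : mkseq g n.+1 = rcons (mkseq g n) (g n).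
  by rewrite /mkseq -[n.+1]addn1 iotaD map_cat /= add0n cats1.
rewrite filter_rcons; case: (posnP (g n)) => gn.
  exists k; split=> //; first exact: leqW.
  by rewrite ltnS leq_eqVlt => /orP[/eqP ->|/zk].
have {kn zk} ek : k = n.
  by apply/eqP; rewrite eqn_leq kn leqNgt; apply/negP=> /[dup] /ltnW/mono le /zk g0; lia.
exists n.+1; split=> // [|j|]; last by rewrite ltnn.
  by rewrite fk ek /mkseq -[n.+1]addn1 iotaD map_cat /= add0n cats1.
by rewrite ltnS leq_eqVlt => /orP[/eqP -> //|]; rewrite -ek; exact: pos.
Qed.

Lemma filter_shape w n : yam w -> (forall j, n <= j -> count_mem j w = 0) ->
  is_shape [seq x <- mkseq (fun j => count_mem j w) n | 0 < x] w.
Proof.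
move=> yw zn; split; first exact: filter_all.
have [|k [kn -> pos zk]] := @filter_mkseq_pos (fun j => count_mem j w) n.
  by move=> j; exact: yam_count.
move=> j; have [jk|kj] := ltnP j k; first by rewrite nth_mkseq.
rewrite nth_default ?size_mkseq //; symmetry; apply/eqP; rewrite -leqn0.
have [kn'|nk] := ltnP k n; last by rewrite zn // (leq_trans nk).
by rewrite -(zk kn'); apply: yam_count_le.
Qed.

Lemma yam_lt w a : yam w -> a \in w -> a < size w.
Proof.
elim/last_ind: w a => // w b IH a; rewrite yam_rcons mem_rcons inE size_rcons => /andP[yw].
rewrite /addable => ob /orP[/eqP ->|/(IH _ yw)/leqW //].
case: b ob => //= b lt; rewrite ltnS; apply: IH => //.
by rewrite -has_pred1 has_count (leq_ltn_trans _ lt).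
Qed.

Lemma shape_exists w : yam w -> exists nu, is_shape nu w.
Proof.
move=> yw; exists [seq x <- mkseq (fun j => count_mem j w) (size w) | 0 < x].
apply: filter_shape => // j js; apply/count_memPn/negP => /(yam_lt yw); lia.
Qed.

Lemma sum_count_mem (w : seq nat) n : all (fun a => a < n) w ->
  \sum_(j < n) count_mem (val j) w = size w.
Proof.
elim: w => [|a w IH] /=; first by rewrite big1.
case/andP=> an /IH <-; rewrite big_split /= -add1n; congr (_ + _).
rewrite (bigD1 (Ordinal an)) //= eqxx big1 // => i.
by rewrite -val_eqE /= eq_sym => /negbTE ->.
Qed.

Lemma is_shape_partition nu w : yam w -> is_shape nu w -> is_partition_of (size w) nu.
Proof.
move=> yw [pos E]; apply/and3P; split=> //.
  by apply/(sortedP 0) => i _; rewrite !E; exact: yam_count.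
rewrite sumnE (big_nth 0) big_mkord; under eq_bigr do rewrite E.
rewrite sum_count_mem //; apply/allP=> a aw; rewrite ltnNge; apply/negP=> na.
have := E a; rewrite nth_default // => /esym/eqP.
by rewrite -leqn0 leqNgt -has_count has_pred1 aw.
Qed.

Lemma pos_nth_eq (s t : seq nat) : all (fun x => 0 < x) s -> all (fun x => 0 < x) t ->
  (forall j, nth 0 s j = nth 0 t j) -> s = t.
Proof.
move=> ps pt E; apply: (@eq_from_nth _ 0) => // ; apply/eqP.
have le (a b : seq nat) : all (fun x => 0 < x) a -> (forall j, nth 0 a j = nth 0 b j) ->
    size a <= size b.
  move=> pa e; rewrite leqNgt; apply/negP=> ba.
  by have /allP/(_ _ (mem_nth 0 ba)) := pa; rewrite e nth_default.
by rewrite eqn_leq !le.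
Qed.

Lemma is_shape_perm nu w w' : is_shape nu w -> perm_eq w w' -> is_shape nu w'.
Proof. by move=> [p1 e1] /seq.permP pe; split=> // j; rewrite e1 pe. Qed.

Lemma mem_allseqs b (s : seq nat) : all (fun x => x <= b) s -> s \in allseqs (size s) b.
Proof.
elim: s => // x s IH /andP[xb /IH h].
by apply: (allpairs_f (fun y t => y :: t)) => //; rewrite (mem_iota 0 b.+1).
Qed.

Lemma mem_partitions m nu : is_partition_of m nu -> nu \in partitions m.
Proof.
move=> pn; rewrite mem_filter pn; case/and3P: pn => _ pos /eqP <-.
have le : all (fun x => x <= sumn nu) nu.
  elim: nu {pos} => //= a nu IH; rewrite leq_addr; apply: sub_all IH => x.
  by move=> h; rewrite (leq_trans h) // leq_addl.
have sz : size nu <= sumn nu.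
  elim: nu {le} pos => //= a nu IH /andP[a0 /IH h].
  by rewrite -add1n leq_add.
apply/flatten_mapP; exists (size nu); last exact: mem_allseqs.
by rewrite mem_iota add0n ltnS sz.
Qed.

(** Ensures that a content differing from the prescribed residue occurs among the factors of
    [contproj], which then kills the word. *)
Lemma qint_cont_Rres m w k : goodw m w -> k < m -> qint (cont w k) \in Rres m.
Proof.
case/andP=> /eqP sw yw km; rewrite mem_undup.
have [nu sh] := shape_exists yw; have pn := is_shape_partition yw sh.
set a := nth 0 w k; set c := count_mem a (take k w).
have ca : c < nth 0 nu a.
  rewrite sh.2 /c -[X in _ < count_mem a X](cat_take_drop k w) count_cat -addn1 leq_add2l.
  by rewrite (drop_nth 0) ?sw // /= eqxx.
have [r1 c1 p1] := posofK ca.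
have -> : qint (cont w k) = resq nu (posof nu a c) by rewrite /resq r1 c1.
rewrite sw in pn; apply: allpairs_f; first exact: mem_partitions.
by rewrite mem_iota /=; case/and3P: pn p1 => _ _ /eqP ->.
Qed.

Lemma rowof_mono nu k k' : k <= k' -> rowof nu k <= rowof nu k'.
Proof.
elim: nu k k' => //= a nu IH k k' kk'.
case: (ltnP k a) => // ak; rewrite (ltnNge k') (leq_trans ak kk') /= ltnS.
by apply: IH; rewrite leq_sub2r.
Qed.

Lemma standard1 nu m : sumn nu = m -> standard nu (1%g : 'S_m).
Proof.
move=> sz; apply/forallP=> k; apply/forallP=> k'; apply/implyP; rewrite !perm1.
case/orP=> /andP[/eqP e lt].
  have [kE _] := @rowcolK nu k ltac:(by rewrite sz).
  have [kE' _] := @rowcolK nu k' ltac:(by rewrite sz).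
  by rewrite -kE -kE' e /posof ltn_add2l.
by rewrite ltnNge; apply/negP=> /(rowof_mono nu); rewrite leqNgt lt.
Qed.

Definition rw (nu : seq nat) : seq nat := mkseq (rowof nu) (sumn nu).

Lemma wd1 nu m : sumn nu = m -> wd nu (1%g : 'S_m) = rw nu.
Proof.
move=> sz; rewrite /wd /rw sz; apply/eq_in_map => k; rewrite mem_iota => /= km.
by rewrite invg1 (dpnatE _ (km : k < m)) perm1.
Qed.

Lemma rw_yam m nu : is_partition_of m nu -> yam (rw nu).
Proof.
move=> pn; have sz : sumn nu = m by case/and3P: pn => _ _ /eqP.
by rewrite -(wd1 sz); apply: standard_yam => //; exact: standard1.
Qed.

Lemma wd_shape m nu (d : 'S_m) : is_partition_of m nu -> rowinc nu d -> is_shape nu (wd nu d).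
Proof. by case/and3P=> _ pos /eqP sz inc; split=> // j; rewrite wd_count_all. Qed.

Lemma rw_shape m nu : is_partition_of m nu -> is_shape nu (rw nu).
Proof.
move=> pn; have sz : sumn nu = m by case/and3P: pn => _ _ /eqP.
by rewrite -(wd1 sz); apply: wd_shape => //; apply: standard_rowinc => //; exact: standard1.
Qed.

Lemma rw_good m nu : is_partition_of m nu -> goodw m (rw nu).
Proof.
move=> pn; rewrite /goodw (rw_yam pn) size_mkseq andbT.
by case/and3P: pn.
Qed.

Local Open Scope ring_scope.

Definition isdiag m (h : hecke m) (d : seq nat -> K) :=
  forall f w, goodw m w -> hact (semX m) f h w = d w * f w.

Lemma isdiag_hprod m (I : eqType) (l : seq I) (F : I -> hecke m) d :
  {in l, forall i, isdiag (F i) (d i)} ->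
  isdiag (hprod [seq F i | i <- l]) (fun w => \prod_(i <- l) d i w).
Proof.
have hX := semX_module m.
elim: l => [|i l IH] hl f w gw; first by rewrite big_nil act_one mul1r.
rewrite /= (act_hmul hX) IH //; last by move=> j jl; apply: hl; rewrite inE jl orbT.
by rewrite hl ?mem_head // big_cons mulrCA mulrA.
Qed.

(** $E_v$ with an arbitrary prescription [r] of residues, so that [Ev] and the projector [wproj]
    onto a single word are both instances. *)
Definition contproj (r : nat -> K) m : hecke m :=
  hprod [seq hprod [seq hscale (r p - c)^-1 (hsub (JM m p) (hscale c (hone m)))
                   | c <- Rres m & c != r p]
        | p <- iota 1 m].

Lemma Ev_contproj nu m (d : 'S_m) : Ev nu d = contproj (rv nu d) m.
Proof. by []. Qed.

Lemma act_contproj r m f w : goodw m w ->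
  hact (semX m) f (contproj r m) w = if all (fun p => qint (cont w p) == r p.+1) (iota 0 m) then f w else 0.
Proof.
have hX := semX_module m => gw.
pose d p c (u : seq nat) := (r p - c)^-1 * (qint (cont u p.-1) - c).
have D : isdiag (contproj r m)
    (fun u => \prod_(p <- iota 1 m) \prod_(c <- [seq c <- Rres m | c != r p]) d p c u).
  apply: isdiag_hprod => p; rewrite mem_iota => /andP[p0 pm].
  apply: isdiag_hprod => c _ g u gu.
  rewrite act_scale act_sub act_scale act_one scalrfctE addrfctE opprfctE scalrfctE.
  case: p p0 pm => // p _ pm; rewrite act_JM //.
  by rewrite -[LHS]/(_^-1 * (qint (cont u p) * g u - c * g u)) -mulrBl mulrA.
rewrite D //; case: ifP => [/allP al|/negbT/allPn[p]].
  rewrite big1_seq ?mul1r // => p /=; rewrite mem_iota => /andP[p0 pm].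
  rewrite big1_seq // => c /=; rewrite mem_filter => /andP[cr _].
  case: p p0 pm cr => // p _ pm cr; rewrite /d (eqP (al p _)) ?mem_iota //.
  by rewrite mulVf // subr_eq0 eq_sym.
rewrite mem_iota => /= pm ne.
suff -> : \prod_(p0 <- iota 1 m) \prod_(c <- [seq c <- Rres m | c != r p0]) d p0 c w = 0 by rewrite mul0r.
apply/eqP; rewrite prodf_seq_eq0; apply/hasP; exists p.+1; first by rewrite mem_iota add1n ltnS.
rewrite /= prodf_seq_eq0; apply/hasP; exists (qint (cont w p)).
  by rewrite mem_filter ne qint_cont_Rres.
by rewrite /d subrr mulr0 eqxx.
Qed.

(** Once the prefixes agree, the content of the last node determines its row by [ccount_inj]. Hence
    joint eigenvalues of the Jucys-Murphy elements separate the basis. *)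
Lemma cont_word_inj u w : yam u -> yam w -> size u = size w ->
  (forall k, (k < size u)%N -> cont u k = cont w k) -> u = w.
Proof.
elim/last_ind: u w => [|u a IH] w; first by case: w.
case/lastP: w => [|w b]; first by rewrite size_rcons.
rewrite !yam_rcons !size_rcons => /andP[yu _] /andP[yw _] [sz] h.
have e : u = w.
  apply: IH => // k ku; have := h k (ltnW ku).
  by rewrite /cont !nth_rcons -sz ku -!cats1 !takel_cat -?sz ?(ltnW ku).
move: (h (size u) (leqnn _)); rewrite e /cont !nth_rcons !ltnn !eqxx -!cats1 !take_size_cat //.
by move=> /(ccount_inj yw) ->.
Qed.

Lemma act_wordproj m f u w : goodw m u -> goodw m w ->
  hact (semX m) f (contproj (fun p => qint (cont u p.-1)) m) w = if w == u then f w else 0.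
Proof.
move=> gu gw; rewrite act_contproj //; congr (if _ then _ else _).
have /andP[/eqP su yu] := gu; have /andP[/eqP sw yw] := gw.
apply/allP/eqP=> [h|-> p _ //]; apply: cont_word_inj; rewrite ?su ?sw // => k km.
by have /eqP/qint_inj := h k ltac:(by rewrite mem_iota).
Qed.

(** * Matrix units *)

Local Open Scope nat_scope.

(** The number of inversions of a word: the measure for sorting here, and later the counterpart of
    [plen]. *)
Fixpoint winv (u : seq nat) : nat :=
  if u is a :: s then count (fun b => b < a) s + winv s else 0.

Lemma winv_sw p a b s : b < a -> winv (p ++ [:: a, b & s]) = (winv (p ++ [:: b, a & s])).+1.
Proof.
move=> ba; elim: p => [|c p IH] /=; first by rewrite ba ltnNge (ltnW ba) /=; lia.
by rewrite IH addnS !count_cat /= [(a < c) + _]addnCA.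
Qed.

Lemma unsorted_split u : ~~ sorted leq u -> exists p a b s, u = p ++ [:: a, b & s] /\ b < a.
Proof.
elim: u => //= a u IH; case: u IH => //= b u IH; rewrite negb_and -ltnNge.
case/orP=> [ba|/IH [p [c [d [s [-> dc]]]]]]; first by exists [::], a, b, u.
by exists (a :: p), c, d, s.
Qed.

Local Open Scope ring_scope.

Definition delta (u : seq nat) : seq nat -> K^o := fun w => (w == u)%:R.

Lemma deltaxx u : delta u u = 1.
Proof. by rewrite /delta eqxx. Qed.

Lemma delta_neq u w : w != u -> delta u w = 0.
Proof. by rewrite /delta => /negbTE ->. Qed.

Lemma opT_bad0 m f (v : 'S_m) w : ~~ goodw m w -> f w = 0 -> opT (semX m) f v w = 0.
Proof.
move=> bw; rewrite /opT; elim: (rword v) f => //= i s IH f fw.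
by apply: IH; rewrite semX_bad // fw mulr0.
Qed.

Lemma sum_fctE (I : Type) (r : seq I) (P : pred I) (F : I -> seq nat -> K^o) w :
  (\sum_(i <- r | P i) F i) w = \sum_(i <- r | P i) F i w.
Proof. by apply: (big_morph (fun f : seq nat -> K^o => f w)). Qed.

Lemma act_bad0 m f (h : hecke m) w : ~~ goodw m w -> f w = 0 -> hact (semX m) f h w = 0.
Proof.
move=> bw fw; rewrite /hact sum_fctE big1 // => v _.
by rewrite scalrfctE opT_bad0 // scaler0.
Qed.

Definition goodf m (f : seq nat -> K^o) := forall w, ~~ goodw m w -> f w = 0.

Lemma act_goodf m f (h : hecke m) : goodf m f -> goodf m (hact (semX m) f h).
Proof. by move=> gf w bw; apply: act_bad0 => //; exact: gf. Qed.

Lemma goodf_delta m u : goodw m u -> goodf m (delta u).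
Proof. by move=> gu w bw; rewrite delta_neq //; apply: contraNneq bw => ->. Qed.

Lemma goodf_eq m f g : goodf m f -> goodf m g -> (forall w, goodw m w -> f w = g w) -> f = g.
Proof.
move=> gf gg e; apply: boolp.funext => w.
by have [gw|bw] := boolP (goodw m w); [exact: e | rewrite gf // gg].
Qed.

Lemma goodfZ m c f : goodf m f -> goodf m (c *: f).
Proof. by move=> gf w bw; rewrite scalrfctE gf // scaler0. Qed.

Definition wproj m u : hecke m := contproj (fun p => qint (cont u p.-1)) m.

Lemma act_wproj m u f : goodw m u -> goodf m f ->
  hact (semX m) f (wproj m u) = f u *: delta u.
Proof.
move=> gu gf; apply: (@goodf_eq m); [exact: act_goodf|exact/goodfZ/goodf_delta|].
move=> w gw; rewrite act_wordproj // scalrfctE /delta.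
case: eqP => [->|_]; first exact/esym/mulr1.
exact/esym/mulr0.
Qed.

Definition munit m (h : hecke m) u0 w0 : Prop := forall f, goodf m f ->
  hact (semX m) f h = f u0 *: delta w0.

Lemma munit_wproj m u : goodw m u -> munit (wproj m u) u u.
Proof. by move=> gu f gf; exact: act_wproj. Qed.

Lemma munit_mul m (h g : hecke m) u v w : goodw m v -> munit h u v -> munit g v w ->
  munit (hmul h g) u w.
Proof.
move=> gv mh mg f gf; rewrite (act_hmul (semX_module m)) mh // mg; last exact/goodfZ/goodf_delta.
by congr (_ *: _); rewrite scalrfctE deltaxx; exact: mulr1.
Qed.

(** Equality would put row [b] directly above row [a] with the same length, and [a] would not be
    addable. *)
Lemma ct_neq_q2 p a b : yam p -> addable p a -> a != b -> ct p b != q * ct p a.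
Proof.
move=> yp oa ab; rewrite /ct -[X in X * _](expr1z q) -expfzDr ?q_neq0 //.
apply/eqP=> /qz_inj; rewrite /ccount => e.
have [ca|ca] := leqP a b.
  by have := yam_count_le yp ca; move: (count_mem a p) (count_mem b p) e => A B e le; lia.
have le := yam_count_le yp (ltnW ca).
have ca1 : a = b.+1 by move: (count_mem a p) (count_mem b p) e le => A B e le; lia.
move: oa e; rewrite /addable ca1 /=; move: (count_mem b.+1 p) (count_mem b p) => A B oa e; lia.
Qed.

Lemma act_sgen m (V : lmodType K) (X : nat -> V -> V) (hX : hecke_module m X) v i :
  (i.+1 < m)%N -> hact X v (hT (sgen m i)) = X i v.
Proof. by move=> im; rewrite act_hT -[sgen m i]mul1g (hm_opT_asc hX) ?opT1 // plen1. Qed.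

(** The generator is cut down by the projectors of the two words, which leaves one entry of [semB].
    It is nonzero because, both orders being standard, the two contents are distinct and do not
    differ by one. *)
Lemma munit_sw m p a b s : goodw m (p ++ [:: a, b & s]) -> goodw m (p ++ [:: b, a & s]) ->
  a != b -> exists h : hecke m, munit h (p ++ [:: a, b & s]) (p ++ [:: b, a & s]).
Proof.
move=> g1 g2 ab; set u := p ++ [:: a, b & s]; set u' := p ++ [:: b, a & s].
have hX := semX_module m; pose i := size p.
have im : (i.+1 < m)%N.
  by case/andP: g1 => /eqP <- _; rewrite size_cat /= /i; lia.
have [yp oa ob] : [/\ yam p, addable p a & addable p b].
  move: (g1) (g2) => /andP[_ +] /andP[_]; rewrite !yam_cat /=.
  by move=> /andP[-> /andP[-> _]] /andP[_ /andP[-> _]].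
set c := semB b a q (ct p b) (ct p a).
have c0 : c != 0.
  rewrite /c /semB; case: ifP => _; last exact: oner_neq0.
  rewrite /semP mulf_neq0 ?invr_eq0 ?expf_neq0 ?mulf_neq0 // subr_eq0.
  - by rewrite eq_sym ct_neq_q2 // eq_sym.
  - by rewrite ct_neq_q2.
  - by rewrite ct_neq // eq_sym.
exists (hscale c^-1 (hmul (hmul (wproj m u) (hT (sgen m i))) (wproj m u'))) => f gf.
have gu : goodf m (semX m i (delta u)) by rewrite -(act_sgen hX) //; exact/act_goodf/goodf_delta.
rewrite act_scale !(act_hmul hX) (act_wproj g1 gf) (act_sgen hX) // (hmXZ hX).
rewrite (act_wproj g2); last exact: goodfZ.
have e : semX m i (delta u) u' = c.
  rewrite semX_good // /u' semU_cat delta_neq; last first.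
    by rewrite eqseq_cat // eqxx /= eqseq_cons negb_and (eq_sym b) ab.
  rewrite deltaxx (_ : ct (rcons p b) a = ct p a); last first.
    by rewrite ct_rcons (eq_sym b) (negbTE ab) mul1r.
  by rewrite -/c mulr0 add0r mulr1.
rewrite scalerA; congr (_ *: _).
transitivity (c^-1 * (f u * semX m i (delta u) u')); first by [].
by rewrite e mulrCA mulVf ?mulr1.
Qed.

Lemma rcons_good_sw p a b s m : (b < a)%N -> goodw m (p ++ [:: a, b & s]) ->
  goodw m (p ++ [:: b, a & s]).
Proof. by move=> ba g; apply: (good_sw g); apply: yam_sw_gt (ltnW ba) _; case/andP: g. Qed.

(** Exchanges removing inversions never leave the standard words, so each word is linked in both
    directions to the sorted word of its class. This makes every block a full matrix algebra. *)
Lemma munit_sort m u : goodw m u ->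
  [/\ goodw m (sort leq u), exists h : hecke m, munit h u (sort leq u)
    & exists h : hecke m, munit h (sort leq u) u].
Proof.
have [k] := ubnP (winv u); elim: k u => // k IH u hk gu.
have [so|/unsorted_split[p [a [b [s [eu ba]]]]]] := boolP (sorted leq u).
  rewrite sorted_sort //; last exact: leq_trans.
  by split=> //; exists (wproj m u); exact: munit_wproj.
rewrite eu in gu hk *; have gu' := rcons_good_sw ba gu.
have ab : a != b by rewrite neq_ltn ba orbT.
have [h1 m1] := munit_sw gu gu' ab; rewrite eq_sym in ab.
have [h2 m2] := munit_sw gu' gu ab.
have [] := IH _ _ gu'; first by rewrite winv_sw in hk.
have es : sort leq (p ++ [:: b, a & s]) = sort leq (p ++ [:: a, b & s]).
  apply/perm_sortP; [exact: leq_total|exact: leq_trans|exact: anti_leq|].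
  by rewrite perm_cat2l -[_ :: _]/([:: b; a] ++ s) -[X in perm_eq _ X]/([:: a; b] ++ s)
    perm_cat2r (permEl (perm_catC [:: b] [:: a])).
rewrite es => gs [h3 m3] [h4 m4]; split=> //.
  by exists (hmul h1 h3); exact: munit_mul gu' m1 m3.
by exists (hmul h4 h2); exact: munit_mul gu' m4 m2.
Qed.

Lemma munit_exists m u v : goodw m u -> goodw m v -> perm_eq u v ->
  exists h : hecke m, munit h u v.
Proof.
move=> gu gv pe; have [gs [h mh] _] := munit_sort gu; have [_ _ [g mg]] := munit_sort gv.
have es : sort leq u = sort leq v.
  by apply/perm_sortP; [exact: leq_total|exact: leq_trans|exact: anti_leq|].
by exists (hmul h g); apply: munit_mul gs mh _; rewrite es.
Qed.

(** * Counting standard tableaux *)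

Local Open Scope nat_scope.

Section Counting.
Variable N : nat.

(** The bound [N] makes sums over rows finite. A Yamanouchi word of length at most [N] only has
    letters below [N], so none is lost ([mem_words]). *)
Fixpoint words (m : nat) : seq (seq nat) :=
  if m is m'.+1 then [seq rcons u j | u <- words m', j <- [seq j <- iota 0 N | addable u j]]
  else [:: [::]].

Lemma mem_words m u : m <= N -> (u \in words m) = goodw m u.
Proof.
elim: m u => [|m IH] u mN; first by rewrite inE /goodw; case: u.
case/lastP: u => [|u a].
  by apply/negbTE/allpairsPdep => -[v [j [_ _]]]; case: v.
rewrite /goodw size_rcons eqSS yam_rcons; apply/allpairsPdep/idP => [[v [j [vm]]]|].
  rewrite mem_filter => /andP[oj _] /rcons_inj[-> ->].
  by rewrite IH ?(ltnW mN) // in vm; case/andP: vm => -> ->.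
case/and3P=> su yu oa; exists u, a; split=> //; first by rewrite IH ?(ltnW mN) // /goodw su.
have /yam_lt : yam (rcons u a) by rewrite yam_rcons yu.
move=> /(_ a); rewrite mem_rcons mem_head size_rcons (eqP su) => /(_ isT) am.
by rewrite mem_filter oa mem_iota /= (leq_trans am).
Qed.

Lemma words_uniq m : uniq (words m).
Proof.
elim: m => // m IH; apply: allpairs_uniq_dep => // [u _|[u a] [v b] _ _ /= /rcons_inj[]].
  exact/filter_uniq/iota_uniq.
by move=> -> ->.
Qed.

(** The number of standard tableaux whose shape is given by the letter counts of [u]. It is zero
    when these do not form a partition of [m] (for [m <= N]), which spares side conditions in the
    recursions. *)
Definition nwords m (u : seq nat) := \sum_(v <- words m) perm_eq u v.

Definition part (u : seq nat) := forall j, count_mem j.+1 u <= count_mem j u.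

Lemma part_perm u v : perm_eq u v -> part u -> part v.
Proof. by move=> /seq.permP e pu j; rewrite -!e. Qed.

Lemma part_le u i j : part u -> i <= j -> count_mem j u <= count_mem i u.
Proof.
move=> pu; elim: j => [|j IH]; first by rewrite leqn0 => /eqP ->.
rewrite leq_eqVlt => /orP[/eqP -> //|/IH]; exact: leq_trans (pu j).
Qed.

Lemma part_lt u a : part u -> a \in u -> a < size u.
Proof.
move=> pu au; rewrite -(size_iota 0 a.+1); apply: uniq_leq_size; first exact: iota_uniq.
move=> i; rewrite mem_iota ltnS => /= ia; rewrite -has_pred1 has_count.
by apply: leq_trans (part_le pu ia); rewrite -has_count has_pred1.
Qed.

Lemma nwords_perm m u v : perm_eq u v -> nwords m u = nwords m v.
Proof. by move=> e; apply: eq_bigr => w _; rewrite (permPl e). Qed.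

Lemma nwords_npart m u : m <= N -> ~ part u -> nwords m u = 0.
Proof.
move=> mN npu; rewrite /nwords big_seq big1 // => v; rewrite mem_words // => /andP[_ yv].
apply/eqP; rewrite eqb0; apply/negP=> e; apply: npu.
by apply: (@part_perm v); [rewrite perm_sym | move=> j; exact: yam_count].
Qed.

Lemma perm_rcons_rem (u v : seq nat) j : perm_eq u (rcons v j) = (j \in u) && perm_eq (rem j u) v.
Proof.
have [ju|nju] /= := boolP (j \in u).
  by rewrite (permPl (perm_to_rem ju)) (permPr (permEl (perm_rcons j v))) perm_cons.
apply/negbTE/negP=> /perm_mem e; move: nju; rewrite e mem_rcons mem_head //.
Qed.

Lemma nwordsS m u : m < N -> part u ->
  nwords m.+1 u = \sum_(j < N | val j \in u) nwords m (rem (val j) u).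
Proof.
move=> mN pu; rewrite /nwords /= big_allpairs_dep /=.
rewrite exchange_big /=; rewrite !big_seq; apply: eq_bigr => v; rewrite mem_words ?(ltnW mN) //.
case/andP=> sv yv.
rewrite big_filter -[iota 0 N]/(iota 0 N) -{1}[N]subn0 -/(index_iota 0 N) big_mkord.
rewrite [LHS]big_mkcond [RHS]big_mkcond /=; apply: eq_bigr => j _.
rewrite perm_rcons_rem; case: ifP => ov; case: ifP => ju //=.
case e: (perm_eq _ _) => //; exfalso; move/negbT: ov; rewrite /addable negb_or => /andP[j0].
have C i : count_mem i u = (val j == i) + count_mem i v.
  by rewrite (seq.permP (perm_to_rem ju)) /= (seq.permP e).
have := pu (val j).-1; rewrite prednK ?lt0n // !C eqxx.
rewrite (_ : (val j == (val j).-1) = false); last by rewrite eq_sym ltn_eqF // prednK ?lt0n.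
rewrite -leqNgt; move: (count_mem _ v) (count_mem _ v) => A B h1 h2; lia.
Qed.

Lemma nwords_self m j u : part (rcons u j) -> nwords m (rem j (rcons u j)) = nwords m u.
Proof.
move=> _; apply: nwords_perm; rewrite -(perm_cons j) -(permPr (permEl (perm_rcons j u))) perm_sym.
by apply: perm_to_rem; rewrite mem_rcons mem_head.
Qed.

Lemma addable_part u j : part u -> addable u j = true <-> part (rcons u j).
Proof.
move=> pu; split=> [oj i|pj].
  rewrite !count_rcons; have := pu i; case: (eqVneq j i.+1) => [ji|_] h; last by lia.
  by move: oj; rewrite /addable ji /=; lia.
rewrite /addable; case: j pj => //= j /(_ j); rewrite !count_rcons eqxx.
by rewrite (_ : (j.+1 == j) = false) ?addn0 ?addn1 //; apply/eqP; lia.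
Qed.

Definition removable (u : seq nat) k := count_mem k.+1 u < count_mem k u.

Lemma removable_part u k : part u -> k \in u -> removable u k = true <-> part (rem k u).
Proof.
move=> pu ku; have C i : count_mem i u = (k == i) + count_mem i (rem k u).
  by rewrite (seq.permP (perm_to_rem ku)).
rewrite /removable !C eqxx; split=> [h i|/(_ k) h]; last by lia.
have := pu i; rewrite !C; case: (eqVneq k i) => [<-|_]; last by lia.
by move=> _; rewrite (_ : (k == k.+1) = false) in h; [lia | apply/eqP; lia].
Qed.

(** Row [j.+1] is addable exactly when row [j] is removable, and row 0 is always addable; the last
    row below [N] is empty, since [size u < N]. *)
Lemma count_corners u : part u -> size u < N ->
  \sum_(j < N) addable u (val j) = (\sum_(j < N) removable u (val j)).+1.
Proof.
move=> pu; case: N => // M; rewrite ltnS => su; rewrite big_ord_recl big_ord_recr /=.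
rewrite [removable _ _](_ : _ = false) ?addn0 ?add1n //.
apply/negbTE; rewrite /removable -leqNgt (leq_trans _ (leq0n _)) // leqn0.
by apply/eqP/count_memPn/negP => /(part_lt pu); rewrite ltnNge su.
Qed.

Lemma part_exchange (u : seq nat) j k : k \in u -> j != k -> part (rcons (rem k u) j) ->
  addable u j /\ removable u k.
Proof.
move=> ku jk px; have C i : count_mem i u = (k == i) + count_mem i (rem k u).
  by rewrite (seq.permP (perm_to_rem ku)).
split.
  rewrite /addable; case: j jk px => //= j jk /(_ j).
  rewrite !count_rcons !C eqxx (_ : (j.+1 == j) = false); last by rewrite gtn_eqF.
  by rewrite (eq_sym k j.+1) (negbTE jk) => h; lia.
have := px k; rewrite /removable !count_rcons !C eqxx (negbTE jk).
by have -> : (k == k.+1) = false; [rewrite ltn_eqF | move=> h; lia].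
Qed.

Lemma perm_rem_rcons (u : seq nat) j k : k \in u -> perm_eq (rem k (rcons u j)) (rcons (rem k u) j).
Proof.
move=> ku; rewrite -(perm_cons k) -(permPl (perm_to_rem _)) ?mem_rcons ?inE ?ku ?orbT //.
rewrite -rcons_cons -!cats1 perm_cat2r; exact: perm_to_rem.
Qed.

(* Young's lattice is a differential poset: adding then removing a corner differs from removing then
   adding one by the identity, since a shape has one more addable than removable corner. No side
   condition is needed on [rcons (rem k u) j] because [nwords] vanishes off partitions. *)
Lemma nwords_rcons m u (j : 'I_N) : m < N -> part u ->
  nwords m.+1 (rcons u (val j)) = addable u (val j) * nwords m u
  + \sum_(k < N | (val k \in u) && (j != k)) nwords m (rcons (rem (val k) u) (val j)).
Proof.
move=> mN pu; have [oj|nj] := boolP (addable u (val j)).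
  have pj : part (rcons u (val j)) by apply/addable_part.
  rewrite nwordsS // mul1n (bigD1 j) ?mem_rcons ?mem_head //= nwords_self //; congr (_ + _).
  apply: eq_big => [k|k /andP[ku kj]].
    by rewrite mem_rcons inE val_eqE (eq_sym j k); case: eqP; rewrite ?andbF.
  rewrite mem_rcons inE val_eqE (negbTE kj) /= in ku.
  exact/nwords_perm/perm_rem_rcons.
rewrite nwords_npart //; last by move/(addable_part _ pu); exact/negP.
rewrite mul0n add0n big1 // => k /andP[ku jk]; apply: nwords_npart; first exact: ltnW.
by move=> /(part_exchange ku jk) []; rewrite (negbTE nj).
Qed.

(** This is $\sum_{\mu} f^{\mu}=(m+1)f^{\lambda}$ over the shapes $\mu$ obtained by adding a node to
    $\lambda$. After [nwords_rcons] the induction applies to $\lambda$ with a corner removed. *)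
Lemma nwords_up m u : m < N -> part u -> size u = m ->
  \sum_(j < N) nwords m.+1 (rcons u (val j)) = m.+1 * nwords m u.
Proof.
elim: m u => [|m IH] u mN pu su; (under eq_bigr do rewrite nwords_rcons //);
  rewrite big_split /= -big_distrl /= count_corners ?su // mulSn -addnA mulSn;
  congr (_ + _).
  by case: u su {pu} => // _; rewrite !big1 // => i _; rewrite ?big1.
rewrite [in RHS]nwordsS ?(ltnW mN) // [RHS]big_distrr /=; move En: (nwords m.+1 u) => n.
rewrite (exchange_big_dep (fun k : 'I_N => val k \in u)) /=; last by move=> i j _ /andP[].
have -> : \sum_(j < N) removable u j = \sum_(j < N | val j \in u) removable u j.
  rewrite [RHS]big_mkcond; apply: eq_bigr => j _; case: ifP => // /negbT nu.
  by rewrite /removable (count_memPn nu) ltn0.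
rewrite big_distrl -big_split /=; apply: eq_bigr => k ku.
have [rk|nk] := boolP (removable u k).
  have pk : part (rem (val k) u) by apply/removable_part.
  rewrite mul1n -IH // ?(ltnW mN) //; last by rewrite size_rem // su.
  (* In the induction hypothesis for [rem k u] the term [j = k] restores [u]; it accounts for the
     contribution of the removable corner [k]. *)
  rewrite [RHS](bigD1 k) //=; congr (_ + _); last by apply: eq_bigl => j; rewrite ku.
  rewrite -En; apply: nwords_perm; rewrite (permPr (permEl (perm_rcons _ _))).
  exact: perm_to_rem.
rewrite mul0n add0n nwords_npart ?muln0 ?(ltnW (ltnW mN)) //; last first.
  by move/(removable_part pu ku); exact/negP.
rewrite big1 // => j /andP[_ jk]; apply: nwords_npart; first exact: ltnW.
by move=> /(part_exchange ku jk) [] _; rewrite (negbTE nk).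
Qed.

(** This is $\sum_\lambda (f^\lambda)^2=m!$, with one summand $f^\lambda$ for each standard tableau
    of shape $\lambda$; [nwords_up] gives the factor in each step. *)
Lemma nwords_total m : m <= N -> \sum_(u <- words m) nwords m u = m`!.
Proof.
elim: m => [|m IH] mN; first by rewrite /= big_seq1 /nwords big_seq1.
rewrite factS -IH ?(ltnW mN) // big_distrr /= big_allpairs_dep /=.
rewrite !big_seq; apply: eq_bigr => u; rewrite mem_words ?(ltnW mN) // => /andP[/eqP su yu].
have pu : part u by move=> j; exact: yam_count.
rewrite -nwords_up // big_filter -{1}[N]subn0 -/(index_iota 0 N) big_mkord.
rewrite big_mkcond /=; apply: eq_bigr => j _; case: ifP => // /negbT nj.
by rewrite nwords_npart // => /(addable_part _ pu); exact/negP.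
Qed.
End Counting.

Definition word_pairs m := [seq (u, v) | u <- words m m, v <- [seq v <- words m m | perm_eq u v]].

Lemma size_word_pairs m : size (word_pairs m) = m`!.
Proof.
rewrite -(nwords_total (leqnn m)) /word_pairs size_allpairs_dep sumnE big_map.
apply: eq_bigr => u _; rewrite size_filter /nwords -sum1_count big_mkcond /=.
by apply: eq_bigr => v _; case: perm_eq.
Qed.

Lemma mem_word_pairs m u v :
  ((u, v) \in word_pairs m) = [&& goodw m u, goodw m v & perm_eq u v].
Proof.
apply/allpairsPdep/idP => [[u' [v' [hu hv [-> ->]]]]|/and3P[gu gv pe]].
  by move: hv; rewrite mem_filter => /andP[-> hv]; rewrite -!(@mem_words m) ?hu ?hv.
by exists u, v; rewrite mem_filter pe !mem_words.
Qed.

Lemma word_pairs_uniq m : uniq (word_pairs m).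
Proof.
apply: allpairs_uniq_dep => [|u _|[u v] [u' v'] _ _ /= [-> ->] //]; first exact: words_uniq.
exact/filter_uniq/words_uniq.
Qed.

(** * Faithfulness *)

Local Open Scope ring_scope.

Lemma act_suml_r m (V : lmodType K) (X : nat -> V -> V) v (I : finType)
    (c : I -> K) (g : I -> hecke m) :
  hact X v (\sum_i c i *: (g i : regV m)) = \sum_i c i *: hact X v (g i).
Proof.
have D h1 h2 : hact X v ((h1 : regV m) + h2) = hact X v h1 + hact X v h2.
  by rewrite -haddE act_add.
have Z a h : hact X v (a *: (h : regV m)) = a *: hact X v h by rewrite -hscaleE act_scale.
have Z0 : hact X v (0 : regV m) = 0 by rewrite -[0](scale0r (0 : regV m)) Z scale0r.
rewrite (big_morph (fun h : regV m => hact X v h) D Z0).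
by apply: eq_bigr => i _; rewrite Z.
Qed.

Section Faithful.
Variable m : nat.
Local Notation n := #|{: 'S_m}|.
Local Notation P i := (nth ([::], [::]) (word_pairs m) i).

Lemma word_pairs_card : size (word_pairs m) = n.
Proof. by rewrite size_word_pairs card_Sn. Qed.

Lemma pair_good (i : 'I_n) : [/\ goodw m (P i).1, goodw m (P i).2 & perm_eq (P i).1 (P i).2].
Proof.
have : P i \in word_pairs m by rewrite mem_nth // word_pairs_card.
by case: (P i) => u v; rewrite mem_word_pairs => /and3P.
Qed.

Lemma munit_coef (g : 'I_n -> hecke m) (x : 'I_n -> K) (k : 'I_n) :
  (forall i : 'I_n, munit (g i) (P i).1 (P i).2) ->
  hact (semX m) (delta (P k).1) (\sum_i x i *: (g i : regV m)) (P k).2 = x k.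
Proof.
move=> mg; have [gk _ _] := pair_good k.
have scE c (f : seq nat -> K^o) w : (c *: f) w = c * f w by [].
rewrite act_suml_r sum_fctE (bigD1 k) //= big1 => [|i ik].
  by rewrite addr0 scE mg ?scE ?deltaxx ?mulr1 //; exact: goodf_delta.
rewrite scE mg ?scE; last exact: goodf_delta.
have [e1|n1] := eqVneq (P i).1 (P k).1; last by rewrite (delta_neq n1) mul0r mulr0.
have [e2|n2] := eqVneq (P k).2 (P i).2; last by rewrite (delta_neq n2) !mulr0.
case/eqP: ik; apply: val_inj => /=; apply/eqP.
rewrite -(nth_uniq ([::], [::]) _ _ (word_pairs_uniq m)) ?word_pairs_card //.
by rewrite [P i]surjective_pairing [P k]surjective_pairing e1 e2.
Qed.

(* There are [m!] matrix units, so they form a basis of the Hecke algebra. *)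
Lemma hecke_faithful (h : hecke m) :
  (forall u, goodw m u -> hact (semX m) (delta u) h = 0) -> (h : regV m) = 0.
Proof.
move=> h0.
have [g mg] : exists g : 'I_n -> hecke m, forall i : 'I_n, munit (g i) (P i).1 (P i).2.
  have [|g mg] := @boolp.choice 'I_n (hecke m) (fun i g => munit g (P i).1 (P i).2); last by exists g.
  move=> i.
  by have [g1 g2 pe] := pair_good i; exact: munit_exists.
pose G : 'M[K]_n := \matrix_(i, j) g i (enum_val j).
have comb (x : 'rV[K]_n) w : (x *m G) 0 (enum_rank w) = (\sum_i x 0 i *: (g i : regV m)) w.
  rewrite mxE sum_ffunE; apply: eq_bigr => i _.
  by rewrite mxE enum_rankK ffunE.
have Gfree : row_free G.
  rewrite -kermx_eq0; apply/rowV0P => x /sub_kermxP xG; apply/rowP => k; rewrite mxE.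
  rewrite -(munit_coef (x 0) k mg).
  have -> : \sum_i x 0 i *: (g i : regV m) = 0.
    by apply/ffunP=> w; rewrite -comb xG mxE ffunE.
  by rewrite /hact big1 // => w _; rewrite ffunE scale0r.
pose y : 'rV[K]_n := \row_j h (enum_val j).
have yG : y *m invmx G *m G = y by rewrite mulmxKV // -row_free_unit.
have hE : (h : regV m) = \sum_i (y *m invmx G) 0 i *: (g i : regV m).
  by apply/ffunP=> w; rewrite -comb yG mxE enum_rankK.
rewrite hE big1 // => i _; rewrite -(munit_coef ((y *m invmx G) 0) i mg) -hE.
by rewrite h0 ?scale0r //; case: (pair_good i).
Qed.
End Faithful.

(** * Fixed vectors and dominance *)

Lemma xnuE nu m w : xnu nu m w = (rowstab nu w)%:R.
Proof.
rewrite /xnu hsumE big_map big_enum sum_ffunE big_mkcond (bigD1 w) //= inE big1.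
  rewrite addr0; case: (rowstab nu w); first by rewrite !ffunE eqxx.
  by [].
by move=> v vw; case: ifP => // _; rewrite ffunE eq_sym (negbTE vw).
Qed.

Section RowStabilizer.
Variables (nu : seq nat) (m i : nat).
Hypotheses (im : (i.+1 < m)%N) (ri : rowof nu i = rowof nu i.+1).

Lemma rowstab_sgen (w : 'S_m) : rowstab nu (w * sgen m i)%g = rowstab nu w.
Proof.
have [a [b [ha hb ->]]] := sgen_ord im.
apply: eq_forallb => k; rewrite permM; congr (_ == _).
by case: tpermP => [->|->|//]; rewrite ha hb ri.
Qed.

Lemma xnu_mulTs : hmulTs (xnu nu m) i = hscale q (xnu nu m).
Proof.
apply/ffunP=> w; rewrite !ffunE !xnuE rowstab_sgen.
by move: ((_)%:R : K) => x; case: ifP => _ //; ring.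
Qed.

Lemma act_xnu_fixed (V : lmodType K) (X : nat -> V -> V) v : hecke_module m X ->
  X i (hact X v (xnu nu m)) = q *: hact X v (xnu nu m).
Proof. by move=> hX; rewrite -(act_mulTs hX) // xnu_mulTs act_scale. Qed.

End RowStabilizer.

(** The values at a descent have preimages in the same rows but in reverse order; as [rowof] is
    monotone, the two rows coincide. Reduced words of the stabilizer thus only use generators inside
    rows. *)
Lemma rowstab_desc nu m (w : 'S_m) i : rowstab nu w -> (plen (w * sgen m i)%g < plen w)%N ->
  rowof nu i = rowof nu i.+1.
Proof.
move=> /forallP st d; have im := desc_range d; have [a [b [ha hb _]]] := sgen_ord im.
rewrite (desc_nat _ ha hb) in d; rewrite -hb -ha.
have ea := st ((w^-1)%g a); have eb := st ((w^-1)%g b); rewrite !permKV in ea eb.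
apply/eqP; rewrite eqn_leq {2}(eqP ea) (eqP eb) (rowof_mono nu (ltnW d)) andbT.
by rewrite -(eqP eb); apply: rowof_mono; rewrite ha hb.
Qed.

Definition fixed_by (nu : seq nat) m (f : seq nat -> K^o) := forall i, (i.+1 < m)%N ->
  rowof nu i = rowof nu i.+1 -> semX m i f = q *: f.

Lemma winv_le u : (winv u <= size u * size u)%N.
Proof.
elim: u => //= a s IH; have := count_size (fun b => (b < a)%N) s; nia.
Qed.

Lemma semA_neqq (F : fieldType) (Q x y : F) : x != y -> y != Q * x -> Q - semA Q x y != 0.
Proof.
move=> xy yQx; have yx : y - x != 0 by rewrite subr_eq0 eq_sym.
have -> : Q - semA Q x y = (y - Q * x) / (y - x) by rewrite /semA; field.
by rewrite mulf_neq0 ?invr_eq0 // subr_eq0.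
Qed.

(** At [w] the fixed equation reads [(q - semA) * f w = semB * f (sw i w)]. At an ascent the second
    content is smaller, hence not one more than the first, and the left side is nonzero. *)
Lemma fixed_step m f i w : (i.+1 < m)%N -> goodw m w -> semX m i f = q *: f ->
  (nth 0%N w i < nth 0%N w i.+1)%N -> f w != 0 -> goodw m (sw i w) /\ f (sw i w) != 0.
Proof.
move=> im gw fx; have [p [a [b [s [ew sp yp yw]]]]] := good_split2 im gw.
have lt : ((size p).+1 < size p)%N = false by rewrite ltnNge leqnSn.
rewrite ew -sp !nth_cat ltnn subnn lt subSnn /= => ab fw.
rewrite sw_cat; have : semX m i f w = q * f w by rewrite fx.
rewrite (semX_good _ _ gw) ew -sp semU_cat; set B := semB _ _ _ _ _.
have yx : ct p b != q * ct p a.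
  rewrite /ct -[X in X * _](expr1z q) -expfzDr ?q_neq0 //; apply/eqP => /qz_inj e.
  by have := ccount_lt yp ab; rewrite e; lia.
have xy := ct_neq yp (negbT (ltn_eqF ab)).
have ct_rcons_ab : ct (rcons p a) b = ct p b by rewrite ct_rcons (ltn_eqF ab) mul1r.
rewrite ct_rcons_ab => e.
have {}e : (q - semA q (ct p a) (ct p b)) * f (p ++ [:: a, b & s]) = B * f (p ++ [:: b, a & s]).
  by rewrite mulrBl -e addrAC subrr add0r.
have : B * f (p ++ [:: b, a & s]) != 0 by rewrite -e; exact: mulf_neq0 (semA_neqq xy yx) fw.
rewrite mulf_eq0 negb_or => /andP[B0 f0]; split=> //.
rewrite ew in gw yw; apply: good_sw gw _; apply/negPn/negP => /(semB_exit yw) B00.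
by move: B0; rewrite /B B00 eqxx.
Qed.

(* Exchanging adjacent letters of a block stays in the support of a fixed vector, so the support
   contains a word that decreases weakly on each block; each block then adds a horizontal strip. *)
Lemma fixed_sorted rho m f w : fixed_by rho m f -> goodw m w -> f w != 0 ->
  exists w', [/\ goodw m w', perm_eq w' w, f w' != 0
    & forall i, (i.+1 < m)%N -> rowof rho i = rowof rho i.+1 -> (nth 0 w' i.+1 <= nth 0 w' i)%N].
Proof.
move=> fx; have [k] := ubnP (m * m - winv w); elim: k w => // k IH w hk gw fw.
pose bad i := (rowof rho i == rowof rho i.+1) && (nth 0 w i < nth 0 w i.+1)%N.
have [/hasP[i]|/hasPn h] := boolP (has bad (iota 0 m.-1)).
  rewrite mem_iota => /= im /andP[/eqP ri lt]; have {}im : (i.+1 < m)%N by lia.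
  have [gs fs] := fixed_step im gw (fx _ im ri) lt fw.
  have hi : (winv w < winv (sw i w))%N.
    have [p [a [b [s [ew sp _ _]]]]] := good_split2 im gw.
    have lt' : ((size p).+1 < size p)%N = false by rewrite ltnNge leqnSn.
    move: lt; rewrite ew -sp sw_cat !nth_cat ltnn subnn lt' subSnn /= => ab.
    by rewrite (winv_sw _ _ ab).
  have le : (winv (sw i w) <= m * m)%N.
    by have := winv_le (sw i w); case/andP: gs => /eqP ->.
  have [|w' [g' pe f' srt]] := IH _ _ gs fs; first by lia.
  by exists w'; split=> //; rewrite (perm_trans pe) // sw_perm.
exists w; split=> // i im ri; rewrite leqNgt; apply/negP => lt.
have /h : i \in iota 0 m.-1 by rewrite mem_iota /=; lia.
by rewrite /bad ri eqxx lt.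
Qed.

(** A letter [a.+1] at the start of a block requires an earlier [a], which is at most the index of
    an earlier block. Inside a block the letters only decrease. *)
Lemma sorted_le_row rho m w : goodw m w ->
  (forall i, (i.+1 < m)%N -> rowof rho i = rowof rho i.+1 -> (nth 0 w i.+1 <= nth 0 w i)%N) ->
  forall i, (i < m)%N -> (nth 0 w i <= rowof rho i)%N.
Proof.
case/andP=> /eqP sw yw srt i; have [k] := ubnP i; elim: k i => // k IH [|i] ik im.
  by have := yam_addable yw (k := 0); rewrite sw im take0 /addable ltnn orbF => /(_ isT) /eqP ->.
have [e|ne] := eqVneq (rowof rho i) (rowof rho i.+1).
  by rewrite -e (leq_trans (srt _ im e)) // IH // ltnW.
have lt : (rowof rho i < rowof rho i.+1)%N by rewrite ltn_neqAle ne rowof_mono.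
have := yam_addable yw (k := i.+1); rewrite sw im => /(_ isT).
rewrite /addable; case: (nth 0 w i.+1)%N => //= a lta.
have : a \in take i.+1 w by rewrite -has_pred1 has_count (leq_ltn_trans _ lta).
case/(nthP 0%N) => j; rewrite size_take_min sw => jm <-.
have ji : (j <= i)%N by move: jm; rewrite leq_min ltnS => /andP[].
rewrite nth_take ?ltnS //; apply: leq_ltn_trans lt.
by rewrite (leq_trans (IH j _ _)) ?rowof_mono //; lia.
Qed.

Lemma sumn_take_count rho k : sumn (take k rho)
  = count (fun i => (rowof rho i < k)%N) (iota 0 (sumn rho)).
Proof.
elim: rho k => [|a rho IH] [|k] //=.
  by rewrite -[LHS](count_pred0 (iota 0 (a + sumn rho))); apply: eq_count.
rewrite iotaD count_cat IH; congr (_ + _)%N.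
  rewrite -[LHS](size_iota 0); apply/esym/eqP; rewrite -all_count; apply/allP => i.
  by rewrite mem_iota => /= ->.
have -> : iota (0 + a) (sumn rho) = map (addn a) (iota 0 (sumn rho)) by rewrite -iotaDl addn0.
rewrite count_map; apply: eq_count => i /=.
by rewrite (ltnNge (a + i)%N) leq_addr addKn.
Qed.

Lemma sumn_take_nth (s : seq nat) k : sumn (take k s) = (\sum_(i < k) nth 0 s i)%N.
Proof.
elim: k => [|k IH]; first by rewrite take0 big_ord0.
rewrite big_ord_recr /= -IH; have [ks|sk] := ltnP k (size s).
  by rewrite (take_nth 0%N ks) sumn_rcons.
by rewrite nth_default // addn0 !take_oversize // ltnW.
Qed.

Lemma sumn_take_shape nu w k : is_shape nu w -> sumn (take k nu) = count (fun a => (a < k)%N) w.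
Proof.
case=> pos E; rewrite sumn_take_nth; under eq_bigr do rewrite E.
elim: w {E} => [|a w IH]; first by rewrite big1.
rewrite /= big_split IH; congr (_ + _)%N; case: ltnP => ak.
  rewrite (bigD1 (Ordinal ak)) //= eqxx big1 // => i.
  by rewrite -val_eqE /= eq_sym => /negbTE ->.
by rewrite big1 // => i _; rewrite gtn_eqF // (leq_trans (ltn_ord i)).
Qed.

(** The support contains a word whose letter at each position is at most the row of that position in
    [rho]. Letters below [k] are therefore at least as many as positions in the first [k] rows of
    [rho]. *)
Lemma fixed_dominance rho nu m f w : sumn rho = m -> fixed_by rho m f -> goodw m w -> is_shape nu w ->
  f w != 0 -> forall k, (sumn (take k rho) <= sumn (take k nu))%N.
Proof.
move=> sz fx gw sh fw k; have [w' [g' pe f' srt]] := fixed_sorted fx gw fw.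
have le := sorted_le_row g' srt; rewrite perm_sym in pe.
rewrite (sumn_take_shape _ (is_shape_perm sh pe)) sumn_take_count sz.
have -> : w' = mkseq (nth 0%N w') m by case/andP: g' => /eqP <- _; rewrite mkseq_nth.
rewrite count_map -!sum1_count big_mkcond [leqRHS]big_mkcond big_seq [leqRHS]big_seq.
apply: leq_sum => i; rewrite mem_iota => /= im; case: ifP => // ri.
by rewrite (leq_ltn_trans (le _ im) ri).
Qed.

Lemma dominance_antisym rho nu m : is_partition_of m rho -> is_partition_of m nu ->
  (forall k, (sumn (take k rho) <= sumn (take k nu))%N) -> dominates rho nu -> rho = nu.
Proof.
move=> /and3P[_ p1 /eqP s1] /and3P[_ p2 /eqP s2] le /forallP dom.
have eqk k : sumn (take k rho) = sumn (take k nu).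
  apply/eqP; rewrite eqn_leq le /=.
  (* [dominates] tests finitely many partial sums; past its bound both are equal to [m]. *)
  have [km|mk] := ltnP k (size rho + size nu).+1; first exact: dom (Ordinal km).
  by rewrite !take_oversize ?s1 ?s2 //; lia.
apply: pos_nth_eq => // j.
have step (s : seq nat) : sumn (take j.+1 s) = (sumn (take j s) + nth 0 s j)%N.
  have [js|sj] := ltnP j (size s); first by rewrite (take_nth 0%N js) sumn_rcons.
  by rewrite nth_default // addn0 !take_oversize // ltnW.
by have := eqk j.+1; rewrite !step eqk => /addnI.
Qed.

Lemma sw_row nu i : (i.+1 < sumn nu)%N -> rowof nu i = rowof nu i.+1 -> sw i (rw nu) = rw nu.
Proof.
move=> im ri; have sz : size (rw nu) = sumn nu by rewrite size_mkseq.
have [p [a [b [s [e sp]]]]] := @split2 i (rw nu) ltac:(by rewrite sz).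
have lt : ((size p).+1 < size p)%N = false by rewrite ltnNge leqnSn.
have ab : a = b.
  have : nth 0%N (rw nu) i = nth 0%N (rw nu) i.+1 by rewrite !nth_mkseq // ltnW.
  by rewrite e -sp !nth_cat ltnn subnn lt subSnn.
by rewrite e -sp sw_cat ab.
Qed.

Lemma rw_fixed m nu : is_partition_of m nu -> fixed_by nu m (delta (rw nu)).
Proof.
move=> pn i im ri; have sz : sumn nu = m by case/and3P: pn => _ _ /eqP.
have gr := rw_good pn; apply: boolp.funext => w.
change ((q *: delta (rw nu)) w) with (q * delta (rw nu) w).
have swr : sw i (rw nu) = rw nu by apply: sw_row; rewrite ?sz.
have [gw|bw] := boolP (goodw m w); last by rewrite semX_bad.
rewrite (semX_good _ _ gw); have [ew|nw] := eqVneq w (rw nu); last first.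
  rewrite /semU (delta_neq nw) delta_neq; first by rewrite !mulr0 addr0.
  by apply: contraNneq nw => e; rewrite -(swK i w) e swr.
rewrite ew; have [p [a [b [s [e sp _ _]]]]] := good_split2 im gr.
have ab : a = b.
  by move: swr; rewrite e -sp sw_cat => /eqP; rewrite eqseq_cat // eqxx /= => /eqP[].
rewrite e -sp semU_cat -ab; rewrite e -ab in swr *.
rewrite ct_rcons eqxx; have x0 := ct_neq0 p a.
by rewrite (semA_same q_neq1 x0) semB_same mul0r addr0.
Qed.

Lemma opT_shape m f u (v : 'S_m) : (forall w, ~~ perm_eq w u -> f w = 0) ->
  forall w, ~~ perm_eq w u -> opT (semX m) f v w = 0.
Proof.
rewrite /opT; elim: (rword v) f => //= i s IH f fu; apply: IH => w nw.
rewrite /semX /semU fu // !mulr0 add0r; case: ifP => // _; rewrite fu ?mulr0 //.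
by rewrite (permPl (sw_perm i w)).
Qed.

Lemma act_shape m f u (h : hecke m) : (forall w, ~~ perm_eq w u -> f w = 0) ->
  forall w, ~~ perm_eq w u -> hact (semX m) f h w = 0.
Proof.
move=> fu w nw; rewrite /hact sum_fctE big1 // => v _.
by change (h v * opT (semX m) f v w = 0); rewrite (opT_shape v fu) // mulr0.
Qed.

Lemma act_delta_shape m u (h : hecke m) w : ~~ perm_eq w u -> hact (semX m) (delta u) h w = 0.
Proof.
by apply: act_shape => v nv; rewrite delta_neq //; apply: contraNneq nv => ->.
Qed.

Lemma xnu_fixed rho m f : fixed_by rho m (hact (semX m) f (xnu rho m)).
Proof. by move=> i im ri; apply: act_xnu_fixed => //; exact: semX_module. Qed.

(** The block-decreasing word [w'] of the support is bounded letter by letter by [rw nu], and being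
    a rearrangement of it has the same letter sum; so the two coincide. *)
Lemma fixed_rw m nu f w : is_partition_of m nu -> fixed_by nu m f -> goodw m w ->
  perm_eq w (rw nu) -> f w != 0 -> f (rw nu) != 0.
Proof.
move=> pn fx gw pe fw; have [w' [g' pe' f' srt]] := fixed_sorted fx gw fw.
have sz : sumn nu = m by case/and3P: pn => _ _ /eqP.
have le := sorted_le_row g' srt.
suff <- : w' = rw nu by [].
have sw' : size w' = m by case/andP: g' => /eqP.
have le' i : (nth 0 w' i <= nth 0 (rw nu) i)%N.
  have [im|mi] := ltnP i m; last by rewrite nth_default ?sw'.
  by rewrite nth_mkseq ?sz // le.
have {pe' pe} pe : perm_eq w' (rw nu) by exact: perm_trans pe.
have se : size w' = size (rw nu) by exact: perm_size.
have sume : sumn w' = sumn (rw nu) by rewrite !sumnE; exact: perm_big.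
elim: w' (rw nu) le' se sume {g' f' srt le sw' pe} => [|a u IH] [|b v] //= le [se] sume.
have ab := le 0%N; have uv : (sumn u <= sumn v)%N.
  have : forall i, (nth 0 u i <= nth 0 v i)%N by move=> i; exact: (le i.+1).
  elim: u v se {IH sume le ab} => [|c u IHu] [|d v] //= [se] lei.
  by apply: leq_add; [exact: (lei 0%N) | apply: IHu => // i; exact: (lei i.+1)].
have eab : a = b by move: ab sume => /=; lia.
by rewrite eab (IH v) // => [i|]; [exact: (le i.+1) | lia].
Qed.

(** Fixed vectors of shape [nu] form a line: subtracting a multiple of [delta (rw nu)] makes the
    value at [rw nu] zero, and by [fixed_rw] the remainder vanishes. *)
Lemma act_xnu_shape m nu u : is_partition_of m nu -> goodw m u -> perm_eq u (rw nu) ->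
  exists c : K, hact (semX m) (delta u) (xnu nu m) = c *: delta (rw nu).
Proof.
move=> pn gu pe; set f := hact _ _ _; exists (f (rw nu)).
have gr := rw_good pn; have gf : goodf m f by exact/act_goodf/goodf_delta.
have gd := goodfZ (f (rw nu)) (goodf_delta gr).
apply: (goodf_eq gf gd) => w gw.
have [pw|npw] := boolP (perm_eq w (rw nu)); last first.
  change (f w = f (rw nu) * delta (rw nu) w); rewrite delta_neq ?mulr0.
    by rewrite /f act_delta_shape // (permPr pe).
  by apply: contraNneq npw => ->.
pose g := f - f (rw nu) *: delta (rw nu).
have gE v : g v = f v - f (rw nu) * delta (rw nu) v by [].
have fxg : fixed_by nu m g.
  move=> i im ri; have hX := semX_module m.
  rewrite /g -scaleN1r addrC (hm_lin hX) (hmXZ hX) (rw_fixed pn im ri) (@xnu_fixed nu m (delta u) i im ri).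
  rewrite scalerDr !scalerA; congr (_ *: _ + _); move: (f _) (q) => c Q; ring.
have g0 : g (rw nu) = 0 by rewrite gE deltaxx mulr1 subrr.
have /eqP : g w = 0.
  by apply/eqP/negPn/negP => /(fixed_rw pn fxg gw pw); rewrite g0 eqxx.
by rewrite gE subr_eq0 => /eqP.
Qed.

Lemma opT_rowstab m nu (w : 'S_m) : is_partition_of m nu -> rowstab nu w ->
  opT (semX m) (delta (rw nu)) w = q ^+ plen w *: delta (rw nu).
Proof.
move=> pn; have hX := semX_module m.
have [k] := ubnP (plen w); elim: k w => // k IH w hk st.
have [/eqP ->|/eqP w1] := boolP (w == 1%g); first by rewrite opT1 plen1 expr0 scale1r.
have [i [di ->]] := @opT_pick m _ (semX m) (delta (rw nu)) w w1.
have im := desc_range di; have ri := rowstab_desc st di.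
rewrite IH; [|exact: leq_trans di hk|by rewrite rowstab_sgen].
rewrite (hmXZ hX) (rw_fixed pn im ri) scalerA; congr (_ *: _).
case: (plenS w im) => [->|e]; first by rewrite exprS mulrC.
by move: di; rewrite e ltnNge leqnSn.
Qed.

(** The scalar is the Poincaré polynomial of the row stabilizer at [q]. Only the identity has length
    zero, so its constant term is 1 and it is nonzero. *)
Lemma act_xnu_rw m nu : is_partition_of m nu -> exists2 c : K, c != 0 &
  hact (semX m) (delta (rw nu)) (xnu nu m) = c *: delta (rw nu).
Proof.
move=> pn; pose P : {poly C} := \sum_(w : 'S_m | rowstab nu w) 'X^(plen w).
have st1 : rowstab nu (1%g : 'S_m) by apply/forallP=> k; rewrite perm1.
have P0 : P != 0.
  apply/eqP => e; have : P`_0 = 0 by rewrite e coef0.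
  rewrite /P coef_sum (bigD1 1%g) // plen1 expr0 coef1 big1 => [/eqP|w /andP[_ w1]].
    by rewrite /= addr0 oner_eq0.
  rewrite coefXn; case: eqP => // e'; case/eqP: w1; apply: nodesc1 => i.
  by rewrite -e'.
exists (polyK P); first by rewrite -(rmorph0 (@FracField.tofrac _)) (inj_eq polyK_inj).
rewrite /hact (bigID (fun w : 'S_m => rowstab nu w)) /= [X in _ + X]big1 ?addr0 => [|w nst]; last first.
  by rewrite xnuE (negbTE nst) scale0r.
rewrite {1}/P /polyK rmorph_sum scaler_suml; apply: eq_bigr => w st.
by rewrite xnuE st scale1r opT_rowstab // -polyKX.
Qed.

(** * Embeddings of Hecke algebras *)

Lemma perm_of_natE m (f : nat -> nat) : (forall k, (k < m)%N -> (f k < m)%N) ->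
  (forall j k, (j < m)%N -> (k < m)%N -> f j = f k -> j = k) ->
  forall k, (k < m)%N -> pnat (perm_of_nat m f) k = f k.
Proof.
move=> fm fi k km; rewrite (dpnatE _ km) /perm_of_nat.
set g := [ffun _ => _].
have gE (x : 'I_m) : g x = f x :> nat.
  by rewrite ffunE val_insubd fm.
have gi : injectiveb g.
  by apply/injectiveP => x y e; apply/val_inj/(fi _ _ (ltn_ord x) (ltn_ord y)); rewrite -!gE e.
have e : val (insubd (1%g : 'S_m) g) = g by rewrite val_insubd gi.
by rewrite -pvalE -[pval _]/(val _) e gE.
Qed.

Section Lift.
Variables (a b : nat).
Hypothesis ab : (a <= b)%N.

Lemma pnat_plift (w : 'S_a) k : (k < b)%N -> pnat (plift b w) k = pnat w k.
Proof.
apply: perm_of_natE => [j jb|j l jb lb].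
  have [ja|aj] := ltnP j a; first exact: leq_trans (pnat_lt w ja) ab.
  by rewrite /pnat insubF // ltnNge aj.
have out x : (a <= x)%N -> pnat w x = x by move=> ax; rewrite /pnat insubF // ltnNge ax.
have [ja|aj] := ltnP j a; have [la|al] := ltnP l a.
- by move=> e; rewrite -(pnatK w ja) e pnatK.
- by move=> e; move: (pnat_lt w ja); rewrite e out // ltnNge al.
- by move=> e; move: (pnat_lt w la); rewrite -e out // ltnNge aj.
- by rewrite !out.
Qed.

Lemma plift1 : plift b (1%g : 'S_a) = 1%g.
Proof.
apply/permP => x; apply: val_inj; rewrite perm1 -[LHS]pnat_ord pnat_plift //.
have [xa|ax] := ltnP x a; first by rewrite (dpnatE _ xa) perm1.
by rewrite /pnat insubF // ltnNge ax.
Qed.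

Lemma pliftM (w v : 'S_a) : plift b (w * v)%g = (plift b w * plift b v)%g.
Proof.
apply/permP => x; apply: val_inj; rewrite permM -[LHS]pnat_ord -[RHS]pnat_ord !pnat_plift //.
rewrite -[in RHS]pnat_ord pnat_plift //.
have [xa|ax] := ltnP x a; first by rewrite (dpnatE _ xa) (dpnatE w xa) permM pnat_ord.
by rewrite /pnat insubF ?insubF // ?ltnNge ax.
Qed.

Lemma plift_sgen i : (i.+1 < a)%N -> plift b (sgen a i) = sgen b i.
Proof.
move=> ia; have [x [y [hx hy ->]]] := sgen_ord ia.
have [x' [y' [hx' hy' ->]]] := sgen_ord (leq_trans ia ab).
apply/permP => z; apply: val_inj; rewrite -[LHS]pnat_ord pnat_plift //.
have zE (o : 'I_b) : (z == o) = (z == o :> nat) by [].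
have [za|az] := ltnP z a; last first.
  rewrite /pnat insubF ?ltnNge ?az // tpermD // eq_sym zE ?hx' ?hy'; lia.
rewrite (dpnatE _ za).
have oE (o : 'I_a) : (Ordinal za == o) = (z == o :> nat) by [].
case: tpermP => [/eqP|/eqP|/eqP + /eqP]; rewrite !oE ?hx ?hy.
- by move=> /eqP zi; rewrite (_ : z = x') ?tpermL ?hy' //; apply: val_inj; rewrite /= zi hx'.
- by move=> /eqP zi; rewrite (_ : z = y') ?tpermR ?hx' //; apply: val_inj; rewrite /= zi hy'.
- by move=> n1 n2; rewrite tpermD // eq_sym zE ?hx' ?hy'.
Qed.

Lemma plift_desc (w : 'S_a) i : (plen (w * sgen a i)%g < plen w)%N ->
  (plen (plift b w * sgen b i)%g < plen (plift b w))%N.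
Proof.
move=> di; have ia := desc_range di; have ib := leq_trans ia ab.
have [x [y [hx hy _]]] := sgen_ord ia; have [x' [y' [hx' hy' _]]] := sgen_ord ib.
have lV : (plift b w)^-1%g = plift b w^-1%g.
  by apply/eqP; rewrite eq_invg_mul -pliftM mulgV plift1.
move: di; rewrite (desc_nat _ hx hy) (desc_nat _ hx' hy') lV.
by rewrite -!pnat_ord !pnat_plift // hx hy hx' hy'.
Qed.

Variables (V : lmodType K) (X : nat -> V -> V).
Hypothesis hX : hecke_module b X.

Lemma hecke_module_le : hecke_module a X.
Proof.
split; first exact: hm_lin hX.
- by move=> i v ia; apply: (hm_quad hX); exact: leq_trans ab.
- by move=> i j v ij ja; apply: (hm_comm hX) => //; exact: leq_trans ab.
- by move=> i v ia; apply: (hm_braid hX); exact: leq_trans ab.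
Qed.

(** [plift] preserves generators and descents, so a factorisation along descents in the small group
    is also one in the large group. *)
Lemma opT_plift v (w : 'S_a) : opT X v (plift b w) = opT X v w.
Proof.
have [k] := ubnP (plen w); elim: k w => [|k IH] w hk; first by rewrite ltn0 in hk.
have [/eqP ->|/eqP w1] := boolP (w == 1%g); first by rewrite plift1 !opT1.
have [i [di ->]] := @opT_pick a _ X v w w1.
have ia := desc_range di.
rewrite (hm_opT_desc hX _ (plift_desc di)) -(plift_sgen ia) -pliftM IH //.
exact: leq_trans di hk.
Qed.

Lemma act_hincl v (h : hecke a) : hact X v (hincl b h) = hact X v h.
Proof.
rewrite /hincl act_hsum big_map big_enum /= /hact; under eq_bigl do rewrite inE.
by apply: eq_bigr => w _; rewrite -/(hact X v _) act_scale act_hT opT_plift.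
Qed.
End Lift.

(** * Restriction of the seminormal module *)

Section Restriction.
Variables (a b : nat) (suf : seq nat).
Hypothesis ab : (a <= b)%N.

Definition extend (f : seq nat -> K^o) : seq nat -> K^o :=
  fun w => if goodw b w && (drop a w == suf) then f (take a w) else 0.

Lemma extend_lin c f g : extend (c *: f + g) = c *: extend f + extend g.
Proof.
apply: boolp.funext => w.
change (extend (c *: f + g) w = c * extend f w + extend g w).
by rewrite /extend; case: ifP => // _; rewrite mulr0 addr0.
Qed.

Lemma extend0 : extend 0 = 0.
Proof. by apply: boolp.funext => w; rewrite /extend if_same. Qed.

Lemma extend_semX i f : (i.+1 < a)%N -> extend (semX a i f) = semX b i (extend f).
Proof.
move=> ia; have ib := leq_trans ia ab; apply: boolp.funext => w.
have [gw|bw] := boolP (goodw b w); last first.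
  by rewrite semX_bad // /extend (negbTE bw) /= mulr0.
rewrite (semX_good _ _ gw).
have gt : goodw a (take a w).
  by case/andP: gw => /eqP sw yw; rewrite /goodw yam_take // size_takel ?sw // eqxx.
have [p [x [y [s [ew sp yp yw]]]]] := good_split2 ib gw.
have sa : ((size p).+1 < a)%N by rewrite sp.
have [k ek] : exists k, (a - size p = k.+2)%N by exists (a - size p - 2)%N; lia.
have dropE z t : drop a (p ++ [:: z, t & s]) = drop (a - size p - 2)%N s.
  rewrite drop_cat ifF; last by lia.
  by rewrite ek /= !subSS subn0.
have takeE z t : take a (p ++ [:: z, t & s]) = p ++ [:: z, t & take (a - size p - 2)%N s].
  rewrite take_cat ifF; last by lia.
  by rewrite ek /= !subSS subn0.
rewrite [LHS]/extend gw /= semX_good // ew -sp semU_cat dropE takeE semU_cat.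
rewrite ew in gw yw gt; rewrite /extend gw !dropE !takeE /=.
case: eqP => ds; last by rewrite andbF !mulr0 addr0.
(* If the exchanged word is not standard, [extend] is zero there although the value of [f] at its
   prefix may not be; the coefficient in front of it vanishes by [semB_exit]. *)
rewrite andbT; congr (_ + _); case: ifP => // bs.
have nys : ~~ yam (p ++ [:: y, x & s]).
  by apply/negP => ys; move: bs; rewrite (good_sw gw ys).
by rewrite (semB_exit yw nys) !mul0r.
Qed.

Lemma extend_act f (h : hecke a) : extend (hact (semX a) f h) = hact (semX b) (extend f) h.
Proof.
have D f1 f2 : extend (f1 + f2) = extend f1 + extend f2.
  by have := extend_lin 1 f1 f2; rewrite !scale1r.
rewrite /hact (big_morph extend D extend0); apply: eq_bigr => w _.
have -> : h w *: opT (semX a) f w = h w *: opT (semX a) f w + 0 by rewrite addr0.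
rewrite extend_lin extend0 addr0; congr (_ *: _); rewrite /opT.
have := @rword_range a w; elim: (rword w) f => //= i s IH f rng.
rewrite IH => [|j js]; last by apply: rng; rewrite inE js orbT.
by rewrite extend_semX // rng ?mem_head.
Qed.

Lemma extend_delta u : size u = a -> goodw b (u ++ suf) -> extend (delta u) = delta (u ++ suf).
Proof.
move=> su gu; apply: boolp.funext => w; rewrite /extend /delta.
have [->|nw] := eqVneq w (u ++ suf); first by rewrite gu drop_size_cat // take_size_cat // !eqxx.
case: ifP => // /andP[_ /eqP dw]; case: eqP => // tw.
by case/eqP: nw; rewrite -tw -dw cat_take_drop.
Qed.

(** Whether [suf] can follow a word only depends on the shape of that word. As the action stays
    inside the class of [u], no value is lost by [extend]. *)
Lemma act_delta_cat u (h : hecke a) : goodw a u -> goodw b (u ++ suf) ->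
  hact (semX b) (delta (u ++ suf)) h = 0 <-> hact (semX a) (delta u) h = 0.
Proof.
move=> gu gus; have su : size u = a by case/andP: gu => /eqP.
rewrite -(extend_delta su gus) -(extend_act (delta u) h).
split=> [e|e]; last by apply: etrans (congr1 extend e) extend0.
apply: (@goodf_eq a) => [|//|w gw]; first exact/act_goodf/goodf_delta.
have [pe|npe] := boolP (perm_eq w u); last by rewrite act_delta_shape.
have sw : size w = a by case/andP: gw => /eqP.
have gws : goodw b (w ++ suf).
  move: gus; rewrite /goodw !size_cat su sw !yam_cat => /and3P[-> _ ys] /=.
  by case/andP: gw => _ ->; rewrite (yam_from_perm _ pe).
have := congr1 (fun g : seq nat -> K^o => g (w ++ suf)) e.
by rewrite /extend gws drop_size_cat // take_size_cat // eqxx.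
Qed.
End Restriction.

(** * The annihilator of the Specht generator *)

Lemma act0r m (V : lmodType K) (X : nat -> V -> V) v : hact X v (0 : regV m) = 0.
Proof. by rewrite /hact big1 // => w _; rewrite ffunE scale0r. Qed.

Opaque xnu hT hmul hact hsum wproj hprod JM.

Section Ideal.
Variables (m : nat) (nu : seq nat).
Implicit Types h g : regV m.

Lemma inNbar0 : inNbar nu (0 : regV m).
Proof. by exists [::]; split=> //; rewrite hsumE big_nil. Qed.

Lemma inNbarD h g : inNbar nu h -> inNbar nu g -> inNbar nu (h + g).
Proof.
move=> [l [hl ->]] [l' [hl' ->]]; exists (l ++ l'); split=> [z|].
  by rewrite mem_cat => /orP[/hl|/hl'].
by rewrite !hsumE map_cat big_cat.
Qed.

Lemma inNbarZ c h : inNbar nu h -> inNbar nu (c *: h).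
Proof.
move=> [l [hl ->]]; exists [seq (c * z.1.1.1, z.1.1.2, z.1.2, z.2) | z <- l]; split=> [z|].
  by case/mapP=> z' /hl h' ->.
rewrite !hsumE !big_map scaler_sumr; apply: eq_bigr => z _ /=.
by rewrite !hscaleE scalerA.
Qed.

Lemma inNbar_sum (I : Type) (r : seq I) (P : pred I) (F : I -> regV m) :
  (forall i, P i -> inNbar nu (F i)) -> inNbar nu (\sum_(i <- r | P i) F i).
Proof. by move=> hF; elim/big_rec: _ => [|i x /hF h1 h2]; [exact: inNbar0|exact: inNbarD]. Qed.

Lemma hmul_suml (I : Type) (r : seq I) (P : pred I) (F : I -> regV m) g :
  hmul (\sum_(i <- r | P i) F i : regV m) g = \sum_(i <- r | P i) (hmul (F i) g : regV m).
Proof.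
rewrite hmul_act (act_suml (regX_module m)).
by apply: eq_bigr => i _; rewrite -hmul_act.
Qed.

Lemma hmulZl c h g : hmul (c *: h) g = c *: (hmul h g : regV m).
Proof. by rewrite !hmul_act (actZl (regX_module m)). Qed.

Lemma hmul_basis h g : hmul h g = \sum_w g w *: (hmul h (hT w) : regV m).
Proof. by rewrite hmul_act; apply: eq_bigr => w _; rewrite hmul_act act_hT. Qed.

Lemma inNbar_mul rho (g1 g2 : hecke m) : is_partition_of m rho && sdominates rho nu ->
  inNbar nu (hmul (hmul g1 (xnu rho m)) g2).
Proof.
move=> hr; rewrite [g1]hT_basis hmul_suml.
rewrite hmul_suml; apply: inNbar_sum => z _; rewrite !hmulZl; apply: inNbarZ.
rewrite hmul_basis; apply: inNbar_sum => z' _; apply: inNbarZ.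
(* The inverse compensates the one in [xuv], whose left factor is [hT du^-1]. *)
exists [:: (1, rho, (z^-1)%g, z')]; split=> [y|]; first by rewrite inE => /eqP ->.
by rewrite hsumE big_seq1 hscaleE scale1r /xuv /= invgK.
Qed.

Lemma inNbar_hmulr h (g : hecke m) : inNbar nu h -> inNbar nu (hmul h g).
Proof.
move=> [l [hl ->]]; rewrite hsumE big_map hmul_suml big_seq; apply: inNbar_sum => z zl.
rewrite hscaleE hmulZl; apply: inNbarZ; rewrite /xuv hmulA; apply: inNbar_mul; exact: hl.
Qed.

End Ideal.

Lemma is_shape_perm_eq lam u v : is_shape lam u -> is_shape lam v -> perm_eq u v.
Proof. by move=> [_ e1] [_ e2]; apply/allP => j _ /=; rewrite -e1 -e2. Qed.

Lemma delta_shape u w : ~~ perm_eq w u -> delta u w = 0.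
Proof. by move=> nw; rewrite delta_neq //; apply: contraNneq nw => ->. Qed.

Section Key.
Variables (m : nat) (nu : seq nat).
Hypothesis pn : is_partition_of m nu.
Let hX := semX_module m.

Lemma act_scalel (c : K) f (h : hecke m) : hact (semX m) (c *: f) h = c *: hact (semX m) f h.
Proof. exact: actZl hX h c f. Qed.

Lemma xrho_shape0 rho lam f u : is_partition_of m rho -> goodf m f ->
  (forall w, ~~ perm_eq w u -> f w = 0) -> goodw m u -> is_shape lam u ->
  hact (semX m) f (xnu rho m) <> 0 -> forall k, (sumn (take k rho) <= sumn (take k lam))%N.
Proof.
move=> pr gf fu gu sh nz.
have sz : sumn rho = m by case/and3P: pr => _ _ /eqP.
have gx := @act_goodf m f (xnu rho m) gf; have sx := @act_shape m f u (xnu rho m) fu.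
have [[w [gw fw]]|none] := boolp.EM (exists w, goodw m w /\ hact (semX m) f (xnu rho m) w != 0).
  apply: (fixed_dominance sz (@xnu_fixed rho m f) gw _ fw).
  apply: is_shape_perm sh _; rewrite perm_sym; apply/negPn/negP => /sx e.
  by rewrite e eqxx in fw.
case: nz; apply: (@goodf_eq m) => // w gw.
by apply/eqP/negPn/negP => fw; apply: none; exists w.
Qed.

(** A nonzero image of [xnu rho] on the block of [nu] would make [nu] dominate [rho], against strict
    dominance of [rho] over [nu]. *)
Lemma Nbar_act0 (h : hecke m) : inNbar nu h -> hact (semX m) (delta (rw nu)) h = 0.
Proof.
have gr := rw_good pn; case=> l [hl ->]; rewrite act_hsum big_map big_seq big1 // => z zl.
have /andP[pr /andP[dom ne]] := hl z zl.
rewrite act_scale /xuv !(act_hmul hX); set f := hact _ (delta _) _.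
suff e : hact (semX m) f (xnu z.1.1.2 m) = 0.
  apply: etrans (congr1 (fun g => z.1.1.1 *: hact (semX m) g (hT z.2)) e) _.
  by rewrite (act0l hX) scaler0.
have [//|nz] := boolp.EM (hact (semX m) f (xnu z.1.1.2 m) = 0).
have le := xrho_shape0 pr (act_goodf _ (goodf_delta gr)) (@act_delta_shape m (rw nu) _) gr
  (rw_shape pn) nz.
by rewrite (dominance_antisym pr pn le dom) eqxx in ne.
Qed.

Lemma faithful_eq (h g : hecke m) :
  (forall u, goodw m u -> hact (semX m) (delta u) h = hact (semX m) (delta u) g) -> h = g.
Proof.
move=> e; have : (hsub h g : regV m) = 0.
  by apply: hecke_faithful => u gu; rewrite act_sub e // subrr.
by rewrite hsubE => /eqP; rewrite subr_eq0 => /eqP.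
Qed.

Lemma wproj_decomp (a : hecke m) : a = hsum [seq hmul a (wproj m u) | u <- words m m].
Proof.
apply: faithful_eq => u gu; rewrite act_hsum big_map.
set f := hact _ _ a; have gf : goodf m f by exact/act_goodf/goodf_delta.
rewrite big_seq (eq_bigr (fun v => f v *: delta v)) => [|v]; last first.
  by rewrite mem_words // (act_hmul hX) => gv; exact: act_wproj.
rewrite -big_seq; apply: boolp.funext => w; rewrite sum_fctE.
have scE v : (f v *: delta v) w = f v * delta v w by [].
have [gw|bw] := boolP (goodw m w); last first.
  rewrite gf // big_seq big1 // => v; rewrite mem_words // => gv.
  by rewrite scE delta_neq ?mulr0 //; apply: contraNneq bw => ->.
rewrite (bigD1_seq w) ?mem_words ?words_uniq //= big1 => [|v vw].
  by rewrite addr0 scE deltaxx mulr1.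
by rewrite scE delta_neq ?mulr0 // eq_sym.
Qed.

(** The projector factors through [xnu lam]: a matrix unit moves [u] to [rw lam], where [xnu lam]
    acts by [c], and another moves back. This exhibits it as an element of the ideal. *)
Lemma wproj_Nbar lam u (a : hecke m) : goodw m u -> is_shape lam u ->
  sdominates lam nu -> inNbar nu (hmul a (wproj m u)).
Proof.
move=> gu sh dom; have pl : is_partition_of m lam.
  by have /andP[/eqP <- yu] := gu; exact: is_shape_partition.
have gr := rw_good pl; have pe := is_shape_perm_eq sh (rw_shape pl).
have [g1 m1] := munit_exists gu gr pe.
have [|g2 m2] := munit_exists gr gu _; first by rewrite perm_sym.
have [c c0 ec] := act_xnu_rw pl.
have -> : hmul a (wproj m u) = hscale c^-1 (hmul (hmul (hmul a g1) (xnu lam m)) g2).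
  apply: faithful_eq => v gv; rewrite act_scale !(act_hmul hX).
  set f := hact _ _ a; have gf : goodf m f by exact/act_goodf/goodf_delta.
  clearbody f; have e3 : hact (semX m) (hact (semX m) f g1) (xnu lam m) = f u *: (c *: delta (rw lam)).
    by rewrite (m1 f gf) act_scalel ec.
  have e4 := m2 _ (goodfZ (f u) (goodfZ c (goodf_delta gr))).
  rewrite (act_wproj gu gf); apply: etrans (congr1 (fun g => c^-1 *: hact (semX m) g g2) (esym e3)).
  rewrite e4; transitivity ((c^-1 * (f u * (c * delta (rw lam) (rw lam)))) *: delta u).
    by rewrite deltaxx mulr1 mulrCA mulVf ?mulr1.
  by rewrite -scalerA.
by rewrite hscaleE; apply: inNbarZ; apply: inNbar_mul; rewrite pl.
Qed.

(* [Nbar nu] is the sum of the blocks of shape strictly dominating [nu], and [x_nu h] lives in the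
   blocks of shape dominating [nu], so only its component of shape [nu] matters. *)
Lemma Specht_annihilator (h : hecke m) :
  inNbar nu (hmul (xnu nu m) h) <-> hact (semX m) (delta (rw nu)) h = 0.
Proof.
split=> [/Nbar_act0|h0].
  have [c c0 ec] := act_xnu_rw pn; rewrite (act_hmul hX) ec act_scalel => /eqP.
  by rewrite scaler_eq0 (negbTE c0) => /eqP.
rewrite (wproj_decomp (hmul _ h)) hsumE big_map big_seq; apply: inNbar_sum => u.
rewrite mem_words // => gu; have /andP[/eqP su yu] := gu.
have [lam sh] := shape_exists yu; have pl := is_shape_partition yu sh; rewrite su in pl.
have [dom|ndom] := boolP (sdominates lam nu); first exact: wproj_Nbar sh dom.
suff -> : hmul (hmul (xnu nu m) h) (wproj m u) = (0 : regV m) by exact: inNbar0.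
apply: faithful_eq => v gv; rewrite !(act_hmul hX) act0r.
pose f := hact (semX m) (hact (semX m) (delta v) (xnu nu m)) h.
have gf : goodf m f := act_goodf h (act_goodf (xnu nu m) (goodf_delta gv)).
suff fu : f u = 0 by apply: etrans (act_wproj gu gf) _; rewrite fu scale0r.
have [pe|npe] := boolP (perm_eq v u); last first.
  rewrite perm_sym in npe.
  exact: (act_shape h (act_shape (xnu nu m) (f := delta v) (delta_shape (u := v))) npe).
have shv : is_shape lam v by apply: is_shape_perm sh _; rewrite perm_sym.
have [e|nz] := boolp.EM (hact (semX m) (delta v) (xnu nu m) = 0).
  by rewrite /f e (act0l hX).
have dl k : (sumn (take k nu) <= sumn (take k lam))%N.
  exact: (xrho_shape0 pn (goodf_delta gv) (delta_shape (u := v)) gv shv nz).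
have el : lam = nu.
  by apply/eqP/negPn/negP => ne; case/negP: ndom; rewrite /sdominates ne andbT; apply/forallP.
have [|c ec] := act_xnu_shape pn gv (u := v).
  by apply: is_shape_perm_eq shv _; rewrite el; exact: rw_shape pn.
by rewrite /f ec act_scalel h0 scaler0.
Qed.
End Key.

(** * The leading seminormal coefficient *)

Lemma winv_sw_le i w : (winv w <= (winv (sw i w)).+1)%N.
Proof.
have [h|h] := ltnP i.+1 (size w); last by rewrite /sw ltnNge h.
have [p [a [b [s [-> <-]]]]] := split2 h; rewrite sw_cat.
case: (ltngtP a b) => [ab|ba|-> //]; last by rewrite (winv_sw _ _ ba).
by rewrite (winv_sw _ _ ab); lia.
Qed.

(** A generator mixes the value at a word only with that at its exchange, whose inversion number
    differs by at most one. This is the triangularity behind [opT_leading]. *)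
Lemma opT_winv m f (d : 'S_m) k : (forall w, f w != 0 -> (winv w <= k)%N) ->
  forall w, opT (semX m) f d w != 0 -> (winv w <= k + plen d)%N.
Proof.
move=> fk; have [n] := ubnP (plen d); elim: n d => [|n IH] d hd w.
  by rewrite ltn0 in hd.
have [/eqP ->|/eqP d1] := boolP (d == 1%g); first by rewrite opT1 plen1 addn0; exact: fk.
have [i [di ->]] := @opT_pick m _ (semX m) f d d1.
have le v : opT (semX m) f (d * sgen m i)%g v != 0 -> (winv v < k + plen d)%N.
  by move=> /(IH _ (leq_trans di hd)); move/leq_ltn_trans; apply; rewrite ltn_add2l.
move: (opT _ _ _) le => g le.
have [g1|/le h _] := eqVneq (g w) 0; last exact: ltnW.
have [g2|/le h _] := eqVneq (g (sw i w)) 0; last exact: leq_trans (winv_sw_le i w) h.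
by rewrite /semX /semU g1 g2 !mulr0 addr0 if_same eqxx.
Qed.

Lemma nth_sw i u k : (i.+1 < size u)%N ->
  nth 0%N (sw i u) k = nth 0%N u (if k == i then i.+1 else if k == i.+1 then i else k).
Proof.
move=> h; have [p [a [b [s [-> <-]]]]] := split2 h; rewrite sw_cat.
have lt : ((size p).+1 < size p)%N = false by rewrite ltnNge leqnSn.
case: (eqVneq k (size p)) => [->|k1]; first by rewrite !nth_cat ltnn subnn lt subSnn.
case: (eqVneq k (size p).+1) => [->|k2]; first by rewrite !nth_cat ltnn subnn lt subSnn.
rewrite !nth_cat; case: ltnP => // pk.
by case e : (k - size p)%N => [|[|l]] //; exfalso; lia.
Qed.

Lemma wd_sw nu m (d : 'S_m) i : (i.+1 < m)%N -> wd nu (d * sgen m i)%g = sw i (wd nu d).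
Proof.
move=> im; apply: (@eq_from_nth _ 0%N); first by rewrite size_sw !size_wd.
rewrite size_wd => k km; rewrite nth_sw ?size_wd // nth_wd //.
have [a [b [ha hb ->]]] := sgen_ord im.
rewrite nth_wd; last by case: ifP => // _; case: ifP => // _; exact: ltnW.
congr rowof; rewrite (dpnatE _ km) invMg permM tpermV.
have kE (o : 'I_m) : (Ordinal km == o) = (k == o) by [].
case: tpermP => [/eqP|/eqP|/eqP + /eqP]; rewrite kE ?ha ?hb.
- by move=> ->; rewrite -hb pnat_ord.
- by move=> /eqP ->; rewrite eqn_leq ltnn eqxx -ha pnat_ord.
- by rewrite !kE ?ha ?hb => /negbTE -> /negbTE ->; rewrite (dpnatE _ km).
Qed.

Lemma rowinc_desc nu m (d : 'S_m) i : rowinc nu d -> sumn nu = m ->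
  (plen (d * sgen m i)%g < plen d)%N -> rowinc nu (d * sgen m i)%g.
Proof.
move=> inc sz di j c c' cc' c'j; have im := desc_range di.
have [_ _ p1] := posofK (ltn_trans cc' c'j); have [_ _ p2] := posofK c'j.
rewrite sz in p1 p2; have := inc _ _ _ cc' c'j.
have [a [b [ha hb s]]] := sgen_ord im; rewrite (desc_nat _ ha hb) in di.
rewrite !(dpnatE _ p1) !(dpnatE _ p2) s !permM => lt; apply: tperm_lt => //; first by rewrite hb ha.
move=> e1 e2; move: di; rewrite -e1 -e2 !permK /= ltnNge /posof leq_add2l.
by rewrite (ltnW cc').
Qed.

Lemma wd_desc nu m (d : 'S_m) i : rowinc nu d -> sumn nu = m ->
  (plen (d * sgen m i)%g < plen d)%N ->
  (nth 0%N (wd nu d) i.+1 < nth 0%N (wd nu d) i)%N.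
Proof.
move=> inc sz di; have im := desc_range di; rewrite !nth_wd ?(ltnW im) //.
have [a [b [ha hb s]]] := sgen_ord im; rewrite (desc_nat _ ha hb) in di.
rewrite -hb -ha !pnat_ord ltn_neqAle (rowof_mono nu (ltnW di)) andbT; apply/eqP => e.
have ltx (o : 'I_m) : (o < sumn nu)%N by rewrite sz.
have [e1 l1] := rowcolK (ltx ((d^-1)%g b)); have [e2 l2] := rowcolK (ltx ((d^-1)%g a)).
have cc : (colof nu ((d^-1)%g b) < colof nu ((d^-1)%g a))%N.
  by move: di; rewrite -[X in (X < _)%N]e1 -[X in (_ < X)%N]e2 /posof e ltn_add2l.
have := inc _ _ _ cc l2; rewrite -[in X in (X < _)%N]e e1 e2 !pnat_ord !permKV ha hb.
by rewrite ltnNge leqnSn.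
Qed.

Lemma winv_rw nu : winv (rw nu) = 0%N.
Proof.
have : sorted leq (rw nu).
  apply/(sortedP 0%N) => i; rewrite size_mkseq => im.
  by rewrite !nth_mkseq ?(ltnW im) // rowof_mono.
elim: (rw nu) => //= a s IH ps; rewrite IH ?(path_sorted ps) // addn0.
have /allP le := order_path_min leq_trans ps.
by apply/eqP; rewrite -leqn0 leqNgt -has_count; apply/hasPn => b /le; rewrite -leqNgt.
Qed.

(** Peel a descent [i] of [d]: the word of [d * sgen m i] has one inversion less. The diagonal term
    vanishes since by [opT_winv] the shorter element cannot reach [wd nu d], and the exchange has
    coefficient 1 by the choice in [semB]. *)
Lemma opT_leading m nu (d : 'S_m) : is_partition_of m nu -> rowinc nu d -> yam (wd nu d) ->
  opT (semX m) (delta (rw nu)) d (wd nu d) != 0 /\ winv (wd nu d) = plen d.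
Proof.
move=> pn; have sz : sumn nu = m by case/and3P: pn => _ _ /eqP.
have hX := semX_module m.
have [k] := ubnP (plen d); elim: k d => [|k IH] d hk inc yd; first by rewrite ltn0 in hk.
have [/eqP ->|/eqP d1] := boolP (d == 1%g).
  by rewrite opT1 wd1 // deltaxx oner_neq0 winv_rw plen1.
have [i [di _]] := @opT_pick m _ (semX m) (delta (rw nu)) d d1.
have im := desc_range di; have lt := wd_desc inc sz di.
have gd : goodw m (wd nu d) by rewrite /goodw size_wd eqxx.
have [p [a [b [s [ew sp yp _]]]]] := good_split2 im gd.
have e' : wd nu (d * sgen m i)%g = p ++ [:: b, a & s] by rewrite wd_sw // ew -sp sw_cat.
have ltp : ((size p).+1 < size p)%N = false by rewrite ltnNge leqnSn.
have ba : (b < a)%N by move: lt; rewrite ew -sp !nth_cat ltnn subnn ltp subSnn.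
have yd' : yam (wd nu (d * sgen m i)%g).
  by rewrite e'; apply: yam_sw_gt (ltnW ba) _; rewrite -ew.
have [nz we] := IH _ (leq_trans di hk) (rowinc_desc inc sz di) yd'.
have ws : winv (wd nu d) = (plen (d * sgen m i)%g).+1 by rewrite ew (winv_sw _ _ ba) -e' we.
have pl : plen d = (plen (d * sgen m i)%g).+1.
  by case: (plenS d im) => // e; move: di; rewrite e ltnNge leqnSn.
split; last by rewrite ws pl.
rewrite (hm_opT_desc hX _ di) (semX_good _ _ gd).
have f0 : opT (semX m) (delta (rw nu)) (d * sgen m i)%g (wd nu d) = 0.
  apply/eqP/negPn/negP => /(@opT_winv m _ _ 0%N); rewrite ws add0n ltnn => /(_ _)/negP; apply=> //.
  move=> w; have [-> _|nw] := eqVneq w (rw nu); first by rewrite winv_rw.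
  by rewrite delta_neq ?eqxx.
rewrite e' in nz; move: (opT _ _ _) nz f0 => g nz f0.
rewrite ew -sp semU_cat; rewrite ew in f0; rewrite f0 mulr0 add0r.
by rewrite /semB leqNgt ba mul1r.
Qed.

(** * The tableau t^<= *)

Local Open Scope nat_scope.

(** The count runs over the nodes of the subshape with row lengths [g] preceding the node [(j, c)]
    of [mu], so it is the reading position of that node inside the subshape. *)
Lemma count_subshape mu (g : nat -> nat) j c : (forall i, g i <= nth 0 mu i) -> c <= g j ->
  count (fun k => colof mu k < g (rowof mu k)) (iota 0 (posof mu j c)) = \sum_(i < j) g i + c.
Proof.
elim: mu g j => [|a mu IH] g j le cj.
  have g0 i : g i = 0 by have := le i; rewrite nth_nil leqn0 => /eqP.
  have c0 : c = 0 by move: cj; rewrite g0 leqn0 => /eqP.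
  by rewrite c0 /posof /= big1.
have le0 : g 0 <= a := le 0.
have firstrow t : t <= a -> count (fun k => colof (a :: mu) k < g (rowof (a :: mu) k)) (iota 0 t)
    = count (fun k => k < g 0) (iota 0 t).
  move=> ta; apply: eq_in_count => k; rewrite mem_iota => /= kt.
  by rewrite (leq_trans kt ta).
have initial t : count (fun k => k < g 0) (iota 0 t) = minn t (g 0).
  elim: t => [|t IHt]; first by rewrite min0n.
  by rewrite -[t.+1]addn1 iotaD count_cat IHt /= addn0; lia.
case: j cj => [|j] cj.
  by rewrite posof0 big_ord0 firstrow ?initial ?(leq_trans cj) //; lia.
rewrite posof_cons iotaD count_cat firstrow // initial (minn_idPr le0) big_ord_recl -addnA.
congr (_ + _); rewrite add0n -(IH (fun i => g i.+1) j (fun i => le i.+1) cj).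
rewrite (_ : iota a _ = map (addn a) (iota 0 (posof mu j c))); last by rewrite -iotaDl addn0.
rewrite count_map; apply: eq_count => k /=.
by rewrite (ltnNge (a + k)) leq_addr addKn.
Qed.

Section Truncation.
Variables (n : nat) (lam : seq nat) (dt : 'S_n).
Hypotheses (pl : is_partition_of n lam) (st : standard lam dt).
Let W := wd lam dt.

Let sz : sumn lam = n. Proof. by case/and3P: pl => _ _ /eqP. Qed.
Let inc : rowinc lam dt. Proof. exact: standard_rowinc. Qed.

Lemma W_yam : yam W. Proof. exact: standard_yam. Qed.

Lemma shape_le_shape t : t <= n -> is_shape (shape_le lam dt t) (take t W).
Proof.
move=> tn; rewrite /shape_le.
have -> : [seq count (fun c => tentry lam dt r c < t) (iota 0 (nth 0 lam r)) | r <- iota 0 (size lam)]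
    = mkseq (fun j => count_mem j (take t W)) (size lam).
  by apply/eq_in_map => r _; rewrite wd_count.
apply: filter_shape => [|j js]; first exact/yam_take/W_yam.
by rewrite wd_count // nth_default.
Qed.

Lemma size_takeW t : t <= n -> size (take t W) = t.
Proof. by move=> tn; rewrite size_takel // size_wd. Qed.

Lemma shape_le_partition t : t <= n -> is_partition_of t (shape_le lam dt t).
Proof.
move=> tn; rewrite -{1}(size_takeW tn); apply: is_shape_partition; last exact: shape_le_shape.
exact/yam_take/W_yam.
Qed.

Variables (r s : nat).
Hypotheses (rs : r <= s) (sn : s <= n).
Let mu := shape_le lam dt s.
Let nu := shape_le lam dt r.
Let rn : r <= n. Proof. exact: leq_trans rs sn. Qed.

(* The word of [t^<=]. *)
Definition tword := rw nu ++ drop r (take s W).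

Lemma rw_take_perm : perm_eq (rw nu) (take r W).
Proof.
by apply: is_shape_perm_eq (rw_shape (shape_le_partition rn)) _; exact: shape_le_shape.
Qed.

Lemma takeWW : take r (take s W) = take r W.
Proof. by rewrite take_takel. Qed.

Lemma tword_perm : perm_eq tword (take s W).
Proof. by rewrite -(cat_take_drop r (take s W)) /tword takeWW perm_cat2r rw_take_perm. Qed.

Lemma size_rwnu : size (rw nu) = r.
Proof. by rewrite (perm_size rw_take_perm) size_takeW. Qed.

Lemma size_tword : size tword = s.
Proof. by rewrite (perm_size tword_perm) size_takeW. Qed.

Lemma tword_yam : yam tword.
Proof.
rewrite /tword yam_cat (rw_yam (shape_le_partition rn)) /=.
rewrite (yam_from_perm _ rw_take_perm) -takeWW.
by have := yam_take s W_yam; rewrite -{1}(cat_take_drop r (take s W)) yam_cat => /andP[].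
Qed.

Lemma tword_good : goodw s tword.
Proof. by rewrite /goodw size_tword eqxx tword_yam. Qed.

Lemma tword_shape : is_shape mu tword.
Proof. by apply: is_shape_perm (shape_le_shape sn) _; rewrite perm_sym tword_perm. Qed.

Lemma mu_le_lam j : nth 0 mu j <= nth 0 lam j.
Proof.
have [_ ->] := shape_le_shape sn.
rewrite -(wd_count_all dt sz) -/W -[X in _ <= count_mem _ X](cat_take_drop s W) count_cat.
exact: leq_addr.
Qed.

Lemma nu_le_mu j : nth 0 nu j <= nth 0 mu j.
Proof.
have [_ ->] := shape_le_shape sn; have [_ ->] := shape_le_shape rn.
rewrite -takeWW -[X in _ <= count_mem _ X](cat_take_drop r (take s W)) count_cat.
exact: leq_addr.
Qed.

Let ent k := tentry lam dt (rowof mu k) (colof mu k).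
Let fn k := if r <= ent k then ent k else count (fun k' => ent k' < r) (iota 0 k).
(** [gpos k] is the position in [mu] of the node added by letter [k] of [tword]. It turns out to be
    inverse to the filling [fn] of $t^{\le}$, which yields the bijectivity that [perm_of_nat]
    requires. Here [r] counts the refilled entries, whence [r.+1] in [tle]. *)
Let occ k := count_mem (nth 0 tword k) (take k tword).
Let gpos k := posof mu (nth 0 tword k) (occ k).

Lemma occ_lt k : k < s -> occ k < nth 0 mu (nth 0 tword k).
Proof.
move=> ks; rewrite tword_shape.2 -[X in _ < count_mem _ X](cat_take_drop k tword) count_cat.
rewrite -addn1 leq_add2l (drop_nth 0) ?size_tword //= eqxx.
by [].
Qed.

Lemma ent_lt j c t : t <= n -> c < nth 0 mu j ->
  (tentry lam dt j c < t) = (c < count_mem j (take t W)).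
Proof. by move=> tn cj; apply: wd_entry => //; exact: leq_trans (mu_le_lam j). Qed.

(** For [k >= r] the prefixes of [tword] and [W] are rearrangements of each other and the next
    letters agree, so the node is the one where $t$ has that entry. For [k < r] it is the node of
    reading position [k] in [nu], and [count_subshape] returns [k]. *)
Lemma fn_gpos k : k < s -> fn (gpos k) = k.
Proof.
move=> ks; have ok := occ_lt ks; have [r1 c1 p1] := posofK ok.
have ss : sumn mu = s by case/and3P: (shape_le_partition sn) => _ _ /eqP.
rewrite /fn /ent r1 c1; have [rk|kr] := leqP r k.
  have kn := leq_trans ks sn.
  have nthE : nth 0 tword k = nth 0 W k.
    rewrite /tword nth_cat size_rwnu ltnNge rk /= nth_drop subnKC // nth_take //.
  have pe : perm_eq (take k tword) (take k W).
    rewrite /tword take_cat size_rwnu ltnNge rk /=.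
    rewrite -[X in perm_eq _ X](cat_take_drop r (take k W)) take_takel // perm_cat ?rw_take_perm //.
    by rewrite take_drop subnK // take_takel // ltnW.
  have e : tentry lam dt (nth 0 tword k) (occ k) = k.
    by rewrite /occ (seq.permP pe) nthE; exact: wd_entryK.
  by rewrite e rk.
have pnu := shape_le_partition rn; have sn' : sumn nu = r by case/and3P: pnu => _ _ /eqP.
have nthE : nth 0 tword k = rowof nu k.
  by rewrite /tword nth_cat size_rwnu kr nth_mkseq // sn'.
have [kE kc] := @rowcolK nu k ltac:(by rewrite sn').
have occE : occ k = colof nu k.
  rewrite /occ /tword takel_cat ?size_rwnu ?(ltnW kr) // nth_cat size_rwnu kr -(wd1 sn').
  rewrite wd_colof // ?invg1 ?(dpnatE _ kr) ?perm1 //.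
  by apply: standard_rowinc => //; exact: standard1.
have lt : tentry lam dt (nth 0 tword k) (occ k) < r.
  by rewrite (ent_lt rn ok) occE nthE -(shape_le_shape rn).2.
rewrite leqNgt lt /=.
transitivity (count (fun k' => colof mu k' < nth 0 nu (rowof mu k')) (iota 0 (gpos k))).
  apply: eq_in_count => k'; rewrite mem_iota add0n => /= k'g.
  have k's : k' < sumn mu by exact: ltn_trans p1.
  by rewrite ent_lt ?(shape_le_shape rn).2 //; case: (rowcolK k's).
rewrite /gpos count_subshape; last by rewrite occE nthE ltnW.
  by rewrite -sumn_take_nth nthE occE.
exact: nu_le_mu.
Qed.

Lemma gpos_lt k : k < s -> gpos k < s.
Proof.
move=> ks; have [_ _] := posofK (occ_lt ks).
by case/and3P: (shape_le_partition sn) => _ _ /eqP ->.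
Qed.

Lemma fn_surj x : x < s -> exists2 k, k < s & gpos k = x.
Proof.
move=> xs; pose G (k : 'I_s) := Ordinal (gpos_lt (ltn_ord k)).
have Gi : injective G.
  move=> k l /(congr1 val) /= e; apply: val_inj.
  by apply: etrans (esym (fn_gpos (ltn_ord k))) _; rewrite e fn_gpos.
have [H _ HK] := injF_bij Gi; exists (val (H (Ordinal xs))); first exact: ltn_ord.
exact: (congr1 val (HK (Ordinal xs))).
Qed.

Lemma tle_fn x : x < s -> pnat (tle lam dt r.+1 s) x = fn x.
Proof.
apply: (@perm_of_natE s fn) => [k /fn_surj[l ls <-]|j k /fn_surj[l ls <-] /fn_surj[l' ls' <-]].
  by rewrite fn_gpos.
by rewrite !fn_gpos // => ->.
Qed.

Lemma tle_inv k : k < s -> pnat (tle lam dt r.+1 s)^-1%g k = gpos k.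
Proof.
move=> ks; have := tle_fn (gpos_lt ks); rewrite fn_gpos // => e.
by rewrite -{1}e pnatK // gpos_lt.
Qed.

Lemma wd_tle : wd mu (tle lam dt r.+1 s) = tword.
Proof.
apply: (@eq_from_nth _ 0); first by rewrite size_wd size_tword.
rewrite size_wd => k ks; rewrite nth_wd // tle_inv //.
by have [-> _ _] := posofK (occ_lt ks).
Qed.

Lemma tle_rowinc : rowinc mu (tle lam dt r.+1 s).
Proof.
move=> j c c' cc' c'j; have ss : sumn mu = s by case/and3P: (shape_le_partition sn) => _ _ /eqP.
have [r1 c1 p1] := posofK (ltn_trans cc' c'j); have [r2 c2 p2] := posofK c'j.
rewrite ss in p1 p2; rewrite !tle_fn //.
have [k ks gk] := fn_surj p1; have [l ls gl] := fn_surj p2.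
rewrite -gk -gl !fn_gpos // ltnNge; apply/negP => lk.
have [rk ck _] := posofK (occ_lt ks); have [rl cl _] := posofK (occ_lt ls).
have ek : nth 0 tword k = j by rewrite -rk -/(gpos k) gk r1.
have el : nth 0 tword l = j by rewrite -rl -/(gpos l) gl r2.
have ok : occ k = c by rewrite -ck -/(gpos k) gk c1.
have ol : occ l = c' by rewrite -cl -/(gpos l) gl c2.
move: cc'; rewrite -ok -ol /occ ek el ltnNge.
by rewrite -[X in _ <= count_mem _ X](cat_take_drop l (take k tword)) count_cat take_takel // leq_addr.
Qed.
End Truncation.

(** * The annihilator of the seminormal generator *)

Local Open Scope ring_scope.

Opaque Ev hincl.

Section SpechtCongruence.
Variables (m : nat) (nu : seq nat).
Implicit Types h g k : hecke m.

Lemma speqE h g : speq nu h g <-> inNbar nu ((h : regV m) - g).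
Proof. by rewrite /speq hsubE. Qed.

Lemma speq_refl h : speq nu h h.
Proof. by apply/speqE; rewrite subrr; exact: inNbar0. Qed.

Lemma speq_sym h g : speq nu h g -> speq nu g h.
Proof. by move=> /speqE /(inNbarZ (-1)) e; apply/speqE; move: e; rewrite scaleN1r opprB. Qed.

Lemma speq_trans g h k : speq nu h g -> speq nu g k -> speq nu h k.
Proof.
by move=> /speqE e1 /speqE e2; apply/speqE; have := inNbarD e1 e2; rewrite addrA subrK.
Qed.

Lemma speq_lin a h h' g g' : speq nu h h' -> speq nu g g' ->
  speq nu (hadd h (hscale a g)) (hadd h' (hscale a g')).
Proof.
move=> /speqE e1 /speqE e2; apply/speqE; rewrite !haddE !hscaleE opprD addrACA -scalerBr.
exact/inNbarD/inNbarZ.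
Qed.

Lemma speq_mulr h g k : speq nu h g -> speq nu (hmul h k) (hmul g k).
Proof.
move=> /speqE e; apply/speqE; have := inNbar_hmulr k e; rewrite !hmul_act.
have := act_linl (regX_module m) k (-1) g h.
by rewrite !scaleN1r ![- _ + _]addrC => ->.
Qed.

End SpechtCongruence.

Section Core.
Variables (n : nat) (lam : seq nat) (dt : 'S_n) (r s : nat).
Hypotheses (pl : is_partition_of n lam) (st : standard lam dt) (rs : (r <= s)%N) (sn : (s <= n)%N).
Let mu := shape_le lam dt s.
Let nu := shape_le lam dt r.
Let d := tle lam dt r.+1 s.

Lemma act_leading : exists2 c : K, c != 0 &
  hact (semX s) (hact (semX s) (delta (rw mu)) (hT d)) (Ev mu d) = c *: delta (tword lam dt r s).
Proof.
have pmu := shape_le_partition pl st sn; have smu : sumn mu = s by case/and3P: pmu => _ _ /eqP.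
have wdE := wd_tle pl st rs sn; have rinc := tle_rowinc pl st rs sn.
have gt := tword_good pl st rs sn.
have [] := @opT_leading s mu d pmu rinc; first by rewrite wdE; case/andP: gt.
rewrite wdE => nz _; exists (opT (semX s) (delta (rw mu)) d (tword lam dt r s)) => //.
rewrite act_hT; have gf : goodf s (opT (semX s) (delta (rw mu)) d).
  by rewrite -act_hT; exact/act_goodf/goodf_delta/rw_good.
move: (opT _ _ _) gf {nz} => f gf.
apply: (@goodf_eq s) => [||w gw]; [exact: act_goodf|exact/goodfZ/goodf_delta|].
rewrite Ev_contproj (act_contproj _ _ gw).
change ((if all (fun p => qint (cont w p) == rv mu d p.+1) (iota 0 s) then f w else 0)
  = f (tword lam dt r s) * delta (tword lam dt r s) w).
have rvE p : (p < s)%N -> rv mu d p.+1 = qint (cont (tword lam dt r s) p).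
  by move=> ps; rewrite -wdE (wd_cont smu rinc ps).
have [->|nw] := eqVneq w (tword lam dt r s).
  rewrite deltaxx mulr1 ifT //; apply/allP => p; rewrite mem_iota => /= ps.
  by rewrite rvE.
rewrite (delta_neq nw) mulr0 ifF //; apply: contraNF nw => /allP al; apply/eqP.
have /andP[/eqP sw yw] := gw; have /andP[/eqP st' yt] := gt.
apply: cont_word_inj; rewrite ?sw ?st' // => p ps.
by have /eqP := al p ltac:(by rewrite mem_iota); rewrite rvE // => /qint_inj.
Qed.

Lemma hmul_hincl (F : hecke s) (h : hecke r) : hmul F (hincl s h) = hact (regX (m := s)) F h.
Proof. by rewrite hmul_act (act_hincl rs (regX_module s)). Qed.

Lemma fv_annihilator (h : hecke r) :
  inNbar mu (hmul (fv mu d) (hincl s h)) <-> inNbar nu (hmul (xnu nu r) h).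
Proof.
have pmu := shape_le_partition pl st sn.
have pnu := shape_le_partition pl st (leq_trans rs sn).
have hX := semX_module s; have [c c0 ec] := act_leading.
have e1 : hact (semX s) (delta (rw mu)) (hmul (hT d) (hmul (Ev mu d) (hincl s h)))
    = c *: hact (semX s) (delta (tword lam dt r s)) h.
  rewrite (act_hmul hX) (act_hmul hX) (act_hincl rs hX).
  apply: etrans (congr1 (fun g => hact (semX s) g h) ec) _.
  exact: (actZl (hecke_module_le rs hX)).
rewrite /fv /ev !hmulA (Specht_annihilator pmu) (Specht_annihilator pnu) e1.
rewrite -(act_delta_cat rs h (rw_good pnu) (tword_good pl st rs sn)) -/(tword lam dt r s).
split=> [/eqP|e]; last by apply: etrans (congr1 _ e) (scaler0 _ c).
by rewrite scaler_eq0 (negbTE c0) => /eqP.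
Qed.
End Core.

Lemma fv_speq n lam (dt : 'S_n) r s (h h' : hecke r) :
  is_partition_of n lam -> standard lam dt -> (r <= s)%N -> (s <= n)%N ->
  let F := fv (shape_le lam dt s) (tle lam dt r.+1 s) in
  let nu := shape_le lam dt r in
  speq (shape_le lam dt s) (hmul F (hincl s h)) (hmul F (hincl s h'))
  <-> speq nu (hmul (xnu nu r) h) (hmul (xnu nu r) h').
Proof.
move=> pl st rs sn F nu; rewrite !speqE !(hmul_hincl rs) -!act_sub.
rewrite -(hmul_hincl rs) (fv_annihilator pl st rs sn) -/nu.
by rewrite !hmul_act act_sub.
Qed.

Theorem theorem3 (zeta : C) (n : nat) (lam : seq nat) (dt : 'S_n) (r s : nat) :
  zeta != 0 ->
  is_partition_of n lam ->
  standard lam dt ->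
  (1 <= r)%N -> (r <= s)%N -> (s <= n)%N ->
  let mu := shape_le lam dt s in        (* lambda^{<= s} *)
  let nu := shape_le lam dt r.-1 in     (* lambda^{< r}  *)
  let F := fv mu (tle lam dt r s) in    (* f_{t^<=} in S^mu *)
  (* U = f_{t^<=} H_{A_zeta, r-1}, as representatives in H_{K,s} *)
  let inU (u : hecke s) := exists h : hecke r.-1,
        inHAz zeta h /\ speq mu u (hmul F (hincl s h)) in
  (* S^nu_{A_zeta} = e_nu H_{A_zeta, r-1}, as representatives in H_{K,r-1} *)
  let inS (y : hecke r.-1) := exists h : hecke r.-1,
        inHAz zeta h /\ speq nu y (hmul (xnu nu r.-1) h) in
  exists phi : hecke s -> hecke r.-1,
    (* the rule f_{t^<=} h |-> e_nu h *)
    (forall h : hecke r.-1, inHAz zeta h ->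
       speq nu (phi (hmul F (hincl s h))) (hmul (xnu nu r.-1) h)) /\
    (* phi is well defined on U (depends only on the class mod bar N_mu) *)
    (forall u u', inU u -> inU u' -> speq mu u u' -> speq nu (phi u) (phi u')) /\
    (* phi maps U into S^nu_{A_zeta} *)
    (forall u, inU u -> inS (phi u)) /\
    (* injective *)
    (forall u u', inU u -> inU u' -> speq nu (phi u) (phi u') -> speq mu u u') /\
    (* surjective *)
    (forall y, inS y -> exists u, inU u /\ speq nu (phi u) y) /\
    (* A_zeta-linear *)
    (forall u u' (a : K), inU u -> inU u' -> inAz zeta a ->
       speq nu (phi (hadd u (hscale a u'))) (hadd (phi u) (hscale a (phi u')))) /\
    (* H_{A_zeta, r-1}-equivariant *)
    (forall u (h : hecke r.-1), inU u -> inHAz zeta h ->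
       speq nu (phi (hmul u (hincl s h))) (hmul (phi u) h)).
Proof.
(* From here on [r] stands for the former [r.-1]. *)
case: r => // r _ pl st _ rs sn mu nu F inU inS; have {}rs := ltnW rs.
change (hecke r.+1.-1) with (hecke r) in *.
pose x := xnu nu r; pose Fh (h : hecke r) := hmul F (hincl s h).
have key (h h' : hecke r) : speq mu (Fh h) (Fh h') <-> speq nu (hmul x h) (hmul x h').
  exact: fv_speq.
have FhE (h : hecke r) : Fh h = hact (regX (m := s)) F h by exact: hmul_hincl.
(* The chosen [h] may have coefficients outside $\mathcal A_\zeta$. By [key] the class of [hmul x h]
   depends only on that of [Fh h], so any integral [h] with the same image gives the same value. The
   default [x] is taken only outside the span of the [Fh h]. *)
pose phi (u : hecke s) : hecke r :=
  if boolp.pselect (exists h : hecke r, speq mu u (Fh h)) is left e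
  then hmul x (projT1 (boolp.cid e)) else x.
have phiP u h : speq mu u (Fh h) -> speq nu (phi u) (hmul x h).
  move=> uh; rewrite /phi; case: boolp.pselect => [e|[]]; last by exists h.
  by case: (boolp.cid e) => h' uh' /=; apply/key; apply: speq_trans (speq_sym uh') uh.
have Flin (a : K) (h h' : hecke r) : Fh (hadd h (hscale a h')) = hadd (Fh h) (hscale a (Fh h')).
  by rewrite !FhE act_add act_scale haddE hscaleE.
have xlin (a : K) (h h' : hecke r) :
    hmul x (hadd h (hscale a h')) = hadd (hmul x h) (hscale a (hmul x h')).
  by rewrite !hmul_act act_add act_scale haddE hscaleE.
exists phi; split=> [h _|]; first exact/phiP/speq_refl.
split=> [u u' [h [_ uh]] _ uu'|].
  by apply: speq_trans (phiP _ _ uh) (speq_sym (phiP _ _ (speq_trans (speq_sym uu') uh))).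
split=> [u [h [hA uh]]|]; first by exists h; split=> //; exact: phiP.
split=> [u u' [h [_ uh]] [h' [_ uh']] e|].
  apply: (speq_trans uh); apply: speq_trans _ (speq_sym uh'); apply/key.
  exact: speq_trans (speq_sym (phiP _ _ uh)) (speq_trans e (phiP _ _ uh')).
split=> [y [h [hA yh]]|].
  exists (Fh h); split; first by exists h; split=> //; exact: speq_refl.
  by apply: speq_trans (phiP _ _ (speq_refl _ _)) (speq_sym yh).
split=> [u u' a [h [_ uh]] [h' [_ uh']] _|u g [h [_ uh]] _].
  have := speq_lin a uh uh'; rewrite -Flin => /phiP /speq_trans; apply.
  by rewrite xlin; apply/speq_sym/speq_lin; exact: phiP.
have : speq mu (hmul u (hincl s g)) (Fh (hmul h g)).
  rewrite FhE (act_hmul (hecke_module_le rs (regX_module s))) -FhE -(hmul_hincl rs).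
  exact: speq_mulr.
by move/phiP/speq_trans; apply; rewrite -hmulA; apply/speq_sym/speq_mulr/phiP.
Qed.
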